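(* For all integers $s\geq 1$ with $s\notin\{4,7,10\}$, $$\widehat{\alpha}(s) \geq \lfloor \sqrt{2.5\,s} \rfloor,$$ where $\widehat{\alpha}(s)$ denotes the Waldschmidt constant of the ideal of $s$ very general lines in $\mathbb{P}^3$.
   Context: Let $\mathbb{K}$ be an uncountable algebraically closed field of characteristic $0$ and $R=\mathbb{K}[x_0,\dots,x_3]$. For a homogeneous ideal $I\subset R$, the $m$-th symbolic power is $I^{(m)}=R\cap\bigcap_{P\in\mathrm{Ass}(I)}I^mR_P$ (intersection taken in the fraction field of $R$). The initial degree of a nonzero homogeneous ideal $I$ is $\alpha(I)=\min\{t: (I)_t\neq 0\}$, where $(I)_t$ is the degree $t$ part of $I$. The Waldschmidt constant of $I$ is $\widehat{\alpha}(I)=\lim_{m\to\infty}\alpha(I^{(m)})/m$ (the limit exists). ''Very general'' means: outside a countable union of proper Zariski closed subsets of the parameter space (here the product of $s$ copies of the Grassmannian of lines in $\mathbb{P}^3$). For an integer $s\ge 1$, $\widehat{\alpha}(s)$ denotes the Waldschmidt constant of the radical ideal of the union of $s$ very general lines in $\mathbb{P}^3$. *)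

(* Defs.v *)
From HB Require Import structures.
From mathcomp Require Import all_boot all_order all_algebra.
(* mpoly has to be imported before MathComp-Analysis: in the other order the
   notations of the two libraries clash. *)
From mathcomp Require Import mpoly.
From mathcomp Require Import all_classical all_reals all_analysis.

Set Implicit Arguments.
Unset Strict Implicit.
Unset Printing Implicit Defensive.

Import Order.TTheory GRing.Theory Num.Theory.
Import numFieldNormedType.Exports.

Local Open Scope classical_set_scope.
Local Open Scope ring_scope.

Section Ideals.
Variable A : idomainType.
Implicit Types (I P : set A) (m : nat).

(* I need not be an ideal; for m = 0 this is the whole ring. *)
Definition ideal_power I m : set A :=
  [set f | exists (n : nat) (c : 'I_n -> A) (g : 'I_n -> 'I_m -> A),
     (forall i j, I (g i j)) /\ f = \sum_i c i * \prod_j g i j].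

(* Ass(I) stands for Ass(A / I): the primes that are annihilators of the class
   of some x modulo I. [idealr_closed] includes properness. *)
Definition associated_prime I P : Prop :=
  [/\ idealr_closed (mem P), prime_idealr_closed (mem P)
    & exists x : A, P = [set f | I (f * x)]].

(* The elements of A whose image in the fraction field lies, for every P in
   Ass(I), in I^m A_P = {a / b | a in I^m, b not in P}. *)
Definition symbolic_power I m : set A :=
  [set f | forall P, associated_prime I P ->
     exists a b : A, [/\ ideal_power I m a, ~ P b &
       @tofrac A f = @tofrac A a / @tofrac A b]].

End Ideals.

(* The value 0 is used only when J has no nonzero homogeneous element. *)
Definition initial_degree (K : fieldType) (n : nat) (J : set {mpoly K[n]})
    : nat :=
  let degrees := [set t | exists f, [/\ J f, f \is t.-homog & f != 0]] in
  xget 0%N (degrees `&` lbound degrees).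

Definition waldschmidt (R : realType) (K : fieldType) (n : nat)
    (I : set {mpoly K[n]}) : R :=
  lim ((fun m : nat =>
          (initial_degree (symbolic_power I m))%:R / m%:R : R) @ \oo).

Section Lines.
Variable K : fieldType.

(* The lines of P^3, as 2-dimensional subspaces of K^4. *)
Definition line : Type := {U : {vspace 'rV[K]_4} | \dim U == 2%N}.

(* The homogeneous radical ideal of the union of the lines: the polynomials
   that vanish on the affine cone over that union. *)
Definition lines_ideal (s : nat) (L : 'I_s -> line) : set {mpoly K[4]} :=
  [set f | forall (i : 'I_s) (v : 'rV[K]_4), v \in val (L i) -> f.@[v 0] = 0].

Definition pluecker_pairs : seq (nat * nat) :=
  [:: (0, 1); (0, 2); (0, 3); (1, 2); (1, 3); (2, 3)]%N.

(* Well defined only up to a nonzero scalar; [vbasis] fixes a representative. *)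
Definition pluecker (l : line) : 'rV[K]_6 :=
  let u := (vbasis (val l))`_0 in
  let v := (vbasis (val l))`_1 in
  \row_k let: (i, j) := nth (0, 0)%N pluecker_pairs k in
         u 0 (inord i) * v 0 (inord j) - u 0 (inord j) * v 0 (inord i).

(* Polynomials in s groups of 6 variables, the j-th variable of the i-th group
   having index [mxvec_index i j], that are homogeneous in each group. *)
Definition multihomogeneous (s : nat) (F : {mpoly K[s * 6]}) : Prop :=
  forall i : 'I_s, exists d : nat, forall e, e \in msupp F ->
    (\sum_(j < 6) e (mxvec_index i j) = d)%N.

(* Closed subsets of the product of s copies of the Grassmannian, embedded in
   the product of s copies of P^5 by the Pluecker coordinates. *)
Definition zariski_closed (s : nat) (Z : set ('I_s -> line)) : Prop :=
  exists S : set {mpoly K[s * 6]},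
    (forall F, S F -> multihomogeneous F) /\
    Z = [set L | forall F, S F ->
           F.@[mxvec (\matrix_(i < s) pluecker (L i)) 0] = 0].

Definition very_general (s : nat) (Q : ('I_s -> line) -> Prop) : Prop :=
  exists Z : nat -> set ('I_s -> line),
    (forall k, zariski_closed (Z k) /\ Z k <> setT) /\
    (forall L, ~ (\bigcup_k Z k) L -> Q L).

End Lines.

(* The common value of the Waldschmidt constants of s very general lines. It is
   unique over an uncountable algebraically closed field, where no countable
   union of proper closed subsets of the parameter space is everything; the
   value would be 0 if it did not exist. *)
Definition waldschmidt_lines (R : realType) (K : fieldType) (s : nat) : R :=
  xget 0 [set c : R |
    very_general (fun L : 'I_s -> line K => waldschmidt R (lines_ideal L) = c)].

(* Main.v *)
(* For each m the maximal value v_m of alpha(I^(m)) over all s-tuples of lines is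
   attained off a proper closed set, v is subadditive, and the constant is
   lim v_m / m. With q = floor (sqrt (5 s / 2)) it therefore suffices to exhibit,
   for every m, some s lines along which no nonzero form of degree < q m vanishes
   to order m. The lines are put on quadrics and planes of total degree q, those
   on a quadric in one ruling and those on a plane through a common point. If
   such a form restricts to 0 on every surface, it is divisible by all of them;
   the quotient has degree < q (m - 1) and vanishes to order m - 1, and one
   concludes by induction. On one surface, the restriction divided by the
   equations of its own lines is a polynomial in two variables vanishing to order
   m at the points where the other lines meet the surface. That it must be 0 is
   an open condition on the configuration, so it can be checked for each surface
   on a special configuration whose points lie on a grid; there the lines of
   the grid contain too many points and split off one after the other. The sizes
   n, k, e, r (n quadrics with k lines, e planes with r lines) are governed by
   linear inequalities and by n k + e r <= s, where 5 s >= 2 q^2. *)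

Require Import Defs.
From HB Require Import structures.
From mathcomp Require Import all_boot all_order all_algebra perm.
From mathcomp Require Import mpoly.
From mathcomp Require Import all_classical all_reals all_analysis.
From mathcomp Require Import ring lra zify.

Set Implicit Arguments.
Unset Strict Implicit.
Unset Printing Implicit Defensive.

Import Order.TTheory GRing.Theory Num.Theory.
Import numFieldNormedType.Exports.

Local Open Scope classical_set_scope.
Local Open Scope ring_scope.

(** * Polynomial functions and minors *)

(** The two points where a line meets a quadric are only quadratic over the coefficients of the
    line, which obstructs the openness argument. Vanishing at both is split into the even and the
    odd part in the square root of the discriminant, and inverse matrices are replaced by adjugates.
    The conditions then form a linear system for the residual polynomial, with entries polynomial on
    a whole vector space of configurations. Injectivity of such a system is witnessed by one nonzero
    minor, so one special configuration per surface and per order suffices, and its matrices may be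
    singular. The constant 5/2 is within reach by the following count: about q/3 quadrics with 2q/3
    lines each and q/3 planes with q/2 lines each use 7q^2/18 lines, less than 2q^2/5. The margin
    q^2/90 absorbs the rounding from q = 40 on; smaller q are treated by a table. For q = 3, 4, 5
    the configurations used have 5, 8, 11 lines, one more than the ceiling of 2q^2/5; this is where
    s = 4, 7, 10 are lost. *)

Section LinePolynomials.
Variable K : fieldType.
Hypothesis K_char0 : [pchar K] =i pred0.

Lemma natr_inj_char0 : injective (fun n : nat => n%:R : K).
Proof.
have H0 : forall n : nat, n%:R = 0 :> K -> n = 0%N by move=> n /eqP; rewrite (iffLR (pcharf0P K) K_char0) => /eqP.
have H : forall m n : nat, (m <= n)%N -> m%:R = n%:R :> K -> m = n.
  move=> m n le_mn /eqP; rewrite eq_sym -subr_eq0 -natrB // => /eqP/H0 /eqP.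
  by rewrite subn_eq0 => le_nm; apply/eqP; rewrite eqn_leq le_mn.
move=> m n Emn; case: (leqP m n) => [|/ltnW] le; first exact: H.
by apply/esym/H.
Qed.

Lemma poly_nonroot (p : {poly K}) : p != 0 -> exists x, p.[x] != 0.
Proof.
move=> p0; pose rs := [seq (i%:R : K) | i <- iota 0 (size p)].
have [/allP|/allPn [x _ nx]] := boolP (all (root p) rs); last by exists x.
move=> rp; have := max_poly_roots p0 (introT allP rp) _.
rewrite map_inj_uniq ?iota_uniq; last exact: natr_inj_char0.
by rewrite size_map size_iota ltnn => /(_ isT).
Qed.

Lemma poly_zero_fun (p : {poly K}) : (forall x, p.[x] = 0) -> p = 0.
Proof.
by move=> H; apply/eqP/negPn/negP => /poly_nonroot [x]; rewrite H eqxx.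
Qed.

(* Polynomial functions only enter through their restrictions to affine
   lines, which spares fixing coordinates on the source space. *)
Definition linepoly (V : lmodType K) (F : V -> K) : Prop :=
  forall a b : V, exists p : {poly K}, forall x : K, F (a + x *: b) = p.[x].

Section Closure.
Variable V : lmodType K.
Implicit Types F G : V -> K.

Lemma linepoly_cst (c : K) : linepoly (fun _ : V => c).
Proof. by move=> a b; exists c%:P => x; rewrite hornerC. Qed.

Lemma linepoly_ext F G : F =1 G -> linepoly F -> linepoly G.
Proof. by move=> E H a b; have [p Hp] := H a b; exists p => x; rewrite -E. Qed.

Lemma linepolyD F G : linepoly F -> linepoly G -> linepoly (fun v => F v + G v).
Proof.
move=> HF HG a b; have [[p Hp] [q Hq]] := (HF a b, HG a b).
by exists (p + q) => x; rewrite hornerD Hp Hq.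
Qed.

Lemma linepolyM F G : linepoly F -> linepoly G -> linepoly (fun v => F v * G v).
Proof.
move=> HF HG a b; have [[p Hp] [q Hq]] := (HF a b, HG a b).
by exists (p * q) => x; rewrite hornerM Hp Hq.
Qed.

Lemma linepolyN F : linepoly F -> linepoly (fun v => - F v).
Proof.
by move=> HF a b; have [p Hp] := HF a b; exists (- p) => x; rewrite hornerN Hp.
Qed.

Lemma linepoly_sum (I : Type) (r : seq I) (P : pred I) (F : I -> V -> K) :
  (forall i, linepoly (F i)) -> linepoly (fun v => \sum_(i <- r | P i) F i v).
Proof.
move=> HF; elim: r => [|i r IH].
  by apply: (linepoly_ext _ (linepoly_cst 0)) => v; rewrite big_nil.
case Pi: (P i).
  by apply: (linepoly_ext _ (linepolyD (HF i) IH)) => v; rewrite big_cons Pi.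
by apply: (linepoly_ext _ IH) => v; rewrite big_cons Pi.
Qed.

Lemma linepoly_prod (I : Type) (r : seq I) (P : pred I) (F : I -> V -> K) :
  (forall i, linepoly (F i)) -> linepoly (fun v => \prod_(i <- r | P i) F i v).
Proof.
move=> HF; elim: r => [|i r IH].
  by apply: (linepoly_ext _ (linepoly_cst 1)) => v; rewrite big_nil.
case Pi: (P i).
  by apply: (linepoly_ext _ (linepolyM (HF i) IH)) => v; rewrite big_cons Pi.
by apply: (linepoly_ext _ IH) => v; rewrite big_cons Pi.
Qed.

Lemma linepolyX F n : linepoly F -> linepoly (fun v => F v ^+ n).
Proof.
move=> HF a b; have [p Hp] := HF a b.
by exists (p ^+ n) => x; rewrite horner_exp Hp.
Qed.

Lemma linepoly_det n (F : 'I_n -> 'I_n -> V -> K) :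
  (forall i j, linepoly (F i j)) ->
  linepoly (fun v => \det (\matrix_(i, j) F i j v)).
Proof.
move=> HF; apply: (@linepoly_ext (fun v =>
  \sum_(s : {perm 'I_n}) (-1) ^+ s * \prod_i F i (s i) v)) => [v|].
  by rewrite /determinant; apply: eq_bigr => s _; congr (_ * _);
    apply: eq_bigr => i _; rewrite mxE.
apply: linepoly_sum => s; apply: linepolyM; first exact: linepoly_cst.
by apply: linepoly_prod => i.
Qed.

Lemma linepoly_meval n (f : {mpoly K[n]}) (F : 'I_n -> V -> K) :
  (forall i, linepoly (F i)) -> linepoly (fun v => f.@[fun i => F i v]).
Proof.
move=> HF; apply: (@linepoly_ext (fun v =>
  \sum_(m <- msupp f) f@_m * \prod_i F i v ^+ m i)) => [v|].
  by rewrite mevalE.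
apply: linepoly_sum => m; apply: linepolyM; first exact: linepoly_cst.
by apply: linepoly_prod => i; apply: linepolyX.
Qed.

(** A common nonzero point v of some of the functions and a nonzero point w of one more are joined
    by an affine line. On it all these functions are nonzero univariate polynomials, and their
    product has a nonroot. *)
Lemma linepoly_nonzero (I : finType) (F : I -> V -> K) :
  (forall i, linepoly (F i)) -> (forall i, exists v, F i v != 0) ->
  exists v, forall i, F i v != 0.
Proof.
move=> HF HE.
suff [v Hv] : exists v, forall i, i \in enum I -> F i v != 0.
  by exists v => i; apply: Hv; rewrite mem_enum.
elim: (enum I) => [|i s [v Hv]]; first by exists 0.
have [w Hw] := HE i.
have /choice [p Hp] : forall j, exists p : {poly K}, forall x,
  F j (v + x *: (w - v)) = p.[x] by move=> j; apply: HF.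
pose q := p i * \prod_(j <- s) p j.
have pi0 : p i != 0.
  apply: contraNneq Hw => p0; have := Hp i 1.
  by rewrite p0 horner0 scale1r addrC subrK => ->.
have q0 : q != 0.
  rewrite mulf_neq0 //; rewrite prodf_seq_neq0; apply/allP => j js /=.
  apply: contraNneq (Hv j js) => p0; have := Hp j 0.
  by rewrite p0 horner0 scale0r addr0 => ->.
have [x] := poly_nonroot q0.
rewrite /q hornerM mulf_eq0 negb_or horner_prod prodf_seq_neq0.
move=> /andP[Hi /allP Hs]; exists (v + x *: (w - v)) => j.
by rewrite in_cons => /predU1P[->|js]; rewrite Hp //; apply: (Hs j js).
Qed.

End Closure.
End LinePolynomials.

Section Minors.
Variable K : fieldType.

(** The index type may be infinite: here an infinite linear system is cut down to a square one.
    Fewer than n independent rows kill some nonzero vector, and a row of the system that does not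
    kill it can be adjoined. *)
Lemma nonzero_minor (I : Type) (n : nat) (rho : I -> 'rV[K]_n) :
  (forall x : 'cV_n, (forall i, rho i *m x = 0) -> x = 0) ->
  exists r : 'I_n -> I, \det (\matrix_i rho (r i)) != 0.
Proof.
move=> H; suff: forall k, (k <= n)%N ->
  exists r : 'I_k -> I, row_free (\matrix_i rho (r i)).
  move=> /(_ n (leqnn n)) [r]; rewrite row_free_unit unitmxE unitfE => d.
  by exists r.
elim=> [|k IH] lt_kn.
  by exists (fun i : 'I_0 => match i with Ordinal m lt => match notF lt with end end);
    rewrite /row_free flatmx0 mxrank0.
have [r rfree] := IH (ltnW lt_kn); set M := \matrix_i _ in rfree.
have : kermx M^T != 0.
  rewrite kermx_eq0 /row_free mxrank_tr.
  by move/eqP: rfree => ->; rewrite neq_ltn lt_kn.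
move=> /rowV0Pn [v /sub_kermxP vM v0].
have [i Hi] : exists i, ~ (rho i *m v^T = 0).
  apply/existsNP => E; move/negP: v0; apply.
  by rewrite -(trmxK v) (H _ E) trmx0.
pose r' (j : 'I_k.+1) := if unlift ord_max j is Some j' then r j' else i.
exists r'; apply: inj_row_free => u uM.
have E0 : (\sum_j u 0 (lift ord_max j) *: rho (r j)) + u 0 ord_max *: rho i = 0.
  rewrite -[RHS]uM mulmx_sum_row big_ord_recr /= rowK /r' unlift_none.
  congr (_ + _); apply: eq_bigr => j _; rewrite rowK.
  have -> : widen_ord (leqnSn k) j = lift ord_max j.
    by apply: val_inj; rewrite /= /bump leqNgt ltn_ord.
  by rewrite liftK.
have Mv : forall j, rho (r j) *m v^T = 0.
  move=> j; have <- : row j M = rho (r j) by rewrite rowK.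
  by rewrite -row_mul -[M]trmxK -trmx_mul vM trmx0 row0.
have um : u 0 ord_max = 0.
  have := congr1 (fun A => A *m v^T) E0; rewrite mul0mx mulmxDl mulmx_suml.
  rewrite big1 => [|j _]; last by rewrite -scalemxAl Mv scaler0.
  rewrite add0r -scalemxAl => /eqP; rewrite scaler_eq0 => /orP[/eqP //|/eqP //].
have ul : \row_j u 0 (lift ord_max j) = 0.
  apply: (row_free_inj rfree); rewrite mul0mx mulmx_sum_row.
  rewrite -[RHS]E0 um scale0r addr0; apply: eq_bigr => j _.
  by rewrite mxE rowK.
apply/rowP => j; rewrite mxE; case: (unliftP ord_max j) => [j' ->|->] //.
by have := congr1 (fun A : 'rV_k => A 0 j') ul; rewrite !mxE.
Qed.

End Minors.

(** * Vanishing of polynomials in two variables *)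

Section LinearFactors.
Variable R : idomainType.

Lemma XsubC_exp_cancel (r : R) (M : nat) (Q H E : {poly R}) :
  H * E = Q * ('X - r%:P) ^+ M -> E.[r] != 0 ->
  exists H', H = H' * ('X - r%:P) ^+ M.
Proof.
move=> EQ Er; elim: M Q H EQ => [|M IH] Q H EQ; first by exists H; rewrite mulr1.
have /factor_theorem [H1 HE] : root H r.
  have := congr1 (fun p => p.[r]) EQ.
  rewrite !hornerM horner_exp hornerXsubC subrr expr0n mulr0 => /eqP.
  by rewrite mulf_eq0 (negPf Er) orbF.
have [|H' H1E] := IH Q H1.
  apply: (mulIf (negbT (polyXsubC_eq0 r))).
  by rewrite -[RHS]mulrA -exprSr -EQ HE mulrAC.
by exists H'; rewrite HE H1E exprSr mulrA.
Qed.

Lemma prod_XsubC_exp_dvd (rs : seq R) (M : nat) (G : {poly R}) : uniq rs ->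
  (forall r, r \in rs -> exists Q, G = Q * ('X - r%:P) ^+ M) ->
  exists Q, G = Q * (\prod_(r <- rs) ('X - r%:P)) ^+ M.
Proof.
elim: rs => [|r rs IH] /=; first by exists G; rewrite big_nil expr1n mulr1.
move=> /andP[nr urs] HG.
have [|Q HQ] := IH urs; first by move=> s srs; apply: HG; rewrite inE srs orbT.
have [Q' HQ'] := HG r (mem_head _ _).
have [||Q1 HQ1] := @XsubC_exp_cancel r M Q' Q ((\prod_(r <- rs) ('X - r%:P)) ^+ M).
- by rewrite -HQ.
- rewrite horner_exp expf_neq0 // horner_prod prodf_seq_neq0.
  apply/allP => s srs; rewrite /= hornerXsubC subr_eq0.
  by apply: contraNneq nr => ->.
by exists Q1; rewrite big_cons exprMn mulrA -HQ1.
Qed.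

Lemma multiple_roots_size (rs : seq R) (M : nat) (p : {poly R}) : uniq rs ->
  (forall r, r \in rs -> exists Q, p = Q * ('X - r%:P) ^+ M) ->
  (size p <= size rs * M)%N -> p = 0.
Proof.
move=> urs H sz; have [Q E] := prod_XsubC_exp_dvd urs H.
apply/eqP/negPn/negP => p0; have Q0 : Q != 0 by apply: contraNneq p0 => Q0; rewrite E Q0 mul0r.
move: sz; rewrite E size_Mmonic //; last by rewrite monic_exp // monic_prod_XsubC.
have := size_exp (\prod_(r <- rs) ('X - r%:P)) M.
rewrite size_prod_XsubC /= => se.
have : (0 < size Q)%N by rewrite size_poly_gt0.
have : (0 < size ((\prod_(r <- rs) ('X - r%:P)) ^+ M)%R)%N.
  by rewrite size_poly_gt0 expf_neq0 // monic_neq0 // monic_prod_XsubC.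
rewrite -se; set c := size (polyseq (_ ^+ M)); case: (size Q) => // a; case: c => // b _ _ /=.
by rewrite addnS ltnNge leq_addl.
Qed.

End LinearFactors.

Section Bivariate.
Variable K : fieldType.
Implicit Types (G H : {poly {poly K}}) (m : nat).

Definition shift2 (x0 y0 : K) G : {poly {poly K}} :=
  (map_poly (comp_poly ('X + x0%:P)) G) \Po ('X + (y0%:P)%:P).

(* The coefficient of x^u y^v in G : {poly {poly K}} is G`_v`_u. *)
Definition vanish2 G (x0 y0 : K) m :=
  forall i j, (i + j < m)%N -> (shift2 x0 y0 G)`_j`_i = 0.

Lemma shift2M x0 y0 G H : shift2 x0 y0 (G * H) = shift2 x0 y0 G * shift2 x0 y0 H.
Proof. by rewrite /shift2 rmorphM /= comp_polyM. Qed.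

Lemma shift2D x0 y0 G H : shift2 x0 y0 (G + H) = shift2 x0 y0 G + shift2 x0 y0 H.
Proof. by rewrite /shift2 rmorphD /= comp_polyD. Qed.

Lemma coef2M G H i j : (G * H)`_j`_i =
  \sum_(k < j.+1) \sum_(l < i.+1) G`_k`_l * H`_(j - k)`_(i - l).
Proof. by rewrite coefM coef_sum; apply: eq_bigr => k _; rewrite coefM. Qed.

Lemma vanish2M G H x0 y0 m n :
  vanish2 G x0 y0 m -> vanish2 H x0 y0 n -> vanish2 (G * H) x0 y0 (m + n).
Proof.
move=> HG HH i j ltij; rewrite shift2M coef2M big1 // => k _.
rewrite big1 // => l _; case: (ltnP (l + k) m) => lk; first by rewrite HG ?mul0r.
rewrite HH ?mulr0 //; have := ltn_ord k; have := ltn_ord l; lia.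
Qed.

Lemma vanish2D G H x0 y0 m :
  vanish2 G x0 y0 m -> vanish2 H x0 y0 m -> vanish2 (G + H) x0 y0 m.
Proof. by move=> HG HH i j lt; rewrite shift2D !coefD HG ?HH ?addr0. Qed.

Lemma vanish2_zero x0 y0 m : vanish2 0 x0 y0 m.
Proof. by move=> i j _; rewrite /shift2 rmorph0 comp_poly0 !coef0. Qed.

Lemma vanish2_sum (I : Type) (r : seq I) (P : pred I) (F : I -> {poly {poly K}}) x0 y0 m :
  (forall i, P i -> vanish2 (F i) x0 y0 m) ->
  vanish2 (\sum_(i <- r | P i) F i) x0 y0 m.
Proof.
move=> H; apply: (big_ind (fun G => vanish2 G x0 y0 m)) => //.
- exact: vanish2_zero.
- by move=> *; apply: vanish2D.
Qed.

Lemma vanish2_prod m (F : 'I_m -> {poly {poly K}}) x0 y0 :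
  (forall i, vanish2 (F i) x0 y0 1) -> vanish2 (\prod_i F i) x0 y0 m.
Proof.
elim: m F => [|m IH] F H //.
by rewrite big_ord_recl; apply: (@vanish2M _ _ _ _ 1 m) => //; apply: IH.
Qed.

Lemma vanish2_Ml G H x0 y0 m : vanish2 H x0 y0 m -> vanish2 (G * H) x0 y0 m.
Proof. by move=> h; rewrite -[m]add0n; apply: vanish2M. Qed.

Lemma shift2_00 x0 y0 G : (shift2 x0 y0 G)`_0`_0 = G.[y0%:P].[x0].
Proof.
rewrite -horner_coef0 -horner_coef0 /shift2 horner_comp !hornerE.
have := horner_map (comp_poly ('X + x0%:P)) G y0%:P.
rewrite /= comp_polyC => ->.
by rewrite horner_comp !hornerE.
Qed.

Lemma vanish2_1 G x0 y0 : G.[y0%:P].[x0] = 0 -> vanish2 G x0 y0 1.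
Proof. by move=> E [|i] [|j] //; rewrite shift2_00. Qed.

(** The Taylor expansion of H at the point has an invertible constant term, so the coefficients of G
    vanish by induction on i + j. *)
Lemma vanish2_unit G H x0 y0 m : H.[y0%:P].[x0] != 0 ->
  vanish2 (H * G) x0 y0 m -> vanish2 G x0 y0 m.
Proof.
rewrite -shift2_00 => H0 HG.
suff A : forall n i j, (i + j <= n)%N -> (n < m)%N -> (shift2 x0 y0 G)`_j`_i = 0.
  by move=> i j lt; apply: (A (i + j)%N).
elim/ltn_ind => n IH i j le lt; have := HG i j (leq_ltn_trans le lt).
rewrite shift2M coef2M big_ord_recl big_ord_recl /= !subn0.
rewrite big1 => [|l _]; last first.
  rewrite (IH (n.-1)) ?mulr0 //; have := ltn_ord l; rewrite /bump /=; lia.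
rewrite big1 => [|k _]; last first.
  rewrite big1 // => l _; rewrite (IH (n.-1)) ?mulr0 //;
  have := ltn_ord l; have := ltn_ord k; rewrite /bump /=; lia.
by rewrite !addr0 => /eqP; rewrite mulf_eq0 (negPf H0) => /eqP.
Qed.

Lemma shift2_Y x0 y0 d :
  shift2 x0 y0 ('X - (d%:P)%:P) = 'X + ((y0 - d)%:P)%:P.
Proof.
rewrite /shift2 rmorphB /= map_polyX map_polyC /= comp_polyC.
rewrite comp_polyB comp_polyX comp_polyC !polyCB.
exact: (esym (addrA _ _ _)).
Qed.

Lemma shift2_X x0 y0 c :
  shift2 x0 y0 ('X - c%:P)%:P = ('X + (x0 - c)%:P)%:P.
Proof.
rewrite /shift2 map_polyC /= comp_polyB comp_polyX comp_polyC comp_polyC.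
by rewrite [(x0 - c)%:P]polyCB; exact: (congr1 (@polyC _) (esym (addrA _ _ _))).
Qed.

Lemma vanish2_divY G x0 y0 m :
  vanish2 (('X - (y0%:P)%:P) * G) x0 y0 m.+1 -> vanish2 G x0 y0 m.
Proof.
move=> H i j lt; have := H i j.+1; rewrite addnS ltnS => /(_ lt).
by rewrite shift2M shift2_Y subrr !polyC0 addr0 coefXM.
Qed.

Lemma vanish2_divX G x0 y0 m :
  vanish2 (('X - x0%:P)%:P * G) x0 y0 m.+1 -> vanish2 G x0 y0 m.
Proof.
move=> H i j lt; have := H i.+1 j; rewrite addSn ltnS => /(_ lt).
by rewrite shift2M shift2_X subrr polyC0 addr0 coefCM coefXM.
Qed.

Lemma vanish2_vert G x0 y0 m : vanish2 G x0 y0 m ->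
  exists Q, map_poly (fun p : {poly K} => p.[x0]) G = Q * ('X - y0%:P) ^+ m.
Proof.
move=> H; pose g := map_poly (horner_eval x0) G.
have gE : g \Po ('X + y0%:P) = map_poly (horner_eval 0) (shift2 x0 y0 G).
  rewrite /shift2 map_comp_poly rmorphD /= map_polyX map_polyC /= /horner_eval hornerC.
  congr (_ \Po _); apply/polyP => j.
  rewrite (@coef_map_id0 _ _ (fun p : {poly K} => p.[0])) ?horner0 // coef_map /=.
  by rewrite /g coef_map /= /horner_eval horner_comp !hornerE.
have : forall j, (j < m)%N -> (g \Po ('X + y0%:P))`_j = 0.
  by move=> j lt; rewrite gE coef_map /= /horner_eval horner_coef0 H.
move=> Hj; pose h := g \Po ('X + y0%:P).
have hE : h = drop_poly m h * 'X^m.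
  rewrite -{1}[h](poly_take_drop m); set t := take_poly m h.
  suff -> : t = 0 by rewrite add0r.
  by apply/polyP => j; rewrite coef_take_poly coef0; case: ifP => // /Hj.
exists (drop_poly m h \Po ('X - y0%:P)).
have <- : g = map_poly (fun p : {poly K} => p.[x0]) G by [].
have {1}-> : g = h \Po ('X - y0%:P).
  by rewrite /h -comp_polyA comp_polyD comp_polyX comp_polyC subrK comp_polyXr.
by rewrite {1}hE comp_polyM comp_Xn_poly.
Qed.

Lemma vanish2_horiz G x0 y0 m : vanish2 G x0 y0 m ->
  exists Q, G.[y0%:P] = Q * ('X - x0%:P) ^+ m.
Proof.
move=> H; pose g := G.[y0%:P].
have gE : g \Po ('X + x0%:P) = (shift2 x0 y0 G)`_0.
  rewrite -horner_coef0 /shift2 horner_comp !hornerE.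
  by have := horner_map (comp_poly ('X + x0%:P)) G y0%:P; rewrite /= comp_polyC => ->.
have Hj : forall j, (j < m)%N -> (g \Po ('X + x0%:P))`_j = 0.
  by move=> j lt; rewrite gE H ?addn0.
pose h := g \Po ('X + x0%:P).
have hE : h = drop_poly m h * 'X^m.
  rewrite -{1}[h](poly_take_drop m); set t := take_poly m h.
  suff -> : t = 0 by rewrite add0r.
  by apply/polyP => j; rewrite coef_take_poly coef0; case: ifP => // /Hj.
exists (drop_poly m h \Po ('X - x0%:P)).
have {1}-> : G.[y0%:P] = h \Po ('X - x0%:P).
  by rewrite /h -comp_polyA comp_polyD comp_polyX comp_polyC subrK comp_polyXr.
by rewrite {1}hE comp_polyM comp_Xn_poly.
Qed.

Lemma div_vert G c : map_poly (fun p : {poly K} => p.[c]) G = 0 ->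
  exists G', G = ('X - c%:P)%:P * G'.
Proof.
move=> H; exists (\poly_(v < size G) (G`_v %/ ('X - c%:P))).
apply/polyP => v; rewrite coefCM coef_poly.
case: ltnP => [_|le]; last by rewrite mulr0 nth_default.
rewrite mulrC divpK // dvdp_XsubCl; apply/rootP.
by have := congr1 (fun p : {poly K} => p`_v) H;
   rewrite coef0 (@coef_map_id0 _ _ (fun p : {poly K} => p.[c])) ?horner0.
Qed.

(** The coefficient of the product at u + 1 is that of G at u minus c times that of G at u + 1,
    which allows a descending induction on u from beyond the size. Letting Z be any set closed under
    raising u serves both boxes (quadrics) and triangles (planes). *)
Lemma div_vert_coef0 G c (Z : nat -> nat -> bool) :
  (forall u v, Z u v -> Z u.+1 v) ->
  (forall u v, Z u v -> (('X - c%:P)%:P * G)`_v`_u.+1 = 0) ->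
  forall u v, Z u v -> G`_v`_u = 0.
Proof.
move=> Zup H u v Zuv.
suff A : forall n u, Z u v -> (size (G`_v)%R <= u + n)%N -> G`_v`_u = 0.
  by apply: (A (size (G`_v)%R)) => //; rewrite leq_addl.
elim=> [|n IH] {Zuv}u Zuv le; first by rewrite nth_default // -[u]addn0.
have := H u v Zuv; rewrite coefCM mulrBl coefB coefXM /= coefCM.
by rewrite (IH u.+1) ?mulr0 ?subr0 ?Zup // addSn -addnS.
Qed.

Lemma div_horiz_coef0 G d (Z : nat -> nat -> bool) :
  (forall u v, Z u v -> Z u v.+1) ->
  (forall u v, Z u v -> (('X - (d%:P)%:P) * G)`_v.+1`_u = 0) ->
  forall u v, Z u v -> G`_v`_u = 0.
Proof.
move=> Zup H u v Zuv.
suff A : forall n v, Z u v -> (size G <= v + n)%N -> G`_v`_u = 0.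
  by apply: (A (size G)) => //; rewrite leq_addl.
elim=> [|n IH] {Zuv}v Zuv le.
  by rewrite [G`_v]nth_default ?coef0 // -[v]addn0.
have := H u v Zuv; rewrite mulrBl coefB coefXM /= coefCM coefB coefCM.
by rewrite (IH v.+1) ?mulr0 ?subr0 ?Zup // addSn -addnS.
Qed.

End Bivariate.

Section Grids.
Variable K : fieldType.
Implicit Types (G H : {poly {poly K}}) (m : nat) (cs ds : seq K).

Lemma prod_vert_coef0 G cs (Z : nat -> nat -> bool) :
  (forall u v, Z u v -> Z u.+1 v) ->
  (forall u v, Z u v ->
     ((\prod_(c <- cs) ('X - c%:P))%:P * G)`_v`_(u + size cs) = 0) ->
  forall u v, Z u v -> G`_v`_u = 0.
Proof.
move=> Zup; elim: cs => [|c cs IH] H.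
  by move=> u v /H; rewrite big_nil mul1r addn0.
apply: IH => u v Zuv.
pose Z' u' v' := (size cs <= u')%N && Z (u' - size cs)%N v'.
apply: (@div_vert_coef0 _ _ c Z').
- move=> u' v' /andP[le Zu']; rewrite /Z' (leq_trans le) //.
  by rewrite subSn //= Zup.
- move=> u' v' /andP[le Zu']; have := H _ _ Zu'.
  by rewrite big_cons polyCM -mulrA /= -addSnnS addSn subnK.
- by rewrite /Z' leq_addl addnK.
Qed.

Lemma prod_horiz_coef0 G ds (Z : nat -> nat -> bool) :
  (forall u v, Z u v -> Z u v.+1) ->
  (forall u v, Z u v ->
     ((\prod_(d <- ds) ('X - (d%:P)%:P)) * G)`_(v + size ds)`_u = 0) ->
  forall u v, Z u v -> G`_v`_u = 0.
Proof.
move=> Zup; elim: ds => [|d ds IH] H.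
  by move=> u v /H; rewrite big_nil mul1r addn0.
apply: IH => u v Zuv.
pose Z' u' v' := (size ds <= v')%N && Z u' (v' - size ds)%N.
apply: (@div_horiz_coef0 _ _ d Z').
- move=> u' v' /andP[le Zu']; rewrite /Z' (leq_trans le) //.
  by rewrite subSn //= Zup.
- move=> u' v' /andP[le Zu']; have := H _ _ Zu'.
  by rewrite big_cons -mulrA /= -addSnnS addSn subnK.
- by rewrite /Z' leq_addl addnK.
Qed.

Lemma prod_vert_dvd G cs : uniq cs ->
  (forall c, c \in cs -> map_poly (fun p : {poly K} => p.[c]) G = 0) ->
  exists G', G = (\prod_(c <- cs) ('X - c%:P))%:P * G'.
Proof.
elim: cs G => [|c cs IH] G /=; first by exists G; rewrite big_nil mul1r.
move=> /andP[nc ucs] H; have [G1 E1] := div_vert (H c (mem_head _ _)).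
have [|G' E'] := IH G1 ucs.
  move=> c' c's; have := H c'; rewrite inE c's orbT => /(_ isT).
  rewrite E1 -/(horner_eval c') rmorphM /= map_polyC /= /horner_eval hornerXsubC.
  move/eqP; rewrite mulf_eq0 polyC_eq0 subr_eq0 => /orP[/eqP E|/eqP //].
  by rewrite -E c's in nc.
by exists G'; rewrite E1 E' big_cons polyCM mulrA.
Qed.

Lemma prod_horiz_dvd G ds : uniq ds ->
  (forall d, d \in ds -> G.[d%:P] = 0) ->
  exists G', G = (\prod_(d <- ds) ('X - (d%:P)%:P)) * G'.
Proof.
move=> uds H; have [||Q E] := @prod_XsubC_exp_dvd _ [seq d%:P | d <- ds] 1 G.
- by rewrite map_inj_uniq //; apply: polyC_inj.
- move=> r /mapP[d dds ->]; have /factor_theorem[Q ->] : root G d%:P.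
    by apply/rootP/H.
  by exists Q; rewrite expr1.
by exists Q; rewrite {1}E big_map expr1 mulrC.
Qed.

Lemma vanish2_prod_vert G cs c y m : uniq cs -> c \in cs ->
  vanish2 ((\prod_(c <- cs) ('X - c%:P))%:P * G) c y m.+1 -> vanish2 G c y m.
Proof.
move=> ucs ccs; rewrite (big_rem c) //= polyCM -mulrA => H.
apply: (@vanish2_unit _ _ (\prod_(c <- rem c cs) ('X - c%:P))%:P); last first.
  exact: vanish2_divX.
rewrite hornerC horner_prod prodf_seq_neq0; apply/allP => x xr /=.
rewrite hornerXsubC subr_eq0; apply: contraTneq xr => <-.
by rewrite mem_rem_uniq // inE eqxx.
Qed.

Lemma vanish2_prod_horiz G ds d x m : uniq ds -> d \in ds ->
  vanish2 ((\prod_(d <- ds) ('X - (d%:P)%:P)) * G) x d m.+1 -> vanish2 G x d m.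
Proof.
move=> uds dds; rewrite (big_rem d) //= -mulrA => H.
apply: (@vanish2_unit _ _ (\prod_(d <- rem d ds) ('X - (d%:P)%:P))); last first.
  exact: vanish2_divY.
rewrite !horner_prod prodf_seq_neq0; apply/allP => y yr /=.
rewrite !hornerE subr_eq0; apply: contraTneq yr => <-.
by rewrite mem_rem_uniq // inE eqxx.
Qed.

Lemma vanish2_prod_vert_out G cs x y m : x \notin cs ->
  vanish2 ((\prod_(c <- cs) ('X - c%:P))%:P * G) x y m -> vanish2 G x y m.
Proof.
move=> ncs; apply: vanish2_unit.
rewrite hornerC horner_prod prodf_seq_neq0; apply/allP => c ccs /=.
by rewrite hornerXsubC subr_eq0; apply: contraNneq ncs => ->.
Qed.

Lemma vanish2_prod_horiz_out G ds x y m : y \notin ds ->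
  vanish2 ((\prod_(d <- ds) ('X - (d%:P)%:P)) * G) x y m -> vanish2 G x y m.
Proof.
move=> nds; apply: vanish2_unit.
rewrite !horner_prod prodf_seq_neq0; apply/allP => d dds /=.
by rewrite !hornerE subr_eq0; apply: contraNneq nds => ->.
Qed.

Lemma poly2_eq0 G : (forall u v, G`_v`_u = 0) -> G = 0.
Proof. by move=> H; apply/polyP => v; apply/polyP => u; rewrite H !coef0. Qed.

Lemma vert_eq0 G c (Y : seq K) m B : uniq Y -> (B <= size Y)%N ->
  (forall y, y \in Y -> vanish2 G c y m) ->
  (forall v, (B * m <= v)%N -> G`_v = 0) ->
  map_poly (fun p : {poly K} => p.[c]) G = 0.
Proof.
move=> uY leY HY HG; apply: (multiple_roots_size uY (M := m)).
  by move=> y yY; apply: vanish2_vert; apply: HY.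
apply: (@leq_trans (B * m)); last by rewrite leq_mul2r leY orbT.
apply/leq_sizeP => v /HG E.
by rewrite (@coef_map_id0 _ _ (fun p : {poly K} => p.[c])) ?horner0 // E horner0.
Qed.

Lemma horiz_eq0 G d (X : seq K) m A : uniq X -> (A <= size X)%N ->
  (forall x, x \in X -> vanish2 G x d m) ->
  (forall u v, (A * m <= u)%N -> G`_v`_u = 0) ->
  G.[d%:P] = 0.
Proof.
move=> uX leX HX HG; apply: (multiple_roots_size uX (M := m)).
  by move=> x xX; apply: vanish2_horiz; apply: HX.
apply: (@leq_trans (A * m)); last by rewrite leq_mul2r leX orbT.
apply/leq_sizeP => u /HG E.
rewrite horner_coef coef_sum big1 // => v _.
by rewrite -polyC_exp coefMC E mul0r.
Qed.

(** Each grid line carries enough m-fold points to be a component, so all of them split off. The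
    points chosen on a vertical line avoid the horizontal ones and conversely; dividing by all the
    lines therefore costs only one order at each point, while the degree bounds drop by [size cs]
    and [size ds]. The hypotheses reappear with m - 1. *)
Lemma quadric_grid_eq0 cs ds m G : uniq cs -> uniq ds ->
  (forall u v, (size cs * m <= u)%N || (size ds * m <= v)%N -> G`_v`_u = 0) ->
  (forall c, c \in cs -> exists Y : seq K, [/\ uniq Y, (size ds <= size Y)%N &
     forall y, y \in Y -> y \notin ds /\ vanish2 G c y m]) ->
  (forall d, d \in ds -> exists X : seq K, [/\ uniq X, (size cs <= size X)%N &
     forall x, x \in X -> x \notin cs /\ vanish2 G x d m]) ->
  G = 0.
Proof.
move=> ucs uds; elim: m G => [|m IH] G HG Hc Hd.
  by apply: poly2_eq0 => u v; rewrite HG // muln0.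
have Ec c : c \in cs -> map_poly (fun p : {poly K} => p.[c]) G = 0.
  move=> /Hc[Y [uY sY HY]]; apply: (vert_eq0 uY sY (m := m.+1)).
    by move=> y /HY[].
  by move=> v le; apply/polyP => u; rewrite HG ?coef0 // le orbT.
have Ed d : d \in ds -> G.[d%:P] = 0.
  move=> /Hd[X [uX sX HX]]; apply: (horiz_eq0 uX sX (m := m.+1)).
    by move=> x /HX[].
  by move=> u v le; rewrite HG // le.
have [G1 E1] := prod_vert_dvd ucs Ec.
have [|G2 E2] := @prod_horiz_dvd G1 ds uds.
  move=> d /Ed /eqP; rewrite E1 hornerM hornerC mulf_eq0 => /orP[|/eqP //].
  by rewrite (negPf (monic_neq0 (monic_prod_XsubC _ _ _))).
have G20 : G2 = 0.
  apply: IH.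
  - apply: (@prod_horiz_coef0 _ ds) => [u v|u v].
      by move=> /orP[->//|le]; rewrite (leq_trans le) ?orbT.
    rewrite -E2 => le.
    apply: (@prod_vert_coef0 _ cs (fun u v => (size cs * m <= u)%N || (size ds * m.+1 <= v)%N)).
    + by move=> u' v' /orP[le'|->]; rewrite ?orbT // (leq_trans le').
    + rewrite -E1 => u' v' le'; apply: HG; rewrite mulnS addnC leq_add2r.
      by [].
    + by rewrite mulnS [in X in _ || X]addnC leq_add2r.
  - move=> c ccs; have [Y [uY sY HY]] := Hc c ccs; exists Y; split=> // y /HY[yds HV].
    split=> //; apply: (vanish2_prod_horiz_out yds); rewrite -E2.
    by apply: (vanish2_prod_vert ucs ccs); rewrite -E1.
  - move=> d dds; have [X [uX sX HX]] := Hd d dds; exists X; split=> // x /HX[xcs HV].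
    split=> //; apply: (vanish2_prod_horiz uds dds); rewrite -E2.
    by apply: (vanish2_prod_vert_out xcs); rewrite -E1.
by rewrite E1 E2 G20 !mulr0.
Qed.

(** The bound is on the total degree, so it already drops by [size cs] when the vertical lines alone
    are divided out. *)
Lemma plane_grid_eq0 cs m G : uniq cs ->
  (forall u v, (size cs * m <= u + v)%N -> G`_v`_u = 0) ->
  (forall c, c \in cs -> exists Y : seq K, [/\ uniq Y, (size cs <= size Y)%N &
     forall y, y \in Y -> vanish2 G c y m]) ->
  G = 0.
Proof.
move=> ucs; elim: m G => [|m IH] G HG Hc.
  by apply: poly2_eq0 => u v; rewrite HG // muln0.
have Ec c : c \in cs -> map_poly (fun p : {poly K} => p.[c]) G = 0.
  move=> /Hc[Y [uY sY HY]]; apply: (vert_eq0 uY sY (m := m.+1)) => // v le.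
  by apply/polyP => u; rewrite HG ?coef0 // (leq_trans le) // leq_addl.
have [G1 E1] := prod_vert_dvd ucs Ec.
have G10 : G1 = 0.
  apply: IH.
  - apply: (@prod_vert_coef0 _ cs (fun u v => (size cs * m <= u + v)%N)).
      by move=> u v le; rewrite addSn (leq_trans le).
    by move=> u v le; rewrite -E1 HG // addnAC mulnS addnC leq_add2r.
  - move=> c ccs; have [Y [uY sY HY]] := Hc c ccs; exists Y; split=> // y /HY HV.
    by apply: (vanish2_prod_vert ucs ccs); rewrite -E1.
by rewrite E1 G10 mulr0.
Qed.

End Grids.

(** * Vanishing along lines *)

Section ZeroFunctions.
Variable K : fieldType.
Hypothesis K_char0 : [pchar K] =i pred0.

(** Induction on the number of variables: q is the coefficient in p of a power of the last variable
    that occurs, and at a nonroot v of q a nonzero polynomial in the last variable remains. *)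
Lemma mpoly_nonroot n (p : {mpoly K[n]}) : p != 0 -> exists v : 'I_n -> K, p.@[v] != 0.
Proof.
elim: n p => [|n IH] p p0.
  exists (fun=> 0); apply: contraNneq p0 => E; apply/eqP/mpolyP => m.
  rewrite mcoeff0; move: E; rewrite mevalE; case: (boolP (m \in msupp p)) => [mp|].
    rewrite (big_rem m) //= big_ord0 mulr1 big1_seq ?addr0 // => m' /andP[_].
    rewrite mem_rem_uniq ?msupp_uniq // inE => /andP[/eqP []].
    by apply/mnmP => -[].
  by move=> /memN_msupp_eq0.
have [m0 m0p] : exists m, m \in msupp p.
  by move: p0; rewrite -msupp_eq0; case: (msupp p) => // m s _; exists m; rewrite inE eqxx.
pose tl (m : 'X_{1..n.+1}) : 'X_{1..n} := [multinom (m (widen_ord (leqnSn n) i)) | i < n].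
pose q : {mpoly K[n]} := \sum_(m <- msupp p | m ord_max == m0 ord_max) p@_m *: 'X_[tl m].
have /IH [v vq] : q != 0.
  apply/negP => /eqP /(congr1 (fun r => r@_(tl m0))); rewrite mcoeff0 raddf_sum /=.
  rewrite (big_rem m0) //= eqxx mcoeffZ mcoeffX eqxx mulr1 big1_seq ?addr0.
    by move/eqP; rewrite mcoeff_eq0 m0p.
  move=> m /andP[/eqP Em]; rewrite mem_rem_uniq ?msupp_uniq // inE => /andP[ne _].
  rewrite mcoeffZ mcoeffX; case: eqP; rewrite ?mulr0 // => Et.
  case/eqP: ne; apply/mnmP => i; case: (unliftP ord_max i) => [j ->|->] //.
  have := congr1 (fun m : 'X_{1..n} => m j) Et; rewrite !mnmE.
  suff -> : widen_ord (leqnSn n) j = lift ord_max j by [].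
  by apply: val_inj; rewrite /= /bump leqNgt ltn_ord.
pose r : {poly K} := \sum_(m <- msupp p) (p@_m * \prod_i v i ^+ tl m i) *: 'X^(m ord_max).
have /(poly_nonroot K_char0) [x rx] : r != 0.
  apply: contraNneq vq => /(congr1 (fun s : {poly K} => s`_(m0 ord_max))).
  rewrite coef0 coef_sum => E; apply/eqP; rewrite -[RHS]E raddf_sum big_mkcond /=.
  apply: eq_bigr => m _; rewrite coefZ coefXn eq_sym.
  by case: eqP => _; rewrite ?mulr0 // mulr1 mevalZ mevalX.
exists (fun i => if unlift ord_max i is Some j then v j else x).
move: rx; rewrite mevalE horner_sum; congr (_ != 0); apply: eq_bigr => m _.
rewrite big_ord_recr /= unlift_none hornerZ hornerXn mulrA; congr (_ * _ * _).
apply: eq_bigr => i _; rewrite mnmE.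
have -> : widen_ord (leqnSn n) i = lift ord_max i.
  by apply: val_inj; rewrite /= /bump leqNgt ltn_ord.
by rewrite liftK.
Qed.

Lemma mpoly_zero_fun n (p : {mpoly K[n]}) : (forall v, p.@[v] = 0) -> p = 0.
Proof. by move=> H; apply/eqP/negPn/negP => /mpoly_nonroot [v]; rewrite H eqxx. Qed.

End ZeroFunctions.

Section Substitution.
Variable K : fieldType.
Implicit Types (f : {mpoly K[4]}) (g : 'M[K]_4).

Definition i0 : 'I_4 := ord0.
Definition i1 : 'I_4 := @Ordinal 4 1 isT.
Definition i2 : 'I_4 := @Ordinal 4 2 isT.
Definition i3 : 'I_4 := @Ordinal 4 3 isT.

Lemma I4P (P : 'I_4 -> Prop) : P i0 -> P i1 -> P i2 -> P i3 -> forall i, P i.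
Proof.
move=> P0 P1 P2 P3 [[|[|[|[|//]]]] lt].
- by rewrite (_ : Ordinal lt = i0) //; apply: val_inj.
- by rewrite (_ : Ordinal lt = i1) //; apply: val_inj.
- by rewrite (_ : Ordinal lt = i2) //; apply: val_inj.
- by rewrite (_ : Ordinal lt = i3) //; apply: val_inj.
Qed.

Lemma big_I4 (T : Type) (idx : T) (op : Monoid.law idx) (F : 'I_4 -> T) :
  \big[op/idx]_i F i = op (F i0) (op (F i1) (op (F i2) (F i3))).
Proof.
rewrite !big_ord_recl big_ord0 Monoid.mulm1.
by do 3?[congr (op _ _)]; congr F; apply: val_inj.
Qed.

Lemma mmap_comp (A : comNzRingType) (phi : {rmorphism K -> A}) n k
    (h : 'I_k -> A) (lq : n.-tuple {mpoly K[k]}) (f : {mpoly K[n]}) :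
  mmap phi h (f \mPo lq) = mmap phi (fun i => mmap phi h (tnth lq i)) f.
Proof.
rewrite comp_mpolyEX raddf_sum /=; apply: eq_bigr => m _.
rewrite mmapZ comp_mpolyX rmorph_prod; congr (_ * _).
by apply: eq_bigr => i _; rewrite rmorphXn.
Qed.

Lemma eq_mmap (A : comNzRingType) (phi psi : K -> A) n (h h' : 'I_n -> A)
    (f : {mpoly K[n]}) : phi =1 psi -> h =1 h' -> mmap phi h f = mmap psi h' f.
Proof.
move=> E E'; apply: eq_bigr => m _; rewrite E; congr (_ * _); exact: mmap1_eq.
Qed.

Lemma rmorph_mmap (A B : comNzRingType) (phi : {rmorphism K -> A})
    (psi : {rmorphism A -> B}) n (h : 'I_n -> A) (f : {mpoly K[n]}) :
  psi (mmap phi h f) = mmap (psi \o phi) (psi \o h) f.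
Proof.
rewrite /mmap raddf_sum; apply: eq_bigr => m _ /=; rewrite rmorphM rmorph_prod.
by congr (_ * _); apply: eq_bigr => i _; rewrite rmorphXn.
Qed.

Definition lsub g f := f \mPo [tuple \sum_j g j i *: 'X_j | i < 4].

(** The target ring is arbitrary so that evaluation at a point, composition of substitutions and the
    expansions [fline] are all instances. *)
Lemma mmap_lsub (A : comNzRingType) (phi : {rmorphism K -> A}) (h : 'I_4 -> A) g f :
  mmap phi h (lsub g f) = mmap phi (fun i => \sum_j phi (g j i) * h j) f.
Proof.
rewrite /lsub mmap_comp; apply: eq_mmap => // i; rewrite tnth_mktuple raddf_sum.
by apply: eq_bigr => j _; rewrite /= mmapZ mmapX mmap1U.
Qed.

Lemma meval_lsub g f (v : 'rV_4) : (lsub g f).@[v 0] = f.@[(v *m g) 0].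
Proof.
rewrite /meval (mmap_lsub idfun); apply: eq_mmap => // i; rewrite mxE.
by apply: eq_bigr => j _; rewrite mulrC.
Qed.

Lemma lsub1 f : lsub 1%:M f = f.
Proof.
rewrite -[RHS]comp_mpoly_id; apply: eq_mmap => // i; rewrite !tnth_mktuple.
rewrite (bigD1 i) //= mxE eqxx scale1r big1 ?addr0 // => j ne.
by rewrite mxE (negPf ne) scale0r.
Qed.

Lemma lsubM g1 g2 f : lsub g1 (lsub g2 f) = lsub (g1 *m g2) f.
Proof.
rewrite [LHS]mmap_lsub; apply: eq_mmap => // i; rewrite tnth_mktuple.
rewrite (eq_bigr (fun j => \sum_k (g1 k j * g2 j i) *: 'X_k)).
  rewrite exchange_big /=; apply: eq_bigr => k _.
  by rewrite -scaler_suml mxE.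
move=> j _; rewrite tnth_mktuple mulr_sumr; apply: eq_bigr => k _.
by rewrite mul_mpolyC scalerA mulrC.
Qed.

Lemma lsub_homog g f t : f \is t.-homog -> lsub g f \is t.-homog.
Proof.
move=> fh; rewrite /lsub comp_mpolyEX big_seq rpred_sum // => m mf.
have dm : mdeg m = t := dhomog_mf fh mf.
rewrite rpredZ // comp_mpolyX -dm mdegE.
elim/big_rec2: _ => [|i p d _ ph]; first exact: dhomog1.
rewrite mulrC addnC; apply: dhomogM => //.
rewrite -[X in X.-homog]mul1n; apply: dhomogMn.
rewrite tnth_mktuple rpred_sum // => j _; rewrite rpredZ //.
by rewrite dhomogX; apply/eqP/mdeg1.
Qed.

Lemma lsub_rM g f1 f2 : lsub g (f1 * f2) = lsub g f1 * lsub g f2.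
Proof. exact: rmorphM. Qed.

End Substitution.

Section Vanishing.
Variable K : fieldType.
Hypothesis K_char0 : [pchar K] =i pred0.
Implicit Types (f h : {mpoly K[4]}) (g : 'M[K]_4) (P w : 'rV[K]_4) (m : nat).

(* f (P + X w) *)
Definition fline f P w : {poly K} :=
  mmap (@polyC K) (fun i => (P 0 i)%:P + w 0 i *: 'X) f.

(** Multiplicity at least m at each point of U, tested on the univariate expansions in all
    directions w; products, substitutions and cancellation thus become questions about polynomials
    in one variable. *)
Definition vanish f (U : 'rV[K]_4 -> Prop) m : Prop :=
  forall P w, U P -> forall i, (i < m)%N -> (fline f P w)`_i = 0.

Definition plane2 (u v : 'rV[K]_4) : 'rV[K]_4 -> Prop :=
  fun P => exists a b, P = a *: u + b *: v.

Lemma flineM f h P w : fline (f * h) P w = fline f P w * fline h P w.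
Proof. exact: rmorphM. Qed.

Lemma fline_coef0 f P w : (fline f P w)`_0 = f.@[P 0].
Proof.
rewrite -horner_coef0 -/(horner_eval 0 _) /fline rmorph_mmap.
apply: eq_mmap => [c|i] /=; rewrite /horner_eval ?hornerC //.
by rewrite !hornerE ?mulr0 ?addr0.
Qed.

Lemma fline_lsub g f P w : fline (lsub g f) P w = fline f (P *m g) (w *m g).
Proof.
rewrite /fline mmap_lsub; apply: eq_mmap => // i; rewrite !mxE.
rewrite raddf_sum scaler_suml -big_split /=; apply: eq_bigr => j _.
by rewrite mulrDr -polyCM mulrC mul_polyC scalerA [w 0 j * _]mulrC.
Qed.

Lemma vanishM f h U m n : vanish f U m -> vanish h U n -> vanish (f * h) U (m + n).
Proof.
move=> Hf Hh P w UP i lt; rewrite flineM coefM big1 // => j _.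
case: (ltnP j m) => le; first by rewrite Hf // mul0r.
by rewrite Hh ?mulr0 //; have := ltn_ord j; lia.
Qed.

Lemma vanishMl f h U m : vanish h U m -> vanish (f * h) U m.
Proof. by move=> H; rewrite -[m]add0n; apply: vanishM. Qed.

Lemma vanish1 f U : (forall P, U P -> f.@[P 0] = 0) -> vanish f U 1.
Proof. by move=> H P w UP [|i] // _; rewrite fline_coef0 H. Qed.

Lemma vanishD f h U m : vanish f U m -> vanish h U m -> vanish (f + h) U m.
Proof.
move=> Hf Hh P w UP i lt; rewrite [fline _ _ _]raddfD coefD.
by rewrite [X in X + _]Hf // [X in _ + X]Hh // addr0.
Qed.

Lemma vanish_ideal_power (I : set {mpoly K[4]}) U m f :
  (forall h, I h -> forall P, U P -> h.@[P 0] = 0) ->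
  ideal_power I m f -> vanish f U m.
Proof.
move=> HI [n [c [g [Ig ->]]]]; elim/big_ind: _ => [P w _ i _|*|i _].
- by rewrite [fline _ _ _]raddf0 coef0.
- exact: vanishD.
- apply: vanishMl; elim: m g Ig => [|m IH] g Ig //.
  rewrite big_ord_recl; apply: (@vanishM _ _ _ 1 m).
    by apply: vanish1; apply: HI.
  exact: (IH (fun k j => g k (lift ord0 j))).
Qed.

(** With l the valuation of H, the coefficient of F H at i + l is [F]_i[times]H[_l] plus terms that
    contain a coefficient of F below i or of H below l. *)
Lemma coefM_cancel (R : idomainType) (F H : {poly R}) (m e : nat) :
  (forall i, (i < m + e)%N -> (F * H)`_i = 0) ->
  (exists2 l, (l <= e)%N & H`_l != 0) -> forall i, (i < m)%N -> F`_i = 0.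
Proof.
move=> FH [l0 le0 Hl0].
have ex : exists l, H`_l != 0 by exists l0.
have [l Hl lmin] := ex_minnP ex.
have le : (l <= e)%N by apply: leq_trans le0; apply: lmin.
elim/ltn_ind => i IH lt; apply/eqP.
have lil : (i + l < m + e)%N by lia.
have /eqP := FH _ lil.
rewrite coefM (bigD1 (inord i)) //= inordK; last by rewrite ltnS leq_addr.
rewrite addKn big1 ?addr0 => [|j ne]; first by rewrite mulf_eq0 (negPf Hl) orbF.
case: (ltngtP j i) => [lti|gti|eji].
- by rewrite IH ?mul0r // (leq_trans lti (ltnW lt)).
- case: (eqVneq (H`_(i + l - j)) 0) => [->|nz]; first by rewrite mulr0.
  have := lmin _ nz; have := ltn_ord j; lia.
- by case/eqP: ne; apply: val_inj; rewrite /= inordK // ltnS leq_addr.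
Qed.

(* Along the segment from (P, w) to (P0, w0) the coefficients of the expansions
   are polynomials in the parameter, so that the valuation of [h] may be
   computed at a single point of a single direction. *)
Lemma vanish_cancel f h (U : 'rV[K]_4 -> Prop) m e P0 w0 :
  (forall P Q x, U P -> U Q -> U (P + x *: (Q - P))) ->
  vanish (f * h) U (m + e) -> U P0 ->
  (exists2 l, (l <= e)%N & (fline h P0 w0)`_l != 0) -> vanish f U m.
Proof.
move=> Uaff V UP0 [l le hl] P w UP i lt.
(* The inner variable is the parameter of the segment, the outer one the expansion variable. The
   parameter 1 gives (P0, w0), where h has small valuation; the parameter 0 gives back (P, w). *)
pose arg (j : 'I_4) : {poly {poly K}} :=
  ((P 0 j)%:P + ((P0 - P) 0 j) *: 'X)%:P + ((w 0 j)%:P + ((w0 - w) 0 j) *: 'X) *: 'X.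
pose ev f' : {poly {poly K}} := mmap (polyC \o @polyC K) arg f'.
have evE f' x : map_poly (horner_eval x) (ev f') =
    fline f' (P + x *: (P0 - P)) (w + x *: (w0 - w)).
  rewrite /ev rmorph_mmap; apply: eq_mmap => [c|j] /=.
    by rewrite map_polyC /= /horner_eval hornerC.
  rewrite rmorphD /= map_polyC map_polyZ map_polyX /= /horner_eval !hornerE !mxE.
  by rewrite ![x * _]mulrC.
have evM : ev (f * h) = ev f * ev h by exact: rmorphM.
have E0 : forall k, (k < m)%N -> (ev f)`_k = 0.
  apply: (@coefM_cancel _ _ (ev h) m e).
    move=> k ltk; apply: (poly_zero_fun K_char0) => x; rewrite -evM.
    have := congr1 (fun p : {poly K} => p`_k) (evE (f * h) x).
    rewrite coef_map /= /horner_eval => ->.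
    by apply: V => //; apply: Uaff.
  exists l => //; apply: contraNneq hl => E.
  have := congr1 (fun p : {poly K} => p`_l) (evE h 1).
  by rewrite coef_map /= /horner_eval E horner0 !scale1r ![_ + (_ - _)]addrC !subrK => <-.
have := congr1 (fun p : {poly K} => p`_i) (evE f 0).
by rewrite coef_map /= /horner_eval E0 // horner0 !scale0r !addr0 => <-.
Qed.

Lemma plane2_aff u v P Q x : plane2 u v P -> plane2 u v Q -> plane2 u v (P + x *: (Q - P)).
Proof.
move=> [a [b ->]] [c [d ->]]; exists (a + x * (c - a)), (b + x * (d - b)).
by apply/rowP => i; rewrite !mxE; ring.
Qed.

(** For P in the plane x2 = x3 = 0 and w in the complementary coordinate plane, the coefficient of
    X^d in f (P + X w) is the value of the part F of f of degree d in x2, x3. If d < m, then F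
    vanishes as a function, hence as a polynomial. *)
Lemma vanish_coef_eq0 f m : vanish f (plane2 (delta_mx 0 i0) (delta_mx 0 i1)) m ->
  forall a : 'X_{1..4}, (a i2 + a i3 < m)%N -> f@_a = 0.
Proof.
move=> V a lt.
pose F : {mpoly K[4]} := \sum_(b <- msupp f | (b i2 + b i3 == a i2 + a i3)%N) f@_b *: 'X_[b].
have F0 : F = 0.
  apply: (mpoly_zero_fun K_char0) => v.
  pose P : 'rV[K]_4 := v i0 *: delta_mx 0 i0 + v i1 *: delta_mx 0 i1.
  pose w : 'rV[K]_4 := v i2 *: delta_mx 0 i2 + v i3 *: delta_mx 0 i3.
  have <- : (fline f P w)`_(a i2 + a i3) = F.@[v]; last first.
    by apply: V => //; exists (v i0), (v i1).
  rewrite /fline /mmap coef_sum /F [RHS]raddf_sum [RHS]big_mkcond /=.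
  apply: eq_bigr => b _; rewrite coefCM /mmap1 big_I4 /= !mxE /=.
  rewrite !(mulr0, mulr1, addr0, add0r, scale0r) !exprZn.
  rewrite -!rmorphXn /= !coefCM -!scalerAl -!scalerAr scalerA coefZ -exprD coefXn.
  rewrite eq_sym; case: eqP => _; last by rewrite !mulr0.
  by rewrite mulr1 mevalZ mevalX big_I4.
case: (boolP (a \in msupp f)) => [af|]; last exact: memN_msupp_eq0.
have := congr1 (fun p => p@_a) F0; rewrite mcoeff0 raddf_sum /=.
rewrite (big_rem a) //= eqxx mcoeffZ mcoeffX eqxx mulr1 big1_seq ?addr0 // => b /andP[_].
rewrite mem_rem_uniq ?msupp_uniq // inE => /andP[ne _].
by rewrite mcoeffZ mcoeffX (negPf ne) mulr0.
Qed.

Lemma ideal_power_coord f m :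
  (forall a : 'X_{1..4}, (a i2 + a i3 < m)%N -> f@_a = 0) ->
  exists (n : nat) (c : 'I_n -> {mpoly K[4]}) (h : 'I_n -> 'I_m -> bool),
  f = \sum_i c i * \prod_j (if h i j then 'X_i2 else 'X_i3).
Proof.
move=> H; pose s := msupp f; pose al (i : 'I_(size s)) : 'X_{1..4} := nth 0%MM s i.
have als i : al i \in s by rewrite mem_nth.
have alm i : (m <= al i i2 + al i i3)%N.
  rewrite leqNgt; apply/negP => /H /eqP; rewrite mcoeff_eq0.
  by rewrite als.
(* Of the at least m factors x2 and x3 of a monomial exactly m are taken out, as many x2 as
   possible. *)
pose e2 i := minn m (al i i2); pose e3 i := (m - e2 i)%N.
exists (size s), (fun i => f@_(al i) *: ('X_i0 ^+ al i i0 * ('X_i1 ^+ al i i1 *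
   ('X_i2 ^+ (al i i2 - e2 i) * 'X_i3 ^+ (al i i3 - e3 i))))),
  (fun i j => (j < e2 i)%N).
rewrite {1}[f]mpolyE (big_nth 0%MM) big_mkord; apply: eq_bigr => i _.
rewrite -scalerAl; congr (_ *: _); rewrite -/(al i) mpolyXE_id big_I4 /=.
have -> : \prod_(j < m) (if (j < e2 i)%N then 'X_i2 else 'X_i3) =
    'X_i2 ^+ e2 i * 'X_i3 ^+ e3 i :> {mpoly K[4]}.
  have em : (e2 i + e3 i = m)%N by rewrite subnKC // geq_minl.
  rewrite -(big_mkord xpredT (fun j => if (j < e2 i)%N then 'X_i2 else 'X_i3)).
  rewrite (big_cat_nat (n := e2 i)) ?geq_minl //=; congr (_ * _).
    rewrite big_nat (eq_bigr (fun=> 'X_i2)) => [|j /andP[_ ->] //].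
    by rewrite -big_nat prodr_const_nat subn0.
  rewrite big_nat (eq_bigr (fun=> 'X_i3)) => [|j /andP[le _]].
    by rewrite -big_nat prodr_const_nat.
  by rewrite ltnNge le.
rewrite -!mulrA; do 2!congr (_ * _).
rewrite [X in _ = _ * X]mulrCA [RHS]mulrA -!exprD subnK ?geq_minr //.
congr (_ * _ ^+ _); rewrite subnK //; have := alm i; rewrite /e3 /e2; lia.
Qed.

(** For a single line symbolic and ordinary powers agree: once the line is moved to x2 = x3 = 0,
    every monomial has degree at least m in x2 and x3. *)
Lemma vanish_in_ideal_power f g m : g \in unitmx ->
  vanish f (plane2 (row i0 g) (row i1 g)) m ->
  ideal_power [set h | forall P, plane2 (row i0 g) (row i1 g) P -> h.@[P 0] = 0] m f.
Proof.
move=> gu V.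
have V' : vanish (lsub g f) (plane2 (delta_mx 0 i0) (delta_mx 0 i1)) m.
  move=> P w [a [b ->]] i lt; rewrite fline_lsub; apply: V => //.
  by exists a, b; rewrite mulmxDl -!scalemxAl -!rowE.
have [n [c [h E]]] := ideal_power_coord (vanish_coef_eq0 V').
exists n, (fun i => lsub (invmx g) (c i)),
  (fun i j => lsub (invmx g) (if h i j then 'X_i2 else 'X_i3)); split.
  move=> i j P [a [b ->]]; rewrite meval_lsub mulmxDl -!scalemxAl !rowE.
  rewrite -!mulmxA mulmxV // !mulmx1; case: ifP => _;
  by rewrite mevalXU !mxE /= !mulr0 addr0.
rewrite -[f]lsub1 -(mulVmx gu) -lsubM E [LHS]raddf_sum; apply: eq_bigr => i _ /=.
by rewrite rmorphM rmorph_prod.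
Qed.

End Vanishing.

(** * Restriction to a quadric or a plane *)

(** The point (1, x, y, b x y) of a surface is [ruling0 y + x *: ruling1 b y], so these two vectors
    span the line y = const. For b = false the second one does not depend on y: it is the common
    point of the lines on a plane. The ring is arbitrary because y will also be a polynomial in a
    parameter. *)
Definition ruling0 (A : nzRingType) (y : A) : 'rV[A]_4 :=
  \row_j (if j == i0 then 1 else if j == i2 then y else 0).

Definition ruling1 (A : nzRingType) b (y : A) : 'rV[A]_4 :=
  \row_j (if j == i1 then 1 else if (j == i3) && b then y else 0).

Section Surfaces.
Variable K : fieldType.
Hypothesis K_char0 : [pchar K] =i pred0.
Implicit Types (f h : {mpoly K[4]}) (b : bool) (m t u v : nat).

(* [b = true]: the quadric x0 x3 = x1 x2; [b = false]: the plane x3 = 0. In the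
   chart x0 = 1 both are parametrised by (x, y) |-> (1, x, y, b x y). *)
Definition surf_form b : {mpoly K[4]} :=
  if b then 'X_i0 * 'X_i3 - 'X_i1 * 'X_i2 else 'X_i3.

Definition surf_chart b (i : 'I_4) : {poly {poly K}} :=
  if i == i0 then 1 else if i == i1 then 'X%:P else if i == i2 then 'X
  else if b then 'X%:P * 'X else 0.

Definition restrict b f : {poly {poly K}} :=
  mmap (polyC \o @polyC K) (surf_chart b) f.

Definition surf_pt b (x y : K) : 'rV[K]_4 :=
  \row_i (if i == i0 then 1 else if i == i1 then x else if i == i2 then y
          else if b then x * y else 0).

Lemma surf_form_homog b : surf_form b \is b.+1.-homog.
Proof.
have X1 (i : 'I_4) : ('X_i : {mpoly K[4]}) \is 1.-homog.
  by rewrite dhomogX; apply/eqP/mdeg1.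
by case: b; rewrite /surf_form ?rpredB // -[2%N]/(1 + 1)%N dhomogM.
Qed.

Lemma restrictM b f h : restrict b (f * h) = restrict b f * restrict b h.
Proof. exact: rmorphM. Qed.

Lemma restrict_eval b f x y : (restrict b f).[y%:P].[x] = f.@[surf_pt b x y 0].
Proof.
rewrite -/(horner_eval y%:P _) -/(horner_eval x _) /restrict !rmorph_mmap.
apply: eq_mmap => [c|i] /=; rewrite /horner_eval; first by rewrite !hornerC.
by rewrite mxE /surf_chart; do 3?case: eqP => _; rewrite ?hornerE //; case: b; rewrite !hornerE.
Qed.

Lemma restrict_mon b (a : 'X_{1..4}) : mmap1 (surf_chart b) a =
  (if b || (a i3 == 0)%N then ('X^(a i1 + a i3))%:P * 'X^(a i2 + a i3) else 0).
Proof.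
rewrite /mmap1 big_I4 /surf_chart /= expr1n mul1r.
case: b => /=; last first.
  case: (a i3) => [|k] /=; last by rewrite expr0n /= !mulr0.
  by rewrite expr0 mulr1 !addn0 rmorphXn.
by rewrite exprMn !exprD polyCM !rmorphXn /=; ring.
Qed.

Lemma coef_restrict b f u v : (restrict b f)`_v`_u =
  \sum_(a <- msupp f | [&& b || (a i3 == 0)%N, (a i1 + a i3 == u)%N & (a i2 + a i3 == v)%N]) f@_a.
Proof.
rewrite /restrict /mmap !coef_sum [RHS]big_mkcond; apply: eq_bigr => a _ /=.
rewrite !coefCM restrict_mon; case: (b || _) => /=; last by rewrite !coef0 mulr0.
rewrite coefCM coefXn [v == _]eq_sym; case: eqP => _; last first.
  by rewrite mulr0 coef0 mulr0 andbF.
by rewrite andbT mulr1 coefXn eq_sym; case: eqP; rewrite ?mulr1 ?mulr0.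
Qed.

Lemma restrict_quadric_coef0 f t u v : f \is t.-homog -> (t < u)%N || (t < v)%N ->
  (restrict true f)`_v`_u = 0.
Proof.
move=> fh lt; rewrite coef_restrict big_seq_cond big1 // => a /andP[af].
have da : mdeg a = t := dhomog_mf fh af.
move: da; rewrite mdegE big_I4 /= => da /andP[/eqP ea /eqP eb]; lia.
Qed.

Lemma restrict_plane_coef0 f t u v : f \is t.-homog -> (t < u + v)%N ->
  (restrict false f)`_v`_u = 0.
Proof.
move=> fh lt; rewrite coef_restrict big_seq_cond big1 // => a /andP[af].
have da : mdeg a = t := dhomog_mf fh af.
move: da; rewrite mdegE big_I4 /= => da /and3P[/eqP e3 /eqP ea /eqP eb]; lia.
Qed.

(** In a fixed degree a monomial free of x3 is determined by its exponents of x1 and x2, so these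
    monomials have independent restrictions and cannot occur in f. *)
Lemma plane_dvd f t : f \is t.-homog -> restrict false f = 0 ->
  exists2 h, h \is (t - 1).-homog & f = surf_form false * h.
Proof.
move=> fh f0.
have H a : a \in msupp f -> (0 < a i3)%N.
  move=> af; rewrite lt0n; apply/negP => /eqP a3.
  have := congr1 (fun p : {poly {poly K}} => p`_(a i2)`_(a i1)) f0.
  rewrite coef_restrict !coef0 (big_rem a) //= a3 !addn0 !eqxx big1_seq ?addr0.
    by move/eqP; rewrite mcoeff_eq0 af.
  move=> c /andP[/and3P[/eqP c3 /eqP c1 /eqP c2]].
  rewrite mem_rem_uniq ?msupp_uniq // inE => /andP[/eqP ne cf]; case: ne.
  have := dhomog_mf fh cf; have := dhomog_mf fh af.
  rewrite /= !mdegE !big_I4 /= => da dc.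
  by apply/mnmP; apply: I4P; lia.
exists (\sum_(a <- msupp f) f@_a *: 'X_[(a - U_(i3))%MM]).
  rewrite big_seq rpred_sum // => a af; rewrite rpredZ // dhomogX; apply/eqP.
  have <- : mdeg a = t := dhomog_mf fh af.
  have le : (U_(i3) <= a)%MM by rewrite lep1mP -lt0n H.
  by rewrite -[in RHS](submK le) mdegD mdeg1 addnK.
rewrite {1}[f]mpolyE mulr_sumr big_seq [RHS]big_seq; apply: eq_bigr => a af.
have le : (U_(i3) <= a)%MM by rewrite lep1mP -lt0n H.
by rewrite -scalerAr /surf_form -mpolyXD addmC submK.
Qed.

(** Replacing x0 x3 by x1 x2 as often as possible changes a monomial by a multiple of the equation
    and leaves its restriction unchanged. The resulting normal form depends only on the bidegree (u,
    v) of the restriction, so the normal form of f is 0 when f restricts to 0. *)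
Lemma quadric_dvd f t : f \is t.-homog -> restrict true f = 0 ->
  exists2 h, h \is (t - 2).-homog & f = surf_form true * h.
Proof.
move=> fh f0.
pose k (a : 'X_{1..4}) := minn (a i0) (a i3).
pose r (a : 'X_{1..4}) : {mpoly K[4]} :=
  'X_i0 ^+ (a i0 - k a) * 'X_i1 ^+ a i1 * 'X_i2 ^+ a i2 * 'X_i3 ^+ (a i3 - k a).
have XE (a : 'X_{1..4}) : 'X_[a] = ('X_i0 * 'X_i3) ^+ k a * r a :> {mpoly K[4]}.
  rewrite mpolyXE_id big_I4 /= /r exprMn.
  have -> : 'X_i0 ^+ a i0 = 'X_i0 ^+ (a i0 - k a) * 'X_i0 ^+ k a :> {mpoly K[4]}.
    by rewrite -exprD subnK ?geq_minl.
  have -> : 'X_i3 ^+ a i3 = 'X_i3 ^+ (a i3 - k a) * 'X_i3 ^+ k a :> {mpoly K[4]}.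
    by rewrite -exprD subnK ?geq_minr.
  ring.
have X1 (i : 'I_4) : ('X_i : {mpoly K[4]}) \is 1.-homog.
  by rewrite dhomogX; apply/eqP/mdeg1.
have Xn (i : 'I_4) n : ('X_i : {mpoly K[4]}) ^+ n \is n.-homog.
  by rewrite -[X in X.-homog]mul1n; apply: dhomogMn.
(* A normal form contains at most one of x0 and x3; which one is decided by comparing u + v with the
   degree t. *)
pose NF u v : {mpoly K[4]} := if (u + v <= t)%N
  then 'X_i0 ^+ (t - (u + v)) * 'X_i1 ^+ u * 'X_i2 ^+ v * 'X_i3 ^+ 0
  else 'X_i0 ^+ 0 * 'X_i1 ^+ (t - v) * 'X_i2 ^+ (t - u) * 'X_i3 ^+ (u + v - t).
have NFE a : a \in msupp f ->
    ('X_i1 * 'X_i2) ^+ k a * r a = NF (a i1 + a i3)%N (a i2 + a i3)%N.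
  move=> af; have := dhomog_mf fh af; rewrite /= mdegE big_I4 /= => da.
  have -> : ('X_i1 * 'X_i2) ^+ k a * r a = 'X_i0 ^+ (a i0 - k a) *
     'X_i1 ^+ (k a + a i1) * 'X_i2 ^+ (k a + a i2) * 'X_i3 ^+ (a i3 - k a).
    rewrite /r exprMn !exprD; ring.
  rewrite /NF /k; case: leqP => le; congr (_ ^+ _ * _ ^+ _ * _ ^+ _ * _ ^+ _); lia.
have NF0 : \sum_(a <- msupp f) f@_a *: NF (a i1 + a i3)%N (a i2 + a i3)%N = 0.
  pose uv (a : 'X_{1..4}) : 'I_t.+1 * 'I_t.+1 := (inord (a i1 + a i3), inord (a i2 + a i3)).
  rewrite (partition_big uv xpredT) //= big1 // => -[u v] _.
  have uvE a : a \in msupp f -> (uv a == (u, v)) =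
      (a i1 + a i3 == u)%N && (a i2 + a i3 == v)%N.
    move=> af; have := dhomog_mf fh af; rewrite /= mdegE big_I4 /= => da.
    rewrite /uv xpair_eqE -!val_eqE /= !inordK //; lia.
  rewrite big_seq_cond (eq_bigr (fun a => f@_a *: NF u v)); last first.
    by move=> a /andP[af]; rewrite uvE // => /andP[/eqP -> /eqP ->].
  rewrite -scaler_suml; have := congr1 (fun p : {poly {poly K}} => p`_v`_u) f0.
  rewrite coef_restrict !coef0 /= => E.
  rewrite (eq_bigl (fun a => (a \in msupp f) &&
     ((a i1 + a i3 == u)%N && (a i2 + a i3 == v)%N))); last first.
    by move=> a; case: (boolP (a \in _)) => //= /uvE ->.
  by rewrite -big_seq_cond E scale0r.
pose q n : {mpoly K[4]} :=
  \sum_(i < n) ('X_i0 * 'X_i3) ^+ (n.-1 - i) * ('X_i1 * 'X_i2) ^+ i.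
exists (\sum_(a <- msupp f) f@_a *: (q (k a) * r a)).
  rewrite big_seq rpred_sum // => a af; rewrite rpredZ //.
  have := dhomog_mf fh af; rewrite /= mdegE big_I4 /= => da.
  case: (posnP (k a)) => [k0|kp]; first by rewrite /q k0 big_ord0 mul0r rpred0.
  have hr : r a \is (a i0 - k a + a i1 + a i2 + (a i3 - k a)).-homog.
    by rewrite /r !dhomogM.
  have hq : q (k a) \is (2 * (k a).-1).-homog.
    rewrite rpred_sum // => i _.
    have -> : (2 * (k a).-1 = 2 * ((k a).-1 - i) + 2 * i)%N.
      by have := ltn_ord i; lia.
    by apply: dhomogM; apply: dhomogMn; rewrite -[2%N]/(1 + 1)%N dhomogM.
  have -> : (t - 2 = 2 * (k a).-1 + (a i0 - k a + a i1 + a i2 + (a i3 - k a)))%N.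
    by move: kp; rewrite /k; lia.
  exact: dhomogM.
rewrite -[RHS]addr0 -[X in _ + X]NF0 {1}[f]mpolyE mulr_sumr big_seq.
rewrite [X in X + _]big_seq [X in _ + X]big_seq -big_split; apply: eq_bigr => a af /=.
rewrite -scalerAr -scalerDr; congr (_ *: _).
rewrite -NFE // XE. rewrite [X in _ = X + _]mulrA -mulrDl; congr (_ * _).
by rewrite /surf_form -subrXX subrK.
Qed.

Lemma surf_dvd b f t : f \is t.-homog -> restrict b f = 0 ->
  exists2 h, h \is (t - b.+1).-homog & f = surf_form b * h.
Proof. by case: b; [apply: quadric_dvd | apply: plane_dvd]. Qed.

(** A unipotent completion of the two spanning vectors of the line to a basis. *)
Definition ruling_mx b (y : K) : 'M[K]_4 :=
  \matrix_(i, j) (if i == j then 1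
    else if (i == i0) && (j == i2) then y
    else if (i == i1) && (j == i3) && b then y else 0).

Lemma ruling_mx_unit b y : ruling_mx b y \in unitmx.
Proof.
rewrite unitmxE -det_tr det_trig; last first.
  apply/is_trig_mxP => i j; rewrite !mxE; by move: j; elim/I4P: i; elim/I4P => //=.
by rewrite big1 ?unitr1 // => i _; rewrite !mxE eqxx.
Qed.

Lemma ruling_mx0 b y : row i0 (ruling_mx b y) = ruling0 y.
Proof. by apply/rowP; apply: I4P; rewrite !mxE. Qed.

Lemma ruling_mx1 b y : row i1 (ruling_mx b y) = ruling1 b y.
Proof. by apply/rowP; apply: I4P; rewrite !mxE. Qed.

Lemma surf_pt_ruling b x y : plane2 (ruling0 y) (ruling1 b y) (surf_pt b x y).
Proof.
exists 1, x; apply/rowP; apply: I4P; rewrite !mxE /= ?mulr0 ?mulr1 ?mul1r ?addr0 ?add0r //.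
by case: b; rewrite ?mulr0.
Qed.

Lemma restrict_ideal_power (I : set {mpoly K[4]}) m b f :
  ideal_power I m f -> exists (n : nat) (c : 'I_n -> {poly {poly K}})
    (g : 'I_n -> 'I_m -> {mpoly K[4]}), (forall i j, I (g i j)) /\
    restrict b f = \sum_i c i * \prod_j restrict b (g i j).
Proof.
move=> [n [c [g [Ig ->]]]]; exists n, (fun i => restrict b (c i)), g; split=> //.
rewrite /restrict rmorph_sum; apply: eq_bigr => i _.
by rewrite rmorphM rmorph_prod.
Qed.

(** f lies in the m-th power of the ideal of the line, and each element of that ideal restricts to a
    multiple of the equation of y = const. *)
Lemma restrict_ruling b f y m : vanish f (plane2 (ruling0 y) (ruling1 b y)) m ->
  exists Q, restrict b f = Q * ('X - (y%:P)%:P) ^+ m.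
Proof.
rewrite -(ruling_mx0 b) -(ruling_mx1 b) => V.
have := vanish_in_ideal_power K_char0 (ruling_mx_unit b y) V.
move=> /(restrict_ideal_power b) [n [c [g [Ig E]]]].
have /choice [q Hq] : forall ij : 'I_n * 'I_m, exists Q,
    restrict b (g ij.1 ij.2) = Q * ('X - (y%:P)%:P).
  move=> [i j] /=; apply/factor_theorem/rootP.
  apply: (poly_zero_fun K_char0) => x; rewrite restrict_eval; apply: (Ig i j).
  by rewrite ruling_mx0 ruling_mx1; apply: surf_pt_ruling.
exists (\sum_i c i * \prod_j q (i, j)); rewrite E mulr_suml; apply: eq_bigr => i _.
rewrite -mulrA; congr (_ * _); rewrite -[m in _ ^+ m](card_ord m) -prodr_const -big_split /=.
by apply: eq_bigr => j _; apply: (Hq (i, j)).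
Qed.

Lemma restrict_vanish2 b f g m x y : g \in unitmx ->
  vanish f (plane2 (row i0 g) (row i1 g)) m ->
  plane2 (row i0 g) (row i1 g) (surf_pt b x y) -> vanish2 (restrict b f) x y m.
Proof.
move=> gu V UP; have := vanish_in_ideal_power K_char0 gu V.
move=> /(restrict_ideal_power b) [n [c [h [Ih E]]]].
rewrite E; apply: vanish2_sum => i _; apply: vanish2_Ml; apply: vanish2_prod => j.
by apply: vanish2_1; rewrite restrict_eval; apply: (Ih i j).
Qed.

End Surfaces.

(** * Conditions at the points where a line meets a surface *)

Section Entries.
Variable A : comNzRingType.
Implicit Types (b : bool) (w : 'rV[A]_4).

(** For b = false this is x0 x3, the plane x3 = 0 together with the plane x0 = 0 at infinity. Both
    kinds of surface are thus met by a line in two points and share all formulas; the spurious point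
    at infinity drops out because [taylor_poly] carries a power of its x0-coordinate. *)
Definition qform b w : A :=
  w 0 i0 * w 0 i3 - (if b then w 0 i1 * w 0 i2 else 0).

Definition qpolar b w w' : A := w 0 i0 * w' 0 i3 + w 0 i3 * w' 0 i0 -
  (if b then w 0 i1 * w' 0 i2 + w 0 i2 * w' 0 i1 else 0).

Definition qdisc b w1 w2 : A :=
  qpolar b w1 w2 ^+ 2 - 4%:R * qform b w1 * qform b w2.

(* The two points of the line <w1, w2> on the quadric [qform b = 0] are the
   values of this vector at the two square roots of [qdisc b w1 w2]. *)
Definition meet_pt b w1 w2 (i : 'I_4) : {poly A} :=
  ('X - (qpolar b w1 w2)%:P) * (w1 0 i)%:P + (2%:R * qform b w1 * w2 0 i)%:P.

(* The coefficient of x^u y^v in the (r, s)-th Taylor coefficient at a point of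
   the line, homogenized to degree T in x0 and multiplied by the equation of the
   lines y = const that have been divided out. *)
Definition taylor_poly b w1 w2 (ys : seq A) (T r s u v : nat) : {poly A} :=
  (\prod_(y <- ys) (meet_pt b w1 w2 i2 - y%:P * meet_pt b w1 w2 i0)) *
  (meet_pt b w1 w2 i0 ^+ (T - (u - r) - (v - s)) *
   (meet_pt b w1 w2 i1 ^+ (u - r) * meet_pt b w1 w2 i2 ^+ (v - s))) *+
  ('C(u, r) * 'C(v, s)).

(* A polynomial condition imposed at both square roots of the discriminant is
   imposed on the even and on the odd part separately; this makes the
   conditions at the two points rational in the coefficients of the line. *)
Definition taylor_entry (par : bool) b w1 w2 ys T r s u v : A :=
  let p := taylor_poly b w1 w2 ys T r s u v in
  let d := qdisc b w1 w2 in
  if par then (even_poly p).[d] else d * (odd_poly p).[d].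

End Entries.

Section EntriesMorphism.
Variables (A B : comNzRingType) (phi : {rmorphism A -> B}).

Lemma map_qform b (w : 'rV[A]_4) : qform b (map_mx phi w) = phi (qform b w).
Proof.
by rewrite /qform !mxE rmorphB rmorphM; case: b; rewrite ?rmorphM ?rmorph0.
Qed.

Lemma map_qpolar b (w w' : 'rV[A]_4) :
  qpolar b (map_mx phi w) (map_mx phi w') = phi (qpolar b w w').
Proof.
by rewrite /qpolar !mxE rmorphB rmorphD !rmorphM; case: b; rewrite ?rmorphD ?rmorphM ?rmorph0.
Qed.

Lemma map_qdisc b (w w' : 'rV[A]_4) :
  qdisc b (map_mx phi w) (map_mx phi w') = phi (qdisc b w w').
Proof.
by rewrite /qdisc map_qpolar !map_qform [RHS]rmorphB rmorphXn !rmorphM rmorph_nat.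
Qed.

Lemma map_meet_pt b (w w' : 'rV[A]_4) i :
  meet_pt b (map_mx phi w) (map_mx phi w') i = map_poly phi (meet_pt b w w' i).
Proof.
rewrite /meet_pt map_qpolar map_qform !mxE [RHS]rmorphD [X in _ = X + _]rmorphM.
rewrite [X in _ = X * _ + _]rmorphB /= map_polyX.
by rewrite !map_polyC /= (rmorphM phi (2%:R * qform b w)) (rmorphM phi 2%:R) rmorph_nat.
Qed.

Lemma map_taylor_poly b (w w' : 'rV[A]_4) ys T r s u v :
  taylor_poly b (map_mx phi w) (map_mx phi w') (map phi ys) T r s u v =
  map_poly phi (taylor_poly b w w' ys T r s u v).
Proof.
rewrite /taylor_poly rmorphMn rmorphM rmorph_prod big_map !map_meet_pt.
rewrite !rmorphM !rmorphXn; congr (_ * _ *+ _); apply: eq_bigr => y _.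
by rewrite rmorphB rmorphM /= map_polyC.
Qed.

Lemma map_taylor_entry par b (w w' : 'rV[A]_4) ys T r s u v :
  taylor_entry par b (map_mx phi w) (map_mx phi w') (map phi ys) T r s u v =
  phi (taylor_entry par b w w' ys T r s u v).
Proof.
rewrite /taylor_entry map_taylor_poly map_qdisc; set p := taylor_poly _ _ _ _ _ _ _ _ _.
have -> : even_poly (map_poly phi p) = map_poly phi (even_poly p).
  by apply/polyP => i; rewrite coef_even_poly !coef_map coef_even_poly.
have -> : odd_poly (map_poly phi p) = map_poly phi (odd_poly p).
  by apply/polyP => i; rewrite coef_odd_poly !coef_map coef_odd_poly.
by case: par; rewrite ?rmorphM horner_map.
Qed.

Lemma map_ruling0 (y : A) : map_mx phi (ruling0 y) = ruling0 (phi y).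
Proof. by apply/rowP; apply: I4P; rewrite !mxE /= ?rmorph1 ?rmorph0. Qed.

Lemma map_ruling1 b (y : A) : map_mx phi (ruling1 b y) = ruling1 b (phi y).
Proof.
by apply/rowP; apply: I4P; rewrite !mxE /= ?rmorph1 ?rmorph0; case: b; rewrite ?rmorph0.
Qed.

End EntriesMorphism.

Section TaylorConditions.
Variable K : closedFieldType.
Hypothesis K_char0 : [pchar K] =i pred0.

Lemma coef_XaddC_exp (R : comNzRingType) (c : R) u i :
  (('X + c%:P) ^+ u)`_i = c ^+ (u - i) *+ 'C(u, i).
Proof.
rewrite addrC exprDn coef_sum; case: (ltnP u i) => le.
  rewrite bin_small // mulr0n big1 // => j _.
  by rewrite coefMn -rmorphXn /= coefCM coefXn gtn_eqF ?mulr0 ?mul0rn //;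
     have := ltn_ord j; lia.
rewrite (bigD1 (inord i)) //= inordK // big1 ?addr0 => [|j ne].
  by rewrite coefMn -rmorphXn /= coefCM coefXn eqxx mulr1.
rewrite coefMn -rmorphXn /= coefCM coefXn; case: eqP => [e|_]; last by rewrite mulr0 mul0rn.
by case/eqP: ne; apply: val_inj; rewrite /= inordK.
Qed.

(** The truncated differences are harmless, since the binomials vanish when u < r or v < s. *)
Lemma shift2_coef (G : {poly {poly K}}) (x0 y0 : K) (U V r s : nat) :
  (forall u v, (U <= u)%N || (V <= v)%N -> G`_v`_u = 0) ->
  (shift2 x0 y0 G)`_s`_r = \sum_(v < V) \sum_(u < U)
    G`_v`_u * (x0 ^+ (u - r) * y0 ^+ (v - s)) *+ ('C(u, r) * 'C(v, s)).
Proof.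
move=> HG.
have GE : G = \sum_(v < V) \sum_(u < U) (G`_v`_u *: 'X^u)%:P * 'X^v.
  apply/polyP => v; rewrite coef_sum; case: (ltnP v V) => le; last first.
    rewrite big1 => [|v' _]; first by apply/polyP => u; rewrite HG ?coef0 // le orbT.
    rewrite coef_sum big1 // => u _; rewrite coefCM coefXn gtn_eqF ?mulr0 //.
    exact: leq_trans le.
  rewrite (bigD1 (Ordinal le)) //= [X in _ + X]big1 ?addr0 => [|v' ne]; last first.
    rewrite coef_sum big1 // => u _; rewrite coefCM coefXn.
    case: eqP => [e|_]; last by rewrite mulr0.
    by case/eqP: ne; apply: val_inj.
  rewrite coef_sum; apply/polyP => u; rewrite coef_sum.
  case: (ltnP u U) => leu; last first.
    rewrite HG ?leu // big1 // => u' _; rewrite coefCM coefXn eqxx mulr1 coefZ coefXn.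
    by rewrite gtn_eqF ?mulr0 //; apply: leq_trans leu.
  rewrite (bigD1 (Ordinal leu)) //= coefCM coefXn eqxx mulr1 coefZ coefXn eqxx mulr1.
  rewrite big1 ?addr0 // => u' ne; rewrite coefCM coefXn eqxx mulr1 coefZ coefXn.
  by case: eqP => [e|_]; rewrite ?mulr0 //; case/eqP: ne; apply: val_inj.
rewrite {1}GE /shift2 !raddf_sum !coef_sum; apply: eq_bigr => v _.
rewrite !raddf_sum !coef_sum; apply: eq_bigr => u _ /=.
rewrite rmorphM /= map_polyC map_polyXn /= comp_polyZ comp_Xn_poly comp_polyM.
rewrite comp_polyC comp_Xn_poly coefCM coef_XaddC_exp -rmorphXn -rmorphMn /= coefMC.
by rewrite coefZ coef_XaddC_exp !(mulrnAr, mulrnAl) -mulrnA mulrA.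
Qed.

Section AtPoint.
Variables (b : bool) (w1 w2 : 'rV[K]_4) (ys : seq K) (U V T : nat).
Variable G : {poly {poly K}}.
Hypothesis GUV : forall u v, (U <= u)%N || (V <= v)%N -> G`_v`_u = 0.
Hypothesis TUV : (U + V < T)%N.

Let pt (z : K) (i : 'I_4) : K := (meet_pt b w1 w2 i).[z].

Definition taylor_sum (r s : nat) : {poly K} :=
  \sum_(v < V) \sum_(u < U) G`_v`_u *: taylor_poly b w1 w2 ys T r s u v.

Lemma taylor_sumE z r s : (taylor_sum r s).[z] =
  (\prod_(y <- ys) (pt z i2 - y * pt z i0)) * pt z i0 ^+ T *
  (shift2 (pt z i1 / pt z i0) (pt z i2 / pt z i0) G)`_s`_r.
Proof.
rewrite (shift2_coef _ _ _ _ GUV) mulr_sumr horner_sum; apply: eq_bigr => v _.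
rewrite mulr_sumr horner_sum; apply: eq_bigr => u _.
rewrite hornerZ /taylor_poly hornerMn !hornerM !horner_exp.
rewrite -/(pt z i0) -/(pt z i1) -/(pt z i2).
have -> : (\prod_(y <- ys) (meet_pt b w1 w2 i2 - y%:P * meet_pt b w1 w2 i0)).[z] =
    \prod_(y <- ys) (pt z i2 - y * pt z i0).
  by rewrite horner_prod; apply: eq_bigr => y _; rewrite hornerD hornerN hornerM hornerC.
set k := \prod_(_ <- _) _.
(* A point with x0 = 0 lies outside the chart and its affine coordinates are junk values; both sides
   are 0 there because [TUV] leaves a positive power of x0 in every term. *)
have [p0|p0] := eqVneq (pt z i0) 0.
  have e1 : (0 < T - (u - r) - (v - s))%N.
    by have := ltn_ord u; have := ltn_ord v; lia.
  have e2 : (0 < T)%N by lia.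
  by rewrite p0 !expr0n !gtn_eqF //= !(mul0r, mulr0, mul0rn).
have -> : pt z i0 ^+ T = pt z i0 ^+ (T - (u - r) - (v - s)) *
    (pt z i0 ^+ (u - r) * pt z i0 ^+ (v - s)).
  rewrite -!exprD; congr (_ ^+ _); have := ltn_ord u; have := ltn_ord v; lia.
rewrite !mulrnAr; congr (_ *+ _); rewrite !exprMn !exprVn.
have n1 : pt z i0 ^+ (u - r) != 0 by rewrite expf_neq0.
have n2 : pt z i0 ^+ (v - s) != 0 by rewrite expf_neq0.
move: (pt z i0 ^+ (u - r)) (pt z i0 ^+ (v - s)) (pt z i0 ^+ (T - (u - r) - (v - s)))
  (pt z i1 ^+ (u - r)) (pt z i2 ^+ (v - s)) n1 n2 => e1 e2 e3 e4 e5 n1 n2.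
by field; rewrite n1 n2.
Qed.

Lemma taylor_entry_sum par r s :
  \sum_(v < V) \sum_(u < U) G`_v`_u * taylor_entry par b w1 w2 ys T r s u v =
  if par then (even_poly (taylor_sum r s)).[qdisc b w1 w2]
  else qdisc b w1 w2 * (odd_poly (taylor_sum r s)).[qdisc b w1 w2].
Proof.
rewrite /taylor_entry /taylor_sum; case: par.
  rewrite raddf_sum horner_sum; apply: eq_bigr => v _.
  rewrite raddf_sum horner_sum; apply: eq_bigr => u _.
  by rewrite /= linearZ /= hornerZ.
rewrite raddf_sum horner_sum mulr_sumr; apply: eq_bigr => v _.
rewrite raddf_sum horner_sum mulr_sumr; apply: eq_bigr => u _.
by rewrite /= linearZ /= hornerZ mulrCA.
Qed.

Lemma horner_even_odd (p : {poly K}) z :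
  p.[z] = (even_poly p).[z ^+ 2] + z * (odd_poly p).[z ^+ 2].
Proof.
by rewrite -{1}[p]poly_even_odd !hornerE !horner_comp !hornerXn mulrC.
Qed.

Lemma two_neq0 : 2%:R != 0 :> K.
Proof. by rewrite -[0](mulr0n 1) (inj_eq (natr_inj_char0 K_char0)). Qed.

(** Vanishing at z and -z gives e = 0 and z o = 0 for the even and odd parts e and o. When d = 0
    this says nothing about o, but d o = z (z o) = 0 in all cases; hence the factor d in the odd
    row. *)
Lemma taylor_rows_eq0 r s :
  (forall z, z ^+ 2 = qdisc b w1 w2 -> (taylor_sum r s).[z] = 0) ->
  forall par, \sum_(v < V) \sum_(u < U)
    G`_v`_u * taylor_entry par b w1 w2 ys T r s u v = 0.
Proof.
move=> H par; rewrite taylor_entry_sum; set d := qdisc b w1 w2 in H *.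
have [z zz] : exists z : K, z ^+ 2 = d.
  have [z] := @solve_monicpoly K 2 (fun i => if i == 0%N then d else 0) isT.
  rewrite !big_ord_recl big_ord0 /= mul0r !addr0 mulr1 => E.
  by exists z.
have H1 := H z zz; have H2 := H (- z) (etrans (sqrrN z) zz).
rewrite horner_even_odd zz in H1; rewrite horner_even_odd sqrrN zz in H2.
set e := (even_poly _).[d] in H1 H2 *; set o := (odd_poly _).[d] in H1 H2 *.
have e0 : e = 0.
  have : 2%:R * e = 0 by rewrite -[RHS](addr0 0) -{1}H1 -H2; ring.
  by move/eqP; rewrite mulf_eq0 (negPf two_neq0) => /eqP.
case: par => //; rewrite -zz expr2 -mulrA; move: H1; rewrite e0 add0r => ->.
exact: mulr0.
Qed.

Lemma meet_pt_on z : z ^+ 2 = qdisc b w1 w2 -> qform b (\row_i pt z i) = 0.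
Proof.
move=> zz; rewrite /qform !mxE /pt /meet_pt !hornerE.
move: zz; rewrite /qdisc; set B := qpolar b w1 w2; set a := qform b w1 => zz.
set c := qform b w2 in zz.
transitivity (a * (z ^+ 2 - (B ^+ 2 - 4%:R * a * c))); last by rewrite zz subrr mulr0.
by rewrite /a /c /B /qform /qpolar; case: b; ring.
Qed.

(** The converse, at a point of the chart: for a nonzero discriminant the even and odd rows together
    give vanishing at each square root. The given point belongs to one of these, and the factors in
    front of its Taylor coefficient are nonzero. *)
Lemma taylor_entry_vanish m x y :
  qform b w1 != 0 -> qdisc b w1 w2 != 0 ->
  (exists s t, surf_pt b x y = s *: w1 + t *: w2) ->
  (forall y', y' \in ys -> y != y') ->
  (forall par r s, (r + s < m)%N -> \sum_(v < V) \sum_(u < U)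
    G`_v`_u * taylor_entry par b w1 w2 ys T r s u v = 0) ->
  vanish2 G x y m.
Proof.
move=> q1 d0 [s [t E]] yys H r s' lt.
have Q0 : qform b (surf_pt b x y) = 0.
  by rewrite /qform !mxE /=; case: b; rewrite ?mul1r ?mulr0 ?subrr ?subr0.
have Qst : qform b w1 * s ^+ 2 + qpolar b w1 w2 * (s * t) + qform b w2 * t ^+ 2 = 0.
  by rewrite -Q0 E /qform /qpolar !mxE; case: b; ring.
have t0 : t != 0.
  apply/negP => /eqP t0; move: Qst; rewrite t0 expr0n /= !mulr0 !addr0 => /eqP.
  rewrite mulf_eq0 (negPf q1) expf_eq0 /= => /eqP s0.
  have := congr1 (fun w : 'rV_4 => w 0 i0) E.
  by rewrite s0 t0 !mxE /= !mul0r addr0 => /eqP; rewrite oner_eq0.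
(* The square root at which [meet_pt] becomes proportional to s w1 + t w2. *)
pose z := qpolar b w1 w2 + 2%:R * qform b w1 * (s / t).
have zz : z ^+ 2 = qdisc b w1 w2.
  apply/eqP; rewrite -subr_eq0; apply/eqP.
  transitivity (4%:R * qform b w1 / t ^+ 2 * (qform b w1 * s ^+ 2 +
    qpolar b w1 w2 * (s * t) + qform b w2 * t ^+ 2)); last by rewrite Qst mulr0.
  by rewrite /z /qdisc; field.
have ptE i : pt z i = 2%:R * qform b w1 / t * surf_pt b x y 0 i.
  rewrite E /pt /meet_pt !hornerE /z; set B := qpolar _ _ _; set a := qform _ _.
  by rewrite !mxE; field.
have c0 : 2%:R * qform b w1 / t != 0.
  by rewrite !mulf_neq0 ?two_neq0 ?invr_eq0.
have z0 : z != 0 by apply: contraNneq d0 => z0; rewrite -zz z0 expr0n.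
have T0 : (taylor_sum r s').[z] = 0.
  rewrite horner_even_odd zz.
  have := H true r s' lt; have := H false r s' lt; rewrite !taylor_entry_sum /=.
  move/eqP; rewrite mulf_eq0 (negPf d0) => /eqP -> ->.
  by rewrite mulr0 addr0.
move: T0; rewrite taylor_sumE !ptE ![surf_pt b x y 0 _]mxE /= mulr1.
rewrite ![_ * x]mulrC ![_ * y]mulrC !mulfK // => /eqP.
rewrite mulf_eq0 mulf_eq0 prodf_seq_eq0 expf_eq0 (negPf c0) andbF orbF.
case/orP => [/hasP[y' y's /=]|/eqP //].
rewrite -mulrBl mulf_eq0 (negPf c0) orbF subr_eq0.
by rewrite (negPf (yys _ y's)).
Qed.

End AtPoint.
End TaylorConditions.

(** * Generic configurations and the degree reduction *)

Section Generic.
Variables (K : fieldType) (V : lmodType K).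
Hypothesis K_char0 : [pchar K] =i pred0.

Definition generic (P : V -> Prop) : Prop :=
  exists F : V -> K, [/\ linepoly F, exists v, F v != 0 & forall v, F v != 0 -> P v].

Lemma generic_ex (P : V -> Prop) : generic P -> exists v, P v.
Proof. by move=> [F [_ [v Fv] H]]; exists v; apply: H. Qed.

Lemma generic_sub (P Q : V -> Prop) : (forall v, P v -> Q v) -> generic P -> generic Q.
Proof. by move=> PQ [F [HF HE HP]]; exists F; split=> // v /HP/PQ. Qed.

Lemma generic_neq0 (F : V -> K) : linepoly F -> (exists v, F v != 0) ->
  generic (fun v => F v != 0).
Proof. by move=> HF [v Fv]; exists F; split=> //; exists v. Qed.

Lemma generic_all (I : finType) (P : I -> V -> Prop) :
  (forall i, generic (P i)) -> generic (fun v => forall i, P i v).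
Proof.
move=> /choice[F HF]; exists (fun v => \prod_i F i v); split.
- by apply: linepoly_prod => i; have [] := HF i.
- have [||v Hv] := @linepoly_nonzero K K_char0 V I F.
  + by move=> i; have [] := HF i.
  + by move=> i; have [] := HF i.
  + by exists v; apply/prodf_neq0 => i _.
- by move=> v /prodf_neq0 H i; have [_ _] := HF i; apply; apply: H.
Qed.

Lemma generic_impl (b : Prop) (P : V -> Prop) : (b -> generic P) -> generic (fun v => b -> P v).
Proof.
move=> H; have [hb|nb] := pselect b.
  by have [F [HF HE HP]] := H hb; exists F; split=> // v /HP.
exists (fun=> 1); split=> //; first exact: linepoly_cst.
by exists 0; apply: oner_neq0.
Qed.

Lemma generic_and (P Q : V -> Prop) : generic P -> generic Q -> generic (fun v => P v /\ Q v).
Proof.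
move=> HP HQ; have [|F [HF HE H]] := @generic_all bool (fun b => if b then P else Q).
  by case.
by exists F; split=> // v Fv; have := H v Fv; split; [exact: (H v Fv true)|exact: (H v Fv false)].
Qed.

End Generic.

Section Configurations.
Variable K : closedFieldType.
Hypothesis K_char0 : [pchar K] =i pred0.
(* [N] surfaces of total degree [q]: quadrics ([kind j]) and planes. The j-th
   surface is the image of the standard one under the j-th matrix and carries
   [k j] lines, the images of lines y = const of the chart. *)
Variables (N q : nat) (kind : 'I_N -> bool) (k : 'I_N -> nat).

(** The matrices are arbitrary and every surface gets q parameters whatever [k j] is, so that
    configurations form a vector space and [linepoly] applies. Invertibility is imposed later as one
    of the generic conditions. *)
Definition cfg : Type := ({ffun 'I_N -> 'M[K]_4} * 'M[K]_(N, q))%type.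
HB.instance Definition _ := GRing.Lmodule.on cfg.
Implicit Types (c : cfg) (i j : 'I_N) (b : 'I_q) (m : nat).

Definition cfg0 c i b := ruling0 (c.2 i b) *m c.1 i.
Definition cfg1 c i b := ruling1 (kind i) (c.2 i b) *m c.1 i.

Definition own_params c j : seq K := [seq c.2 j b | b <- enum 'I_q & (b < k j)%N].

(* Exponents (u, v) of x^u y^v that are excluded in the residual of the
   restriction to the j-th surface of a form of degree < q m, once its lines
   have been divided out. *)
Definition excluded j m u v : bool :=
  if kind j then (q * m <= u)%N || ((q - k j) * m <= v)%N
  else ((q - k j) * m <= u + v)%N.

(** The adjugate in place of the inverse keeps the entry polynomial in c. The first vector is the
    sum of the two spanning points because [meet_pt] needs a point off the surface, whereas in
    [quadric_cfg] the spanning points of the lines of the other quadrics lie on it. *)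
Definition cfg_entry c par j i b m r s u v : K :=
  taylor_entry par (kind j) ((cfg0 c i b + cfg1 c i b) *m \adj (c.1 j))
    (cfg1 c i b *m \adj (c.1 j)) (own_params c j) (q * m + q * m).+1 r s u v.

Definition cfg_forced m j c : Prop := forall G : {poly {poly K}},
  (forall u v, excluded j m u v -> G`_v`_u = 0) ->
  (forall par i b r s, i != j -> (b < k i)%N -> (r + s < m)%N ->
    \sum_(v < q * m) \sum_(u < q * m) G`_v`_u * cfg_entry c par j i b m r s u v = 0) ->
  G = 0.

(** The same entry computed for the configuration a + X c over [{poly K}] specializes to the entry
    at a + x c. *)
Lemma linepoly_cfg_entry par j i b m r s u v :
  linepoly (fun c => cfg_entry c par j i b m r s u v).
Proof.
move=> a c.
pose g j : 'M[{poly K}]_4 := map_mx polyC (a.1 j) + 'X *: map_mx polyC (c.1 j).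
pose y j b : {poly K} := (a.2 j b)%:P + 'X * (c.2 j b)%:P.
pose w1 := ruling1 (kind i) (y i b) *m g i.
pose w0 := ruling0 (y i b) *m g i.
exists (taylor_entry par (kind j) ((w0 + w1) *m \adj (g j)) (w1 *m \adj (g j))
  [seq y j b | b <- enum 'I_q & (b < k j)%N] (q * m + q * m).+1 r s u v) => x.
rewrite -/(horner_eval x _) -map_taylor_entry.
have gE j' : map_mx (horner_eval x) (g j') = (a + x *: c).1 j'.
  rewrite /g map_mxD map_mxZ -!map_mx_comp /= /horner_eval hornerX !ffunE.
  by congr (_ + _ *: _); rewrite map_mx_id // => z /=; rewrite hornerC.
have yE j' b' : horner_eval x (y j' b') = (a + x *: c).2 j' b'.
  by rewrite /y /horner_eval !hornerE !mxE.
have w0E : cfg0 (a + x *: c) i b = map_mx (horner_eval x) w0.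
  by rewrite /cfg0 -gE -yE -map_ruling0 -map_mxM.
have w1E : cfg1 (a + x *: c) i b = map_mx (horner_eval x) w1.
  by rewrite /cfg1 -gE -yE -map_ruling1 -map_mxM.
have ysE : own_params (a + x *: c) j =
    map (horner_eval x) [seq y j b | b <- enum 'I_q & (b < k j)%N].
  by rewrite -map_comp; apply: eq_map => b' /=; rewrite yE.
by rewrite /cfg_entry ysE w0E w1E -gE -map_mx_adj -map_mxD -!map_mxM.
Qed.

Lemma excluded_box j m u v : (q * m <= u)%N || (q * m <= v)%N -> excluded j m u v.
Proof.
rewrite /excluded => H; have le : ((q - k j) * m <= q * m)%N by rewrite leq_mul2r leq_subr orbT.
case: ifP => _; case/orP: H => H; rewrite ?H //; last 1 first.
- by apply: (leq_trans le); apply: leq_trans H _; rewrite leq_addl.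
- by rewrite (leq_trans le) ?orbT.
- by apply: (leq_trans le); apply: leq_trans H _; rewrite leq_addr.
Qed.

(** A linear system in the coefficients of G with trivial kernel at c0 has there a nonzero maximal
    minor. The minor is polynomial in the configuration, and the kernel is trivial wherever it does
    not vanish. [excluded_box] makes the number of unknowns finite. *)
Lemma generic_forced m j : (exists c, cfg_forced m j c) -> generic (cfg_forced m j).
Proof.
move=> [c0 H0]; pose E : finType := ('I_(q * m) * 'I_(q * m))%type.
pose I : Type := ((bool * 'I_N * 'I_q * (nat * nat)) + (nat * nat))%type.
pose eu (e : 'I_#|E|) : nat := (enum_val e : E).1.
pose ev (e : 'I_#|E|) : nat := (enum_val e : E).2.
(* Rows of two kinds: the conditions at the meeting points, and unit vectors that kill the excluded
   coefficients. Indices out of range give zero rows. *)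
pose rho c (l : I) : 'rV[K]_#|E| := \row_e match l with
  | inl (par, i, b, (r, s)) => if [&& i != j, (b < k i)%N & (r + s < m)%N]
      then cfg_entry c par j i b m r s (eu e) (ev e) else 0
  | inr (u', v') => ([&& excluded j m u' v', u' == eu e & v' == ev e])%:R
  end.
pose toG (x : 'cV[K]_#|E|) : {poly {poly K}} :=
  \poly_(v < q * m) \poly_(u < q * m)
    (if insub u is Some u then if insub v is Some v then x (enum_rank (u, v)) 0 else 0 else 0).
have toGE x (u v : 'I_(q * m)) : (toG x)`_v`_u = x (enum_rank (u, v)) 0.
  by rewrite coef_poly ltn_ord coef_poly ltn_ord !valK.
have sumE c l x : (rho c l *m x) 0 0 = \sum_(v < q * m) \sum_(u < q * m)
    rho c l 0 (enum_rank (u, v)) * x (enum_rank (u, v)) 0.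
  rewrite mxE (reindex (@enum_rank E)) /=; last first.
    by exists enum_val => e _; rewrite ?enum_rankK ?enum_valK.
  rewrite exchange_big pair_big /=; apply: eq_bigr => -[u v] _ //.
have ker c (x : 'cV_#|E|) (G : {poly {poly K}}) :
    (forall u v : 'I_(q * m), G`_v`_u = x (enum_rank (u, v)) 0) ->
    (forall l, rho c l *m x = 0) <->
    ((forall u v : 'I_(q * m), excluded j m u v -> G`_v`_u = 0) /\
     (forall par i b r s, i != j -> (b < k i)%N -> (r + s < m)%N ->
      \sum_(v < q * m) \sum_(u < q * m) G`_v`_u * cfg_entry c par j i b m r s u v = 0)).
  move=> Gx; split=> [H|[H1 H2] l].
    split=> [u v ex|par i b r s ne lt lt'].
      have := congr1 (fun A : 'M[K]_1 => A 0 0) (H (inr (val u, val v))).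
      rewrite sumE mxE (bigD1 v) //= (bigD1 u) //= !mxE /eu /ev !enum_rankK /= ex !eqxx mul1r.
      rewrite big1 ?addr0 => [|u' ne]; last first.
        by rewrite !mxE /eu /ev !enum_rankK /= !val_eqE [u == u']eq_sym (negPf ne) andbF mul0r.
      rewrite big1 ?addr0 => [|v' ne]; first by rewrite Gx.
      rewrite big1 // => u' _.
      by rewrite !mxE /eu /ev !enum_rankK /= !val_eqE [v == v']eq_sym (negPf ne) !andbF mul0r.
    have := congr1 (fun A : 'M[K]_1 => A 0 0) (H (inl (par, i, b, (r, s)))).
    rewrite sumE [RHS]mxE => EE; rewrite -[RHS]EE; apply: eq_bigr => v _; apply: eq_bigr => u _.
    by rewrite !mxE /eu /ev !enum_rankK /= ne lt lt' /= Gx mulrC.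
  apply/matrixP => o o'; rewrite !ord1 sumE mxE.
  case: l => [[[[par i] b] [r s]]|[u' v']].
    case C : [&& i != j, (b < k i)%N & (r + s < m)%N]; last first.
      by rewrite big1 // => v _; rewrite big1 // => u _; rewrite !mxE C mul0r.
    case/and3P: (C) => ne lt lt'; rewrite -[RHS](H2 par i b r s ne lt lt').
    apply: eq_bigr => v _; apply: eq_bigr => u _.
    by rewrite !mxE /eu /ev !enum_rankK /= C Gx mulrC.
  rewrite big1 // => v _; rewrite big1 // => u _; rewrite !mxE /eu /ev !enum_rankK /=.
  case: and3P => [[ex /eqP e1 /eqP e2]|]; last by rewrite mul0r.
  by rewrite -Gx H1 ?mulr0 // -e1 -e2.
have [x Hx|r Hr] := @nonzero_minor K I #|E| (rho c0).
  have [H1 H2] := (iffLR (ker c0 x (toG x) (toGE x)) Hx).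
  have G0 : toG x = 0.
    apply: H0 => // u v ex.
    case: (ltnP v (q * m)) => lv; last by rewrite coef_poly ltnNge lv coef0.
    case: (ltnP u (q * m)) => lu; last by rewrite !coef_poly lv coef_poly ltnNge lu.
    exact: (H1 (Ordinal lu) (Ordinal lv)).
  apply/matrixP => e o; rewrite ord1 mxE -(enum_valK e).
  by case: (enum_val e) => u v; rewrite -toGE G0 !coef0.
exists (fun c => \det (\matrix_l rho c (r l))); split.
- apply: (linepoly_ext _ (@linepoly_det _ _ _ (fun l e c => rho c (r l) 0 e) _)).
    by move=> c; congr (\det _); apply/matrixP => l e; rewrite !mxE.
  move=> l e; case: (r l) => [[[[par i] b] [r' s']]|[u' v']].
    case C : [&& i != j, (b < k i)%N & (r' + s' < m)%N].
      apply: (linepoly_ext _ (@linepoly_cfg_entry par j i b m r' s' (eu e) (ev e))).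
      by move=> c; rewrite mxE C.
    by apply: (linepoly_ext _ (@linepoly_cst K cfg 0)) => c; rewrite mxE C.
  by apply: (linepoly_ext _ (@linepoly_cst K cfg
      ([&& excluded j m u' v', u' == eu e & v' == ev e])%:R)) => c;
    rewrite mxE.
- by exists c0.
- move=> c Fc G HG1 HG2.
  pose x : 'cV[K]_#|E| := \col_e G`_(ev e)`_(eu e).
  have Gx (u v : 'I_(q * m)) : G`_v`_u = x (enum_rank (u, v)) 0.
    by rewrite mxE /eu /ev enum_rankK.
  have Hk : forall l, rho c l *m x = 0.
    by apply/(ker c x G Gx); split=> // u v; apply: HG1.
  have x0 : x = 0.
    have : (\matrix_l rho c (r l)) *m x = 0.
      by apply/row_matrixP => l; rewrite row_mul rowK Hk row0.
    move/(congr1 (mulmx (invmx (\matrix_l rho c (r l))))).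
    by rewrite mulKmx ?mulmx0 // unitmxE unitfE.
  apply: poly2_eq0 => u v.
  case: (ltnP v (q * m)) => lv; last by apply: HG1; apply: excluded_box; rewrite lv orbT.
  case: (ltnP u (q * m)) => lu; last by apply: HG1; apply: excluded_box; rewrite lu.
  by rewrite (Gx (Ordinal lu) (Ordinal lv)) x0 mxE.
Qed.

End Configurations.

Section Horace.
Variable K : closedFieldType.
Hypothesis K_char0 : [pchar K] =i pred0.
Variables (N q : nat) (kind : 'I_N -> bool) (k : 'I_N -> nat).
Hypothesis k_le_q : forall j, (k j <= q)%N.
Implicit Types (c : cfg K N q) (i j : 'I_N) (b : 'I_q) (m t : nat) (f : {mpoly K[4]}).

Definition cfg_line c i b := plane2 (cfg0 c i b) (cfg1 kind c i b).

Definition cfg_vanish c f m := forall i b, (b < k i)%N -> vanish f (cfg_line c i b) m.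

Lemma count_ord_lt n p : (p <= n)%N -> size [seq b : 'I_n <- enum 'I_n | (b < p)%N] = p.
Proof.
move=> le; rewrite size_filter.
have -> : count (fun b : 'I_n => (b < p)%N) (enum 'I_n) =
  count (fun x => (x < p)%N) [seq val x | x <- enum 'I_n] by rewrite count_map.
rewrite val_enum_ord.
rewrite -{1}(subnKC le) iotaD count_cat (eq_in_count (a2 := predT)); last first.
  by move=> x; rewrite mem_iota add0n => /andP[_ ->].
rewrite count_predT size_iota (eq_in_count (a2 := pred0)) ?count_pred0 ?addn0 //.
by move=> x; rewrite mem_iota add0n => /andP[lx _]; rewrite ltnNge lx.
Qed.

Lemma size_own_params c j : size (own_params k c j) = k j.
Proof. by rewrite size_map count_ord_lt. Qed.

Lemma prod_horiz_exp_coef0 (G : {poly {poly K}}) (ds : seq K) m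
    (Z : nat -> nat -> bool) :
  (forall u v, Z u v -> Z u v.+1) ->
  (forall u v, Z u v ->
     (((\prod_(d <- ds) ('X - (d%:P)%:P)) ^+ m) * G)`_(v + size ds * m)`_u = 0) ->
  forall u v, Z u v -> G`_v`_u = 0.
Proof.
move=> Zup H; apply: (@prod_horiz_coef0 _ G (flatten (nseq m ds))) => // u v Zuv.
rewrite big_flatten big_nseq iter_mulr_1 size_flatten /shape map_nseq sumn_nseq.
exact: H.
Qed.

(** In coordinates where the j-th surface is standard, its own lines split off to order m, and the
    residual [G0] has no excluded coefficients. At the points where the other lines meet the surface
    the restriction vanishes to order m, and so does [G0] off the own lines. Hence [G0] solves the
    system that forces it to be 0. *)
Lemma cfg_forced_restrict c j m f t :
  (forall i, \det (c.1 i) != 0) ->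
  (forall b b', b != b' -> c.2 j b != c.2 j b') ->
  cfg_forced kind k m j c -> f \is t.-homog -> (t < q * m)%N ->
  cfg_vanish c f m -> restrict (kind j) (lsub (c.1 j) f) = 0.
Proof.
move=> dets dist forced fh lt V.
set fj := lsub (c.1 j) f.
have fjh : fj \is t.-homog by apply: lsub_homog.
have own b : (b < k j)%N ->
    vanish fj (plane2 (ruling0 (c.2 j b)) (ruling1 (kind j) (c.2 j b))) m.
  move=> lb P w [x [y ->]] l ltl; rewrite fline_lsub; apply: (V j b lb) => //.
  by exists x, y; rewrite mulmxDl -!scalemxAl.
have uys : uniq (own_params k c j).
  rewrite map_inj_in_uniq => [|b b' _ _ E]; first exact/filter_uniq/enum_uniq.
  by apply/eqP/negPn/negP => /dist; rewrite E eqxx.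
have [||G0 EG0] := @prod_XsubC_exp_dvd _ [seq y%:P | y <- own_params k c j] m
    (restrict (kind j) fj).
- by rewrite map_inj_uniq //; apply: polyC_inj.
- move=> r /mapP[y /mapP[b]]; rewrite mem_filter => /andP[lb _] -> ->.
  exact/restrict_ruling/own.
rewrite big_map in EG0; set D := \prod_(_ <- _) _ in EG0.
have EG : restrict (kind j) fj = D ^+ m * G0 by rewrite EG0 mulrC.
have exc u v : excluded q kind k j m u v -> G0`_v`_u = 0.
  apply: (@prod_horiz_exp_coef0 _ (own_params k c j) m (excluded q kind k j m)).
    move=> u' v'; rewrite /excluded; case: ifP => _.
      by case/orP => [->//|h]; rewrite (leq_trans h) ?orbT.
    by move=> h; rewrite addnS (leq_trans h).
  move=> u' v'; rewrite -EG size_own_params /excluded.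
  have kq : ((q - k j) * m + k j * m = q * m)%N by rewrite -mulnDl subnK.
  case: (kind j) => [h|h].
    apply: (restrict_quadric_coef0 fjh).
    by case/orP: h => h; apply/orP; [left|right]; lia.
  by apply: (restrict_plane_coef0 fjh); lia.
suff G00 : G0 = 0 by rewrite EG G00 mulr0.
apply: forced => // par i b r s ne lb rs.
have box u v : (q * m <= u)%N || (q * m <= v)%N -> G0`_v`_u = 0.
  by move=> h; apply: exc; apply: excluded_box.
apply: (taylor_rows_eq0 K_char0) => z zz.
rewrite (taylor_sumE _ _ _ _ box) //.
set w1 := _ *m _ in zz *; set w2 := _ *m _ in zz *.
pose pt l : K := (meet_pt (kind j) w1 w2 l).[z].
rewrite -/(pt i0) -/(pt i1) -/(pt i2).
(* Points at infinity and points on the own lines satisfy the condition trivially, through the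
   factors built into [taylor_poly]. *)
have [p0|p0] := eqVneq (pt i0) 0; first by rewrite p0 expr0n mulr0 mul0r.
have [->|kap] := eqVneq (\prod_(y <- own_params k c j) (pt i2 - y * pt i0)) 0.
  by rewrite !mul0r.
suff V2 : vanish2 G0 (pt i1 / pt i0) (pt i2 / pt i0) m by rewrite V2 ?mulr0.
apply: (@vanish2_unit _ _ (D ^+ m)).
  rewrite !horner_exp expf_neq0 // /D !horner_prod prodf_seq_neq0.
  apply/allP => y yys /=; rewrite !hornerE.
  move: kap; rewrite prodf_seq_neq0 => /allP/(_ _ yys) /=.
  by rewrite -{1}[pt i2](divfK p0) -mulrBl mulf_eq0 (negPf p0) orbF.
rewrite -EG; pose g := ruling_mx (kind i) (c.2 i b) *m c.1 i *m \adj (c.1 j).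
have gu : g \in unitmx.
  rewrite !unitmx_mul ruling_mx_unit !unitmxE !unitfE dets /=.
  have : \det (\adj (c.1 j)) * \det (c.1 j) != 0.
    by rewrite -det_mulmx mul_adj_mx det_scalar expf_neq0.
  by rewrite mulf_eq0 negb_or => /andP[].
have r0 : row i0 g = cfg0 c i b *m \adj (c.1 j) by rewrite !row_mul ruling_mx0.
have r1 : row i1 g = cfg1 kind c i b *m \adj (c.1 j) by rewrite !row_mul ruling_mx1.
apply: (restrict_vanish2 K_char0 (g := g)) => //.
  (* Since g contains the adjugate, applying [c.1 j] brings a point back to the i-th line up to the
     factor [\det (c.1 j)]. *)
  move=> P w [x [y ->]] l ltl; rewrite fline_lsub; apply: (V i b lb) => //.
  exists (\det (c.1 j) * x), (\det (c.1 j) * y).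
  rewrite r0 r1 mulmxDl -!scalemxAl -!mulmxA mul_adj_mx !mul_mx_scalar.
  by rewrite -!scalemxAr !scalerA ![x * _]mulrC ![y * _]mulrC.
have pton : qform (kind j) (\row_l pt l) = 0 by apply: meet_pt_on.
have ptE : surf_pt (kind j) (pt i1 / pt i0) (pt i2 / pt i0) =
    (pt i0)^-1 *: (\row_l pt l).
  apply/rowP; apply: I4P; rewrite !mxE /= ?mulVf // 1?mulrC //.
  move: pton; rewrite /qform !mxE; case: (kind j) => /eqP; rewrite subr_eq0 => /eqP E.
    by rewrite -[pt i3](mulKf p0) E; field.
  by move/eqP: E; rewrite mulf_eq0 (negPf p0) => /eqP ->; rewrite mulr0.
have ptl : \row_l pt l = (z - qpolar (kind j) w1 w2) *: w1 +
    (2%:R * qform (kind j) w1) *: w2.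
  have linE (x y : K) (u u' : 'rV[K]_4) l : (x *: u + y *: u') 0 l = x * u 0 l + y * u' 0 l.
    by rewrite !mxE.
  by apply/rowP => l; rewrite linE mxE /pt /meet_pt !hornerE.
rewrite ptE ptl r0 r1; move: (z - _) (2%:R * _) (pt i0)^-1 => A B d.
rewrite /w1 mulmxDl /w2; move: (cfg0 c i b *m _) (cfg1 kind c i b *m _) => l0 l1.
by exists (d * A), (d * (A + B)); apply/rowP => l; rewrite !mxE; ring.
Qed.

(** The third clause keeps a point of each line off the other surfaces. It serves twice: the
    equations of other surfaces can be cancelled on the j-th one, and dividing by all equations
    costs a line only one order. The last clause ranges over all smaller orders because the
    reduction passes through them. *)
Definition cfg_ok c m : Prop :=
  [/\ forall j, \det (c.1 j) != 0,
      forall j b b', b != b' -> c.2 j b != c.2 j b',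
      forall i j b, i != j ->
        (surf_form K (kind j)).@[(cfg0 c i b *m \adj (c.1 j)) 0] != 0 &
      forall j m', (0 < m' <= m)%N -> cfg_forced kind k m' j c].

Definition cfg_form c j : {mpoly K[4]} := lsub (invmx (c.1 j)) (surf_form K (kind j)).

Lemma meval_homog_scale n (f : {mpoly K[n]}) t (x : K) (v : 'I_n -> K) :
  f \is t.-homog -> f.@[fun l => x * v l] = x ^+ t * f.@[v].
Proof.
move=> fh; rewrite !mevalE mulr_sumr big_seq [RHS]big_seq; apply: eq_bigr => a af.
have da : mdeg a = t := dhomog_mf fh af.
rewrite mulrCA; congr (_ * _); rewrite -da mdegE -prodrXr -big_split /=.
by apply: eq_bigr => l _; rewrite exprMn.
Qed.

Lemma cfg_form_neq0 c m i j b : cfg_ok c m -> i != j -> (cfg_form c j).@[cfg0 c i b 0] != 0.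
Proof.
move=> [dets _ nz _] ne; rewrite meval_lsub.
have := nz i j b ne; apply: contraNneq => E.
have -> : cfg0 c i b *m \adj (c.1 j) = \det (c.1 j) *: (cfg0 c i b *m invmx (c.1 j)).
  by rewrite /invmx unitmxE unitfE dets -scalemxAr scalerA mulfV ?scale1r.
rewrite (@meval_eq _ _ _ (fun l => \det (c.1 j) * (cfg0 c i b *m invmx (c.1 j)) 0 l)).
  by rewrite (meval_homog_scale _ _ (surf_form_homog K (kind j))) E mulr0.
by move=> l; rewrite mxE.
Qed.

Lemma surf_form_ruling0 (e : bool) (y : K) : (surf_form K e).@[ruling0 y 0] = 0.
Proof.
by case: e; rewrite /surf_form ?rmorphB ?rmorphM /= !mevalXU !mxE /= ?mulr0 ?mul0r ?subr0.
Qed.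

(** The point has x0 = 1, so the direction of x3 is transversal to the surface. *)
Lemma surf_form_deriv (e : bool) (y : K) : (fline (surf_form K e) (ruling0 y) (delta_mx 0 i3))`_1 != 0.
Proof.
have flX (P w : 'rV[K]_4) l : fline 'X_l P w = (P 0 l)%:P + w 0 l *: 'X.
  by rewrite /fline mmapX mmap1U.
case: e; rewrite /surf_form; last first.
  by rewrite flX !mxE /= scale1r add0r coefX oner_neq0.
rewrite [fline _ _ _]raddfB /= -![mmap _ _ _]/(fline _ _ _) !flineM !flX !mxE /=.
by rewrite !(scale0r, scale1r, addr0, add0r, mul0r, subr0) mul1r coefX oner_neq0.
Qed.

Lemma cfg_horace c m f t : (\sum_j (kind j).+1 = q)%N -> cfg_ok c m ->
  f \is t.-homog -> (t < q * m)%N -> cfg_vanish c f m -> f = 0.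
Proof.
move=> sumq; elim: m f t => [|m IH] f t ok fh lt V; first by rewrite muln0 in lt.
have okm : cfg_ok c m.
  by case: ok => h1 h2 h3 h4; split=> // j m' /andP[p le]; apply: h4; rewrite p leqW.
have [dets dist nz forced] := ok.
have q0 : (0 < q)%N by case: (q) lt.
have rst j : restrict (kind j) (lsub (c.1 j) f) = 0.
  by apply: (cfg_forced_restrict dets (dist j) _ fh lt V); apply: forced; rewrite ltn0Sn leqnn.
have cu j : c.1 j \in unitmx by rewrite unitmxE unitfE.
(* The equations are divided out one by one: those already removed do not restrict to 0 on the j-th
   surface, so the current quotient does. *)
have [h [hh fE]] : exists h, h \is (t - q).-homog /\ f = h * \prod_j cfg_form c j.
  rewrite -sumq; elim: (index_enum _) (index_enum_uniq 'I_N) => [_|j js IHj /=/andP[nj ujs]].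
    by exists f; rewrite !big_nil subn0 mulr1.
  have [h [hh fE]] := IHj ujs.
  have : restrict (kind j) (lsub (c.1 j) h) = 0.
    have := rst j; rewrite fE lsub_rM restrictM => /eqP; rewrite mulf_eq0 => /orP[/eqP//|].
    rewrite /lsub rmorph_prod /restrict rmorph_prod /= => /eqP E; exfalso.
    have b0 : 'I_q := Ordinal q0.
    have := congr1 (fun p : {poly {poly K}} => p.[(c.2 j b0)%:P].[0]) E.
    rewrite !horner0 !horner_prod => /eqP; rewrite prodf_seq_eq0 => /hasP[i ijs /=].
    have ne : j != i by apply: contraNneq nj => ->.
    rewrite restrict_eval meval_lsub.
    suff -> : surf_pt (kind j) 0 (c.2 j b0) *m c.1 j = cfg0 c j b0.
      by apply/negP; apply: (cfg_form_neq0 b0 ok ne).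
    congr (_ *m _); apply/rowP; apply: I4P; rewrite !mxE //=.
    by case: (kind j); rewrite ?mul0r.
  move=> /(surf_dvd (lsub_homog _ hh)) [h' hh' hE].
  exists (lsub (invmx (c.1 j)) h'); split.
    by rewrite big_cons addnC subnDA; apply: lsub_homog.
  rewrite fE big_cons mulrA; congr (_ * _).
  rewrite -[h]lsub1 -(mulVmx (cu j)) -lsubM hE lsub_rM mulrC; by [].
(* At the point [cfg0 c i b] in a transversal direction, the i-th equation has valuation 1 and the
   others have valuation 0; the product therefore absorbs only one order. *)
have Vh : cfg_vanish c h m.
  move=> i b lb; apply: (@vanish_cancel _ K_char0 h (\prod_j cfg_form c j) _ m 1
      (cfg0 c i b) (delta_mx 0 i3 *m c.1 i)).
  - by move=> P Q x; apply: plane2_aff.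
  - by rewrite -fE addn1; apply: V.
  - by exists 1, 0; rewrite scale1r scale0r addr0.
  exists 1%N => //.
  rewrite (bigD1 i) //= flineM coefM !big_ord_recl big_ord0 /= addr0 subn0 subnn.
  have -> : (fline (cfg_form c i) (cfg0 c i b) (delta_mx 0 i3 *m c.1 i))`_0 = 0.
    by rewrite fline_coef0 meval_lsub /cfg0 mulmxK // surf_form_ruling0.
  rewrite mul0r add0r mulf_neq0 //.
    by rewrite /cfg_form fline_lsub /cfg0 !mulmxK // surf_form_deriv.
  rewrite fline_coef0 rmorph_prod prodf_seq_neq0; apply/allP => j _ /=.
  by apply/implyP; rewrite eq_sym => ne; apply: (cfg_form_neq0 b ok ne).
apply/eqP/negPn/negP => f0.
have h0 : h != 0 by apply: contraNneq f0 => h0; rewrite fE h0 mul0r.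
have Ph : \prod_j cfg_form c j \is q.-homog.
  rewrite -sumq; elim/big_rec2: _ => [|j d p _ ph]; first exact: dhomog1.
  by apply: dhomogM => //; apply: lsub_homog; apply: surf_form_homog.
(* The subtraction is not truncated: a nonzero f has the degree of the product. *)
have te : t = (t - q + q)%N.
  by apply: (dhomog_uniq f0 fh); rewrite {1}fE; apply: dhomogM.
suff hz : h = 0 by rewrite hz eqxx in h0.
by apply: (IH h (t - q)%N) => //; move: lt; rewrite mulnS; lia.
Qed.

End Horace.

Section GenericConfigurations.
Variable K : closedFieldType.
Hypothesis K_char0 : [pchar K] =i pred0.
Variables (N q : nat) (kind : 'I_N -> bool) (k : 'I_N -> nat).

(** Each condition is generic and may be shown nonempty by a witness of its own; in particular the
    special configurations may vary with the surface and the order. *)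
Lemma cfg_ok_ex m :
  (forall j m', (0 < m' <= m)%N -> exists c : cfg K N q, cfg_forced kind k m' j c) ->
  exists c : cfg K N q, cfg_ok kind k c m.
Proof.
move=> Hf.
have lin1 j a b : linepoly (fun c : cfg K N q => c.1 j a b).
  by move=> c d; exists ((c.1 j a b)%:P + (d.1 j a b) *: 'X) => x;
     rewrite !hornerE !ffunE !mxE mulrC.
have lin2 j b : linepoly (fun c : cfg K N q => c.2 j b).
  by move=> c d; exists ((c.2 j b)%:P + (d.2 j b) *: 'X) => x;
     rewrite !hornerE !mxE mulrC.
have G1 : generic (fun c : cfg K N q => forall j, \det (c.1 j) != 0).
  apply: (generic_all K_char0) => j; apply: generic_neq0.
    have := @linepoly_det _ (cfg K N q) 4 (fun a b c => c.1 j a b) (lin1 j).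
    apply: linepoly_ext => c; congr (\det _); apply/matrixP => a b.
    by rewrite mxE.
  by exists ([ffun=> 1%:M], 0); rewrite ffunE det1 oner_neq0.
have G2 : generic (fun c : cfg K N q => forall j b b', b != b' -> c.2 j b != c.2 j b').
  apply: (generic_all K_char0) => j; apply: (generic_all K_char0) => b.
  apply: (generic_all K_char0) => b'; apply: generic_impl => ne.
  apply: (@generic_sub _ _ (fun c : cfg K N q => c.2 j b - c.2 j b' != 0)) => [c|].
    by rewrite subr_eq0.
  apply: generic_neq0; first by apply: linepolyD => //; apply: linepolyN.
  exists (0, \matrix_(j, b1) (b1 == b)%:R); rewrite /= !mxE eqxx [b' == b]eq_sym (negPf ne).
  by rewrite subr0 oner_neq0.
have G3 : generic (fun c : cfg K N q => forall i j b, i != j ->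
    (surf_form K (kind j)).@[(cfg0 c i b *m \adj (c.1 j)) 0] != 0).
  apply: (generic_all K_char0) => i; apply: (generic_all K_char0) => j.
  apply: (generic_all K_char0) => b; apply: generic_impl => ne.
  apply: generic_neq0.
    apply: linepoly_meval => l a c.
    pose g j : 'M[{poly K}]_4 := map_mx polyC (a.1 j) + 'X *: map_mx polyC (c.1 j).
    pose y : {poly K} := (a.2 i b)%:P + 'X * (c.2 i b)%:P.
    exists ((ruling0 y *m g i *m \adj (g j)) 0 l) => x.
    have gE j' : map_mx (horner_eval x) (g j') = (a + x *: c).1 j'.
      rewrite /g map_mxD map_mxZ -!map_mx_comp /= /horner_eval hornerX !ffunE.
      by congr (_ + _ *: _); rewrite map_mx_id // => z /=; rewrite hornerC.
    have yE : horner_eval x y = (a + x *: c).2 i b.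
      by rewrite /y /horner_eval !hornerE !mxE.
    rewrite -/(horner_eval x _) /cfg0 -!gE -yE -map_ruling0 -map_mx_adj -!map_mxM.
    by rewrite [LHS]mxE.
  (* Here the point of the i-th line becomes (1, 0, 0, 1), which lies on neither standard
     surface. *)
  exists ([ffun l => if l == j then 1%:M else
    \matrix_(a, d) ((d == i0) || (d == i3))%:R], 0).
  rewrite /cfg0 /= !ffunE eqxx (negPf ne) mxE.
  have -> : \adj (1%:M : 'M[K]_4) = 1%:M by rewrite -[LHS]mul1mx mul_mx_adj det1.
  rewrite mulmx1.
  have -> : ruling0 0 *m (\matrix_(a < 4, d < 4) ((d == i0) || (d == i3))%:R) =
      \row_d ((d == i0) || (d == i3))%:R :> 'rV[K]_4.
    apply/rowP => d; rewrite !mxE big_I4 /= !mxE /=.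
    by rewrite !mul0r mul1r !addr0.
  by case: (kind j); rewrite /surf_form ?rmorphB ?rmorphM /= !mevalXU !mxE /=
     ?mulr1 ?mulr0 ?subr0 oner_neq0.
have G4 : generic (fun c : cfg K N q => forall (m' : 'I_m.+1) j,
    (0 < m')%N -> cfg_forced kind k m' j c).
  apply: (generic_all K_char0) => m'; apply: (generic_all K_char0) => j.
  apply: generic_impl => m'0; apply: generic_forced; apply: Hf.
  by rewrite m'0 -ltnS ltn_ord.
have [c [[[h1 h2] h3] h4]] := generic_ex
  (generic_and K_char0 (generic_and K_char0 (generic_and K_char0 G1 G2) G3) G4).
exists c; split=> // j m' /andP[m'0 le].
have lt : (m' < m.+1)%N by [].
exact: (h4 (Ordinal lt) j m'0).
Qed.

End GenericConfigurations.

(** * Special configurations *)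

Section SpecialConfigurations.
Variable K : closedFieldType.
Hypothesis K_char0 : [pchar K] =i pred0.
Variables (N q : nat) (kind : 'I_N -> bool) (k : 'I_N -> nat).
Implicit Types (i j : 'I_N) (b : 'I_q) (m : nat).

Let natr_inj := natr_inj_char0 K_char0.

Lemma natr_neq0 n : (0 < n)%N -> n%:R != 0 :> K.
Proof. by move=> n0; rewrite -[0](mulr0n 1) (inj_eq natr_inj) -lt0n. Qed.

Lemma natr_neqN n p : (0 < p)%N -> n%:R != - p%:R :> K.
Proof. by move=> p0; rewrite -addr_eq0 -natrD natr_neq0 // addn_gt0 p0 orbT. Qed.

Definition rows4 (r0 r1 r2 r3 : 'rV[K]_4) : 'M[K]_4 :=
  \matrix_(i, j) (if i == i0 then r0 else if i == i1 then r1 else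
                  if i == i2 then r2 else r3) 0 j.

Definition vec4 (x0 x1 x2 x3 : K) : 'rV[K]_4 :=
  \row_j (if j == i0 then x0 else if j == i1 then x1 else if j == i2 then x2 else x3).

Lemma ruling0_rows4 y r0 r1 r2 r3 : ruling0 y *m rows4 r0 r1 r2 r3 = r0 + y *: r2.
Proof.
apply/rowP => l; rewrite !mxE big_I4 /= !mxE /=.
by rewrite !mul0r mul1r !addr0 add0r.
Qed.

Lemma ruling1_rows4 e y r0 r1 r2 r3 :
  ruling1 e y *m rows4 r0 r1 r2 r3 = r1 + (if e then y else 0) *: r3.
Proof.
apply/rowP => l; rewrite !mxE big_I4 /= !mxE /=.
by rewrite !mul0r mul1r !add0r; case: e.
Qed.

Lemma adj1 : \adj (1%:M : 'M[K]_4) = 1%:M.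
Proof. by rewrite -[LHS]mul1mx mul_mx_adj det1. Qed.

Section ForcedPoints.
Variables (c : cfg K N q) (j : 'I_N) (m : nat) (G : {poly {poly K}}).
Hypothesis cj1 : c.1 j = 1%:M.
Hypothesis cj2 : forall b, c.2 j b = - b.+1%:R.
Hypothesis box : forall u v, excluded q kind k j m u v -> G`_v`_u = 0.
Hypothesis rows0 : forall par i b r s, i != j -> (b < k i)%N -> (r + s < m)%N ->
  \sum_(v < q * m) \sum_(u < q * m) G`_v`_u * cfg_entry kind k c par j i b m r s u v = 0.

(** The own lines sit at negative integers y, and the prescribed points at natural numbers y, so
    none of the points lies on an own line. *)
Lemma forced_point i b x (y : nat) : i != j -> (b < k i)%N ->
  qform (kind j) (cfg0 c i b + cfg1 kind c i b) != 0 ->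
  qdisc (kind j) (cfg0 c i b + cfg1 kind c i b) (cfg1 kind c i b) != 0 ->
  (exists s t, surf_pt (kind j) x y%:R =
     s *: (cfg0 c i b + cfg1 kind c i b) + t *: cfg1 kind c i b) ->
  vanish2 G x y%:R m.
Proof.
move=> ne lb q0 d0 st.
have box' u v : (q * m <= u)%N || (q * m <= v)%N -> G`_v`_u = 0.
  by move=> h; apply: box; apply: excluded_box.
apply: (@taylor_entry_vanish K K_char0 (kind j) _ _ (own_params k c j) _ _
  (q * m + q * m).+1 G box' _ m x y%:R q0 d0 st) => //.
  by move=> y' /mapP[b' _ ->]; rewrite cj2 natr_neqN.
move=> par r s rs; rewrite -[RHS](rows0 par ne lb rs).
by rewrite /cfg_entry cj1 adj1 !mulmx1.
Qed.

End ForcedPoints.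

Section OnQuadric.
Variables (j : 'I_N) (beta : 'I_N -> nat) (eta : 'I_N -> 'I_q -> nat).
Hypothesis kj : kind j.
Let a := (q - k j)%N.
Let NN i := (q + N + i)%N.

(* S_j is the standard quadric. The line with index b on the i-th quadric joins
   (x, y) = (eta i b, a + i) and (eta i b + q (i + 1), beta i) on it; the one on the
   i-th plane joins (b - NN i, b) and (q - 1 - b, q - 1 - b + NN i). The first
   points of the former and the second ones of the latter are meant for the lines
   x = h with h < q, the other points for the lines y = d with d < a. *)
Definition quadric_cfg : cfg K N q :=
  ([ffun i => if i == j then 1%:M else if kind i then
      rows4 (vec4 1 0 (a + i)%:R 0) (vec4 1 (q * i.+1)%:R (beta i)%:R ((q * i.+1)%:R * (beta i)%:R))
            (vec4 0 1 0 (a + i)%:R) (vec4 0 1 0 (beta i)%:R)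
    else rows4 (vec4 1 0 (NN i)%:R 0) (q%:R *: vec4 0 1 1 q.-1%:R) (vec4 0 0 0 1) 0],
   \matrix_(i, b) (if i == j then - b.+1%:R else if kind i then (eta i b)%:R
     else ((NN i - b) * (q.-1 - b))%:R)).

Hypothesis beta_lt : forall i, (0 < a)%N -> i != j -> kind i -> (beta i < a)%N.
Hypothesis eta_lt : forall i b, i != j -> kind i -> (b < k i)%N -> (eta i b < q)%N.
Hypothesis eta_inj : forall i b b', i != j -> kind i -> (b < k i)%N -> (b' < k i)%N ->
  eta i b = eta i b' -> b = b'.
Hypothesis short_ge : forall h, (h < q)%N ->
  (a <= #|[pred i | (i != j) && (if kind i then [exists b : 'I_q, (b < k i)%N && (eta i b == h)]
                               else (q.-1 - h < k i)%N)]|)%N.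
Hypothesis long_ge : forall d, (d < a)%N ->
  (q <= #|[pred p : 'I_N * 'I_q | [&& p.1 != j, (p.2 < k p.1)%N &
           (if kind p.1 then beta p.1 == d else p.2 == d :> nat)]]|)%N.

Let c := quadric_cfg.

Lemma quadric_cfg0_q i b : i != j -> kind i ->
  cfg0 c i b = surf_pt true (eta i b)%:R (a + i)%:R.
Proof.
move=> ne ki; rewrite /cfg0 /c /quadric_cfg /= ffunE (negPf ne) ki ruling0_rows4 !mxE (negPf ne) ki.
by apply/rowP; apply: I4P; rewrite !mxE /= ?mulr0 ?mulr1 ?addr0 ?add0r.
Qed.

Lemma quadric_cfg1_q i b : i != j -> kind i ->
  cfg1 kind c i b = surf_pt true (eta i b + q * i.+1)%:R (beta i)%:R.
Proof.
move=> ne ki; rewrite /cfg1 /c /quadric_cfg /= ffunE (negPf ne) ki ruling1_rows4 !mxE (negPf ne) ki.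
apply/rowP; apply: I4P; rewrite !mxE /= ?mulr0 ?mulr1 ?addr0 ?add0r // natrD; first by rewrite addrC.
by rewrite mulrDl addrC.
Qed.

Lemma quadric_forced m : cfg_forced kind k m j c.
Proof.
move=> G box rows0.
have cj1 : c.1 j = 1%:M by rewrite ffunE eqxx.
have cj2 b : c.2 j b = - b.+1%:R by rewrite mxE eqxx.
have fp := forced_point cj1 cj2 box rows0; rewrite kj in fp.
have [a0|a0] := posnP a.
  by apply: poly2_eq0 => u v; apply: box; rewrite /excluded kj -/a a0 orbT.
have Qpts i b : i != j -> (b < k i)%N -> kind i ->
    vanish2 G (eta i b)%:R (a + i)%:R m /\
    vanish2 G (eta i b + q * i.+1)%:R (beta i)%:R m.
  move=> ne lb ki; have bne : (beta i != a + i)%N by have := beta_lt a0 ne ki; lia.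
  have q0 : (0 < q)%N by case: (q) b {lb} => // -[].
  have pz : (q * i.+1)%:R * ((a + i)%:R - (beta i)%:R) != 0 :> K.
    rewrite mulf_neq0 ?natr_neq0 ?muln_gt0 ?q0 //.
    by rewrite subr_eq0 (inj_eq natr_inj) eq_sym.
  have E1 : qform true (cfg0 c i b + cfg1 kind c i b) =
     - ((q * i.+1)%:R * ((a + i)%:R - (beta i)%:R)).
    rewrite quadric_cfg0_q // quadric_cfg1_q // /qform !mxE /= !natrD; ring.
  have E2 : qdisc true (cfg0 c i b + cfg1 kind c i b) (cfg1 kind c i b) =
     ((q * i.+1)%:R * ((a + i)%:R - (beta i)%:R)) ^+ 2.
    rewrite quadric_cfg0_q // quadric_cfg1_q // /qdisc /qpolar /qform !mxE /= !natrD; ring.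
  have n1 : qform true (cfg0 c i b + cfg1 kind c i b) != 0 by rewrite E1 oppr_eq0.
  have n2 : qdisc true (cfg0 c i b + cfg1 kind c i b) (cfg1 kind c i b) != 0.
    by rewrite E2 expf_neq0.
  split; apply: (fp i b _ _ ne lb n1 n2).
    by exists 1, (-1); rewrite -quadric_cfg0_q // scale1r scaleN1r addrK.
  by exists 0, 1; rewrite -quadric_cfg1_q // scale1r scale0r add0r.
(* Both points lie on the plane x2 - x1 = [NN i] x0. Because b and q - 1 - b have a sum independent
   of b, their joining line has direction (0, 1, 1, q - 1) for every b; the lines are thus
   concurrent, as lines of a plane have to be. *)
have Ppts i b : i != j -> (b < k i)%N -> ~~ kind i ->
    vanish2 G (- (NN i - b)%:R) b%:R m /\
    vanish2 G (q.-1 - b)%:R (q.-1 - b + NN i)%:R m.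
  move=> ne lb ki; have lbq := ltn_ord b.
  have q0 : (0 < q)%N by apply: leq_ltn_trans lbq.
  pose n : K := (NN i)%:R; pose B : K := b%:R; pose Q : K := q%:R.
  have Qm : q.-1%:R = Q - 1 :> K by rewrite -subn1 natrB.
  have nB : (NN i - b)%:R = n - B :> K by rewrite natrB // /NN; lia.
  have QB : (q.-1 - b)%:R = Q - 1 - B :> K by rewrite natrB ?Qm //; lia.
  have e0 : cfg0 c i b = vec4 1 0 n ((n - B) * (Q - 1 - B)).
    rewrite /cfg0 /c /quadric_cfg /= ffunE (negPf ne) (negPf ki) ruling0_rows4 !mxE (negPf ne) (negPf ki).
    rewrite natrM nB QB.
    by apply/rowP; apply: I4P; rewrite !mxE /= ?mulr0 ?mulr1 ?addr0 ?add0r.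
  have e1 : cfg1 kind c i b = vec4 0 Q Q (Q * (Q - 1)).
    rewrite /cfg1 /c /quadric_cfg /= ffunE (negPf ne) (negPf ki) ruling1_rows4 Qm.
    by apply/rowP; apply: I4P; rewrite !mxE /= ?mulr0 ?mulr1 ?addr0 ?add0r.
  have Q0 : Q != 0 by rewrite natr_neq0.
  (* On the line of direction (0, 1, 1, q - 1) through [cfg0 c i b] the quadric is met at the
     parameters b - [NN i] and q - 1 - b. The factor q in the second row of the matrix picks a
     parameter different from both. *)
  have n1 : qform true (cfg0 c i b + cfg1 kind c i b) != 0.
    have -> : qform true (cfg0 c i b + cfg1 kind c i b) = - (b.+1%:R * (NN i + q - b)%:R).
      rewrite e0 e1 /qform !mxE /= natrB; last by rewrite /NN; lia.
      by rewrite natrD -/n -/B -/Q -addn1 natrD -/B; ring.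
    by rewrite oppr_eq0 mulf_neq0 ?natr_neq0 // /NN; lia.
  have n2 : qdisc true (cfg0 c i b + cfg1 kind c i b) (cfg1 kind c i b) != 0.
    have -> : qdisc true (cfg0 c i b + cfg1 kind c i b) (cfg1 kind c i b) =
        (Q * (NN i + q - (b + b + 1))%:R) ^+ 2.
      rewrite e0 e1 /qdisc /qpolar /qform !mxE /= natrB; last by rewrite /NN; lia.
      by rewrite (natrD _ (NN i)) (natrD _ (b + b)%N) (natrD _ b) -/n -/B -/Q; ring.
    by rewrite expf_neq0 // mulf_neq0 // natr_neq0 // /NN; lia.
  split; apply: (fp i b _ _ ne lb n1 n2).
    exists 1, (- (n - B) / Q - 1); rewrite nB e0 e1.
    by apply/rowP; apply: I4P; rewrite !mxE /=; field.
  exists 1, ((Q - 1 - B) / Q - 1); rewrite natrD QB -/n e0 e1.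
  by apply/rowP; apply: I4P; rewrite !mxE /=; field.
pose cs : seq K := [seq h%:R | h <- iota 0 q].
pose ds : seq K := [seq d%:R | d <- iota 0 a].
have csP n : (n%:R \in cs) = (n < q)%N by rewrite mem_map // mem_iota.
have dsP n : (n%:R \in ds) = (n < a)%N by rewrite mem_map // mem_iota.
apply: (@quadric_grid_eq0 K cs ds m G).
- by rewrite map_inj_uniq // iota_uniq.
- by rewrite map_inj_uniq // iota_uniq.
- by move=> u v; rewrite !size_map !size_iota => h; apply: box; rewrite /excluded kj.
- move=> x /mapP[h]; rewrite mem_iota add0n => /andP[_ hq] ->{x}.
  pose A := [pred i | (i != j) && (if kind i then [exists b : 'I_q, (b < k i)%N && (eta i b == h)]
                               else (q.-1 - h < k i)%N)].
  (* Heights on x = h: quadrics occupy a, ..., a + N - 1 and planes start at h + q + N, so all are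
     distinct and none is below a. *)
  pose yv (i : 'I_N) : nat := if kind i then (a + i)%N else (h + NN i)%N.
  have yv_inj : injective yv.
    move=> i i'; rewrite /yv /NN => E; apply: val_inj; move: E => /=.
    by have := ltn_ord i; have := ltn_ord i'; case: (kind i); case: (kind i') => /=; rewrite /a; lia.
  exists [seq (yv i)%:R | i <- enum A]; split.
  + by rewrite map_inj_uniq ?enum_uniq // => i i' /natr_inj /yv_inj.
  + by rewrite !size_map size_iota -cardE short_ge.
  + move=> y /mapP[i]; rewrite mem_enum inE => /andP[ne hit] ->{y}.
    rewrite dsP; split; first by rewrite /yv /NN; case: (kind i); rewrite /a; lia.
    rewrite /yv; case: ifP hit => ki.
      by move=> /existsP[b /andP[lb /eqP eb]]; rewrite -eb; apply: (Qpts i b ne lb ki).1.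
    move=> lk; have lb : (q.-1 - h < q)%N by lia.
    have [_] := Ppts i (Ordinal lb) ne lk (negbT ki).
    by rewrite /= subKn //; lia.
- move=> y /mapP[d]; rewrite mem_iota add0n => /andP[_ da] ->{y}.
  pose A := [pred p : 'I_N * 'I_q | [&& p.1 != j, (p.2 < k p.1)%N &
           (if kind p.1 then beta p.1 == d else p.2 == d :> nat)]].
  (* Abscissae on y = d: each quadric has its own block of length q starting at q or later, and
     planes give negative values, so the points avoid the lines x = h with h < q. *)
  pose xv (p : 'I_N * 'I_q) : K := if kind p.1 then (eta p.1 p.2 + q * p.1.+1)%:R
     else - (NN p.1 - p.2)%:R.
  have NNp i b : (0 < NN i - b)%N by have := ltn_ord b; rewrite /NN; lia.
  have xv_inj : {in A &, injective xv}.
    move=> [i b] [i' b']; rewrite !inE /= => /and3P[ne lb h] /and3P[ne' lb' h'].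
    rewrite /xv /=; case: ifP h => ki h; case: ifP h' => ki' h'.
    + move/natr_inj => E.
      have l1 := eta_lt ne ki lb; have l2 := eta_lt ne' ki' lb'.
      have q0 : (0 < q)%N by apply: leq_ltn_trans l1.
      have := congr1 (fun n => n %/ q)%N E; rewrite ![(_ + q * _)%N]addnC ![(q * _)%N]mulnC.
      rewrite !divnMDl // !divn_small // !addn0 => -[ii].
      have {ii}ii : i = i' by apply: val_inj.
      by subst i'; move: E => /addIn E; rewrite (eta_inj ne ki lb lb' E).
    + by move/eqP; rewrite (negPf (natr_neqN _ (NNp i' b'))).
    + by move/esym/eqP; rewrite (negPf (natr_neqN _ (NNp i b))).
    + move/oppr_inj/natr_inj; move: h h' => /eqP h /eqP h'; rewrite /NN h h' => E.
      by congr (_, _); apply: val_inj => /=; move: (ltn_ord b) (ltn_ord b'); lia.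
  exists [seq xv p | p <- enum A]; split.
  + by rewrite map_inj_in_uniq ?enum_uniq // => p p'; rewrite !mem_enum; apply: xv_inj.
  + by rewrite !size_map size_iota -cardE long_ge.
  + move=> x /mapP[[i b]]; rewrite mem_enum inE /= => /and3P[ne lb h] ->{x}.
    rewrite /xv /=; case: ifP h => ki /eqP <-.
      split; last exact: (Qpts i b ne lb ki).2.
      rewrite csP; have := ltn_ord b; have : (q <= q * i.+1)%N by rewrite leq_pmulr.
      lia.
    split; last by apply: (Ppts i b ne lb _).1; rewrite ki.
    by apply/mapP => -[n _ /esym/eqP]; rewrite (negPf (natr_neqN _ (NNp i b))).
Qed.

End OnQuadric.
End SpecialConfigurations.

Section OnPlane.
Variable K : closedFieldType.
Hypothesis K_char0 : [pchar K] =i pred0.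
Variables (N q : nat) (kind : 'I_N -> bool) (k : 'I_N -> nat).
Implicit Types (i j : 'I_N) (b : 'I_q) (m : nat).
Variables (j : 'I_N) (mu : 'I_N -> 'I_q -> nat) (sg : 'I_N -> 'I_q -> bool).
Hypothesis kj : ~~ kind j.
Let p := (q - k j)%N.
Let natr_inj := natr_inj_char0 K_char0.
(** The heights used by the i-th surface are within p + 1 of this multiple of 2p + 4, so different
    surfaces have disjoint ranges. *)
Let ga i := ((2 * p + 4) * i.+1)%N.

(* The lines of the other surfaces meet the plane in points on the lines
   x = (mu + 2)^2; the traces of the quadrics are parabolas, which meet each of
   these lines twice, for the parameters +(mu + 2) and -(mu + 2). *)
Definition plane_cfg : cfg K N q :=
  ([ffun i => if i == j then 1%:M else if kind i then
      rows4 (vec4 1 0 (ga i)%:R 0) (vec4 0 0 1 1) (vec4 0 0 0 (-1)) (vec4 0 1 0 0)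
    else rows4 (vec4 1 0 (ga i)%:R 0) (vec4 0 0 0 1) (vec4 0 1 0 0) 0],
   \matrix_(i, b) (if i == j then - b.+1%:R else if kind i then
      (if sg i b then (mu i b).+2%:R else - (mu i b).+2%:R)
     else (mu i b).+2%:R ^+ 2)).

Hypothesis sg_inj : forall i b b', i != j -> kind i -> (b < k i)%N -> (b' < k i)%N ->
  mu i b = mu i b' -> sg i b = sg i b' -> b = b'.
Hypothesis mu_inj : forall i b b', i != j -> ~~ kind i -> (b < k i)%N -> (b' < k i)%N ->
  mu i b = mu i b' -> b = b'.
Hypothesis mu_ge : forall d, (d < p)%N ->
  (p <= #|[pred t : 'I_N * 'I_q | [&& t.1 != j, (t.2 < k t.1)%N & mu t.1 t.2 == d]]|)%N.

Let c := plane_cfg.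

Let ht i b : nat := if kind i then
  (if sg i b then ga i + (mu i b).+2 else ga i - (mu i b).+2)%N else ga i.

Lemma plane_forced m : cfg_forced kind k m j c.
Proof.
move=> G box rows0.
have cj1 : c.1 j = 1%:M by rewrite ffunE eqxx.
have cj2 b : c.2 j b = - b.+1%:R by rewrite mxE eqxx.
have fp := forced_point K_char0 cj1 cj2 box rows0; rewrite (negPf kj) in fp.
have pts i b : i != j -> (b < k i)%N -> (mu i b < p)%N ->
    vanish2 G ((mu i b).+2%:R ^+ 2) (ht i b)%:R m.
  move=> ne lb mup.
  have gal : ((mu i b).+2 <= ga i)%N by rewrite /ga mulnS; lia.
  case ki : (kind i); last first.
    have e0 : cfg0 c i b = vec4 1 ((mu i b).+2%:R ^+ 2) (ga i)%:R 0.
      rewrite /cfg0 /c /plane_cfg /= ffunE (negPf ne) ki ruling0_rows4 !mxE (negPf ne) ki.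
      by apply/rowP; apply: I4P; rewrite !mxE /= ?mulr0 ?mulr1 ?addr0 ?add0r.
    have e1 : cfg1 kind c i b = vec4 0 0 0 1.
      rewrite /cfg1 /c /plane_cfg /= ffunE (negPf ne) ki ruling1_rows4.
      by rewrite scale0r addr0.
    apply: (fp i b _ _ ne lb).
    - by rewrite e0 e1 /qform !mxE /= !(mul1r, add0r, addr0, subr0) oner_neq0.
    - rewrite e0 e1 /qdisc /qpolar /qform !mxE /=.
      by rewrite !(mul1r, mul0r, mulr0, add0r, addr0, subr0) expr1n oner_neq0.
    - exists 1, (-1); rewrite /ht ki e0 e1.
      by apply/rowP; apply: I4P; rewrite !mxE /=; ring.
  (* The line meets x3 = 0 in [cfg0] + s [cfg1] = (1, s^2, ga + s, 0), a point of the parabola x =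
     (y - ga)^2. *)
  pose s : K := if sg i b then (mu i b).+2%:R else - (mu i b).+2%:R.
  have e0 : cfg0 c i b = vec4 1 0 (ga i)%:R (- s).
    rewrite /cfg0 /c /plane_cfg /= ffunE (negPf ne) ki ruling0_rows4 !mxE (negPf ne) ki -/s.
    by apply/rowP; apply: I4P; rewrite !mxE /= ?mulr0 ?mulr1 ?addr0 ?add0r // mulrN1.
  have e1 : cfg1 kind c i b = vec4 0 s 1 1.
    rewrite /cfg1 /c /plane_cfg /= ffunE (negPf ne) ki ruling1_rows4 !mxE (negPf ne) ki -/s.
    by apply/rowP; apply: I4P; rewrite !mxE /= ?mulr0 ?mulr1 ?addr0 ?add0r.
  have s2 : (mu i b).+2%:R ^+ 2 = s ^+ 2 by rewrite /s; case: (sg i b); rewrite ?sqrrN.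
  have hE : (ht i b)%:R = (ga i)%:R + s.
    by rewrite /ht ki /s; case: (sg i b); rewrite ?natrD ?natrB.
  (* This is the value of [qform] at the first vector. The shift by 2 in the parameters excludes s =
     1, and also s = 0, where the two signs would coincide. *)
  have s1 : 1 - s != 0.
    rewrite subr_eq0 eq_sym /s; case: (sg i b); first by rewrite -[1]/(1%:R) (inj_eq natr_inj).
    by rewrite eq_sym -[1]/(1%:R) natr_neqN.
  rewrite s2 hE; rewrite -hE.
  apply: (fp i b _ _ ne lb).
  - by rewrite e0 e1 /qform !mxE /= !(addr0, subr0) mul1r addrC.
  - rewrite e0 e1 /qdisc /qpolar /qform !mxE /=.
    by rewrite !(mul1r, mul0r, mulr0, mulr1, add0r, addr0, subr0) expr1n oner_neq0.
  - exists 1, (s - 1); rewrite hE e0 e1.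
    by apply/rowP; apply: I4P; rewrite !mxE /=; ring.
pose cs : seq K := [seq d.+2%:R ^+ 2 | d <- iota 0 p].
apply: (@plane_grid_eq0 K cs m G).
- rewrite map_inj_uniq ?iota_uniq // => d d'; rewrite -!natrX => /natr_inj /eqP.
  by rewrite eqn_exp2r // => /eqP [].
- by move=> u v; rewrite size_map size_iota => h; apply: box; rewrite /excluded (negPf kj).
- move=> x /mapP[d]; rewrite mem_iota add0n => /andP[_ dp] ->{x}.
  pose A := [pred t : 'I_N * 'I_q | [&& t.1 != j, (t.2 < k t.1)%N & mu t.1 t.2 == d]].
  have ht_inj : {in A &, injective (fun t => ht t.1 t.2)}.
    move=> [i b] [i' b']; rewrite !inE /= => /and3P[ne lb /eqP h] /and3P[ne' lb' /eqP h'].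
    move=> E; have ii : i = i'.
      apply: val_inj => /=; apply/eqP; rewrite eqn_leq.
      have far (u v : nat) : (u < v)%N -> ((2 * p + 4) * u.+1 + (2 * p + 4) <= (2 * p + 4) * v.+1)%N.
        by move=> uv; rewrite addnC -mulnS leq_mul2l ltnS uv orbT.
      move: E; rewrite /ht h h' /ga.
      set U := ((2 * p + 4) * i.+1)%N; set V := ((2 * p + 4) * i'.+1)%N.
      have U0 : (2 * p + 4 <= U)%N by rewrite /U leq_pmulr.
      have V0 : (2 * p + 4 <= V)%N by rewrite /V leq_pmulr.
      move=> E; apply/andP; split; rewrite leqNgt; apply/negP => /far; rewrite -/U -/V => lt;
      by move: E; case: (kind i); case: (kind i'); case: (sg i b); case: (sg i' b');
         clearbody U V; clear -lt U0 V0 dp; move: (p) dp lt U0 V0 => P dp lt U0 V0; lia.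
    subst i'; case ki: (kind i); last first.
      by rewrite (@mu_inj i b b') // ?ki // h h'.
    rewrite (@sg_inj i b b') // ?ki ?h ?h' //.
    move: E; rewrite /ht ki h h' /ga mulnS; case: (sg i b); case: (sg i b') => //; lia.
  exists [seq (ht t.1 t.2)%:R | t <- enum A]; split.
  + rewrite map_inj_in_uniq ?enum_uniq // => t t'; rewrite !mem_enum => tA t'A.
    by move/natr_inj; apply: ht_inj.
  + by rewrite !size_map size_iota -cardE mu_ge.
  + move=> y /mapP[[i b]]; rewrite mem_enum inE /= => /and3P[ne lb /eqP h] ->{y}.
    by rewrite -h; apply: pts => //; rewrite h.
Qed.

End OnPlane.

(** * Numbers of lines *)

Section Realization.
Variable K : closedFieldType.
Hypothesis K_char0 : [pchar K] =i pred0.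

Definition realizable (q s : nat) : Prop :=
  exists (N : nat) (kind : 'I_N -> bool) (k : 'I_N -> nat),
  [/\ forall j, (k j <= q)%N, (\sum_j (kind j).+1 = q)%N, (\sum_j k j <= s)%N &
      forall j m, exists c : cfg K N q, cfg_forced kind k m j c].

Lemma card_geI (T : finType) (A : pred T) a (f : 'I_a -> T) :
  injective f -> (forall i, A (f i)) -> (a <= #|A|)%N.
Proof.
move=> fI fA; rewrite -[X in (X <= _)%N]card_ord -(card_codom fI).
by apply/subset_leq_card/fintype.subsetP => x /codomP[i ->]; apply: fA.
Qed.

(* The condition on the quadrics places the points on S_j as in [quadric_cfg]
   with eta i b = b and beta i running through all values < q - k; the one on the
   planes uses the first q - r lines of each quadric at mu = b, and, if r < q - r,
   the next ones to reach the remaining values of mu. *)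
Definition uniform_ok (n k e r q : nat) : bool :=
  [&& (n * 2 + e == q)%N, (k <= q)%N, (r <= q)%N,
      [|| (n == 0)%N, (q - k == 0)%N | [&& (q - k < n)%N, (q - k <= e)%N & (q - k <= r)%N]] &
      [|| (e == 0)%N, (q - r == 0)%N | [&& (q - r < n + e)%N, (n == 0)%N || (q - r <= k)%N &
         (q - r <= r)%N || ((q - r <= n * 2)%N && ((q - r) * 2 <= k + r)%N)]]].

Lemma uniform_realizable n k e r q s :
  uniform_ok n k e r q -> (n * k + e * r <= s)%N -> realizable q s.
Proof.
move=> /and5P[/eqP nq kq rq Hq Hp] tot.
pose kind (i : 'I_(n + e)) := (i < n)%N.
pose kk (i : 'I_(n + e)) := if (i < n)%N then k else r.
exists (n + e)%N, kind, kk; split.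
- by move=> j; rewrite /kk; case: ifP.
- rewrite big_split_ord /= -nq.
  rewrite (eq_bigr (fun=> 2%N)); last by move=> i _; rewrite /kind /= ltn_ord.
  rewrite [X in (_ + X)%N](eq_bigr (fun=> 1%N)); last first.
    by move=> i _; rewrite /kind /= ltnNge leq_addr.
  by rewrite !sum_nat_const !card_ord muln1.
- rewrite big_split_ord /=.
  rewrite (eq_bigr (fun=> k)); last by move=> i _; rewrite /kk /= ltn_ord.
  rewrite [X in (_ + X)%N](eq_bigr (fun=> r)); last first.
    by move=> i _; rewrite /kk /= ltnNge leq_addr.
  by rewrite !sum_nat_const !card_ord.
move=> j m; have jne := ltn_ord j.
have [kj|kj] := boolP (kind j).
  have {Hq}Hq : (q - k = 0)%N \/ [/\ q - k < n, q - k <= e & q - k <= r]%N.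
    move: Hq; case/or3P => [/eqP n0|/eqP|/and3P[]]; [|by left|by right].
    by move: kj; rewrite /kind; lia.
  have kkj : kk j = k by rewrite /kk -/(kind j) kj.
  (* Skipping j, the first q - k quadrics get the values 0, ..., q - k - 1 of beta; [minn] sends the
     surplus ones to the last value. *)
  exists (quadric_cfg K kind kk j (fun i => minn (unbump j i) (q - k).-1) (fun i b => b)).
  apply: quadric_forced => //; rewrite ?kkj.
  + by move=> i a0 _ _; rewrite gtn_min prednK // leqnn orbT.
  + by move=> i b b' _ _ _ _ /val_inj.
  + move=> h hq; case: Hq => [->//|[an ae ar]].
    (* For h < k the points come from q - k other quadrics, for larger h from q - k planes. *)
    have [hk|hk] := ltnP h k.
      have bP (i : 'I_(q - k)) : (bump j i < n + e)%N by rewrite /bump; have := ltn_ord i; lia.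
      have bn (i : 'I_(q - k)) : (bump j i < n)%N by rewrite /bump; have := ltn_ord i; lia.
      apply: (@card_geI _ _ _ (fun i => Ordinal (bP i))).
        by move=> i i' [] /(can_inj (bumpK _)) /val_inj.
      move=> i; rewrite inE -val_eqE /= /kind /kk /= bn eq_sym neq_bump /=.
      by apply/existsP; exists (Ordinal hq); rewrite /= hk eqxx.
    have bP (i : 'I_(q - k)) : (n + i < n + e)%N by have := ltn_ord i; lia.
    apply: (@card_geI _ _ _ (fun i => Ordinal (bP i))).
      by move=> i i' [] /addnI /val_inj.
    move=> i; rewrite inE -val_eqE /= /kind /kk /= (ltnNge (n + i)) leq_addr /=.
    by move: kj; rewrite /kind; lia.
  + move=> d da; case: Hq => [a0|[an ae ar]]; first by rewrite a0 in da.
    (* Of the q points on y = d, the quadric with beta equal to d gives k, and q - k planes give one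
       each. *)
    have bP (t : 'I_q) : ((if t < k then bump j d else n + (t - k)) < n + e)%N.
      by rewrite /bump; have := ltn_ord t; case: ifP; move: kj; rewrite /kind; lia.
    have dq : (d < q)%N by lia.
    apply: (@card_geI _ _ _ (fun t => (Ordinal (bP t), if (t < k)%N then t else Ordinal dq))).
      move=> t t' [] E /(congr1 val); move: E => /=.
      have : (bump j d < n)%N by rewrite /bump; lia.
      by move: (bump j d) => u; case: ifP => h; case: ifP => h' /= *; apply: val_inj => /=; lia.
    move=> t; rewrite inE -!val_eqE /= /kind /kk /=.
    have bn : (bump j d < n)%N by rewrite /bump; lia.
    case: ifP => h; first by rewrite bn eq_sym neq_bump h bumpK; apply/eqP; lia.
    rewrite (ltnNge (n + _)) leq_addr /= eqxx andbT.
    by move: kj; rewrite /kind; lia.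
have {Hp}Hp : (q - r = 0)%N \/ [/\ q - r < n + e, (n == 0)%N || (q - r <= k)%N &
    (q - r <= r)%N || ((q - r <= n * 2)%N && ((q - r) * 2 <= k + r)%N)]%N.
  move: Hp; case/or3P => [/eqP e0|/eqP|/and3P[]]; [|by left|by right].
  by move: kj; rewrite /kind; lia.
have kkj : kk j = r by rewrite /kk -/(kind j) (negPf kj).
pose p := (q - r)%N.
exists (plane_cfg K kind kk j
  (fun i b => if kind i then (if b < p then b : nat else r + (b - p)) else b)%N
  (fun i b => (b < p)%N)).
apply: plane_forced => //; rewrite ?kkj -/p.
- move=> i b b' _ ki _ _; rewrite ki => E E'; apply: val_inj => /=.
  by move: E E'; case: ifP; case: ifP => //; lia.
- by move=> i b b' _ ki _ _; rewrite (negPf ki) => /val_inj.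
- move=> d dp; case: Hp => [p0|[pn pk pr]]; first by rewrite /p p0 in dp.
  rewrite -/p in pn pk pr.
  (* For d < r one line from each of p other surfaces suffices; for d >= r the planes have no line
     left with mu = d. *)
  have [dr|dr] := ltnP d r.
    have bP (t : 'I_p) : (bump j t < n + e)%N by rewrite /bump; have := ltn_ord t; lia.
    have dq : (d < q)%N by rewrite /p in dp; lia.
    apply: (@card_geI _ _ _ (fun t => (Ordinal (bP t), Ordinal dq))).
      by move=> t t' [] /(can_inj (bumpK _)) /val_inj.
    move=> t; rewrite inE -!val_eqE /= eq_sym neq_bump /= /kk /kind /=.
    by case: ifP => h; rewrite ?dp eqxx andbT; lia.
  (* Now only quadrics are available, each with two lines at mu = d: number d with sign plus and
     number p + (d - r) with sign minus. The two inequalities say that there are enough quadrics and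
     that the second number is below k. *)
  have {pr}[pn2 p2] : (p <= n * 2)%N /\ (p * 2 <= k + r)%N by lia.
  have bP (t : 'I_p) : ((if t < n then t : nat else t - n) < n + e)%N.
    by have := ltn_ord t; case: ifP; lia.
  have dq : (d < q)%N by rewrite /p in dp; lia.
  have dq' : (p + (d - r) < q)%N by lia.
  apply: (@card_geI _ _ _ (fun t => (Ordinal (bP t), if (t < n)%N then Ordinal dq else Ordinal dq'))).
    move=> t t' [] E /(congr1 val); move: E => /=.
    by case: ifP => h; case: ifP => h' /= E E'; apply: val_inj => /=; lia.
  move=> t; have tp := ltn_ord t; rewrite inE -!val_eqE /= /kk /kind /=.
  move: kj; rewrite /kind -leqNgt => kj.
  have -> : ((if t < n then t : nat else t - n) < n)%N by case: ifP; lia.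
  by case: ifP => h /=; apply/and3P; split; try (case: ifP => h'); lia.
Qed.


Lemma card_ord_count N (P : nat -> bool) :
  #|[pred i : 'I_N | P i]| = count P (iota 0 N).
Proof. by rewrite cardE size_filter -enumT -val_enum_ord count_map. Qed.

Lemma card_pair_count N q (P : nat -> nat -> bool) :
  #|[pred p : 'I_N * 'I_q | P p.1 p.2]| = sumn [seq count (P i) (iota 0 q) | i <- iota 0 N].
Proof.
rewrite -sum1_card -(pair_big_dep predT (fun (i : 'I_N) (b : 'I_q) => P i b) (fun _ _ => 1%N)) /=.
have -> : iota 0 N = index_iota 0 N by rewrite /index_iota subn0.
rewrite sumnE big_map big_mkord.
by apply: eq_bigr => i _; rewrite sum1_card -card_ord_count.
Qed.

Section Certificates.
Variables (N q : nat) (kind : nat -> bool) (k : nat -> nat) (j : nat).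

(** The hypotheses of [quadric_forced] rewritten over natural number indices, in a form that
    evaluates by computation. *)
Definition quadric_cert (beta : nat -> nat) (eta : nat -> nat -> nat) : bool :=
  [&& all (fun i => (i != j) && kind i ==> [&& (beta i < q - k j)%N,
        all (fun b => (b < k i)%N ==> (eta i b < q)%N) (iota 0 q) &
        all (fun b => all (fun b' => [&& b < k i, b' < k i & eta i b == eta i b']%N ==> (b == b'))
                          (iota 0 q)) (iota 0 q)]) (iota 0 N),
      all (fun h => q - k j <= count (fun i => (i != j) &&
         if kind i then has (fun b => (b < k i)%N && (eta i b == h)) (iota 0 q)
         else (q.-1 - h < k i)%N) (iota 0 N))%N (iota 0 q) &
      all (fun d => q <= sumn [seq count (fun b => [&& i != j, (b < k i)%N &
         if kind i then beta i == d else b == d]) (iota 0 q) | i <- iota 0 N])%N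
        (iota 0 (q - k j))].

Definition plane_cert (mu : nat -> nat -> nat) (sg : nat -> nat -> bool) : bool :=
  all (fun i => all (fun b => all (fun b' => [&& i != j, b < k i, b' < k i, mu i b == mu i b' &
        kind i ==> (sg i b == sg i b')]%N ==> (b == b')) (iota 0 q)) (iota 0 q)) (iota 0 N) &&
  all (fun d => q - k j <= sumn [seq count (fun b => [&& i != j, (b < k i)%N & mu i b == d]) (iota 0 q)
                               | i <- iota 0 N])%N (iota 0 (q - k j)).

Lemma all_iotaP (P : pred nat) n : all P (iota 0 n) -> forall i : 'I_n, P i.
Proof. by move=> /allP h i; apply: h; rewrite mem_iota ltn_ord. Qed.

Lemma all_iota_lt (P : pred nat) n d : all P (iota 0 n) -> (d < n)%N -> P d.
Proof. by move=> /allP h dn; apply: h; rewrite mem_iota. Qed.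

Lemma quadric_cert_forced beta eta (jN : (j < N)%N) m : kind j ->
  quadric_cert beta eta -> exists c : cfg K N q, cfg_forced kind k m (Ordinal jN) c.
Proof.
move=> kj /and3P[/all_iotaP H1 /all_iota_lt H2 /all_iota_lt H3].
exists (quadric_cfg K (fun i : 'I_N => kind i) (fun i : 'I_N => k i) (Ordinal jN) (fun i => beta i)
  (fun i b => eta i b)).
apply: quadric_forced => //=.
- by move=> i _ ne ki; have /implyP := H1 i; rewrite ki -(inj_eq val_inj) in ne *; case/(_ _)/and3P; rewrite ?ne.
- move=> i b ne ki; have /implyP := H1 i; rewrite ki -(inj_eq val_inj) /= in ne *.
  by rewrite ne => /(_ isT)/and3P[_ /all_iotaP/(_ b)/implyP].
- move=> i b b' ne ki lb lb' E; have /implyP := H1 i; rewrite ki -(inj_eq val_inj) /= in ne *.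
  rewrite ne => /(_ isT)/and3P[_ _ /all_iotaP/(_ b)/all_iotaP/(_ b')].
  by rewrite lb lb' E eqxx => /eqP /val_inj.
- move=> h hq; apply: (leq_trans (H2 h hq)); rewrite -card_ord_count; apply: subset_leq_card.
  apply/fintype.subsetP => i; rewrite !inE -val_eqE /= => /andP[-> /=]; case: ifP => // _ /hasP[b].
  by rewrite mem_iota => /= bq hb; apply/existsP; exists (Ordinal bq).
- move=> d da; apply: (leq_trans (H3 d da)); rewrite -card_pair_count; apply: subset_leq_card.
  by apply/fintype.subsetP => -[i b]; rewrite !inE.
Qed.

Lemma plane_cert_forced mu sg (jN : (j < N)%N) m : ~~ kind j ->
  plane_cert mu sg -> exists c : cfg K N q, cfg_forced kind k m (Ordinal jN) c.
Proof.
move=> kj /andP[/all_iotaP H1 /all_iota_lt H3].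
exists (plane_cfg K (fun i : 'I_N => kind i) (fun i : 'I_N => k i) (Ordinal jN) (fun i b => mu i b)
  (fun i b => sg i b)).
have inj (i : 'I_N) (b b' : 'I_q) : i != Ordinal jN -> (b < k i)%N -> (b' < k i)%N -> mu i b = mu i b' ->
   (kind i -> sg i b = sg i b') -> b = b' :> 'I_q.
  move=> ne lb lb' E E'; have /all_iotaP/(_ b)/all_iotaP/(_ b') := H1 i.
  rewrite -(inj_eq val_inj) /= in ne; rewrite ne lb lb' E eqxx /=.
  by case: (kind i) E' => [->//|_]; rewrite ?eqxx => /eqP/val_inj.
apply: plane_forced => //=.
- by move=> i b b' ne ki lb lb' E E'; apply: (inj i b b').
- by move=> i b b' ne ki lb lb' E; apply: (inj i b b') => //; rewrite (negPf ki).
- move=> d da; apply: (leq_trans (H3 d da)); rewrite -card_pair_count; apply: subset_leq_card.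
  by apply/fintype.subsetP => -[i b]; rewrite !inE.
Qed.

End Certificates.

(* For q = 6 and q = 7 no parameters satisfying [uniform_ok] have n k + e r <= 15
   and n k + e r <= 20, respectively. *)
Lemma realizable_6 : realizable 6 15.
Proof.
exists 3%N, (fun=> true), (fun=> 5%N); split=> //; try by rewrite !big_ord_recl big_ord0.
case=> j j3 m.
(* Here q - k = 1, so each of the six lines x = h needs one point: one of the other two quadrics
   uses 0, ..., 4 and the other 1, ..., 5. *)
apply: (@quadric_cert_forced 3 6 (fun=> true) (fun=> 5%N) j (fun=> 0%N)
  (fun i b => if (i == if j == 0 then 1 else 0)%N then b else b.+1)) => //.
by move: j j3; do 3?[case=> [_|]]; vm_compute.
Qed.

Lemma realizable_7 : realizable 7 20.
Proof.
pose kind (i : nat) := (i < 3)%N; pose k i := nth 0%N [:: 6; 6; 5; 3]%N i.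
exists 4%N, kind, k; split=> //; try by rewrite !big_ord_recl big_ord0.
  by case=> -[|[|[|[|]]]].
case=> j j4 m; have [j3|j3] := ltnP j 3.
  (* Only the quadric with 5 lines has q - k = 2. For it the two others go to different lines y = d,
     and one line of the second moves from x = 5 to x = 6, where only the plane would otherwise
     contribute. *)
  apply: (@quadric_cert_forced 4 7 kind k j (fun i => if (j == 2) && (i == 1) then 1 else 0)%N
    (fun i b => if [&& j == 2, i == 1 & b == 5]%N then 6%N else b)) => //.
  by move: j j4 j3; do 3?[case=> [_|]]; vm_compute.
(* Each of the four values of mu needs four points. The first four lines of every quadric give three
   of them; the remaining 2 + 2 + 1 lines, taken with the other sign, run through the four values
   again. *)
apply: (@plane_cert_forced 4 7 kind k j (fun i b => if (b < 4)%N then b else (i * 2 + (b - 4)) %% 4)%N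
    (fun i b => (b < 4)%N)) => //; first by rewrite /kind -leqNgt.
by have -> : j = 3%N by [lia]; vm_compute.
Qed.

(* The general formula fails for small q; the list gives (n, k, e, r) for q < 40,
   with dummy entries at 0, 6 and 7. *)
Definition uniform_params (q : nat) : nat * nat * nat * nat :=
  nth (let n := (q + 2) %/ 3 in (n, if (3 %| q)%N then n.*2.+1 else n.*2, q - n.*2, uphalf q))%N
  [:: (0, 0, 0, 0); (0, 0, 1, 1); (1, 2, 0, 1); (1, 3, 1, 2); (2, 4, 0, 4); (2, 4, 1, 3);
      (0, 0, 0, 0); (0, 0, 0, 0); (3, 6, 2, 4); (3, 7, 3, 4); (3, 8, 4, 4); (4, 8, 3, 5);
      (4, 9, 4, 5); (5, 10, 3, 6); (5, 10, 4, 6); (5, 11, 5, 7); (5, 12, 6, 7); (5, 13, 7, 7);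
      (6, 13, 6, 8); (6, 14, 7, 8); (6, 16, 8, 8); (6, 16, 9, 9); (7, 16, 8, 10); (7, 17, 9, 10);
      (7, 18, 10, 10); (8, 18, 9, 11); (8, 19, 10, 11); (8, 20, 11, 12); (8, 21, 12, 12);
      (9, 21, 11, 13); (9, 22, 12, 13); (9, 23, 13, 13); (10, 23, 12, 14); (10, 24, 13, 14);
      (10, 25, 14, 15); (10, 26, 15, 15); (11, 26, 14, 16); (11, 27, 15, 16); (11, 28, 16, 16);
      (11, 29, 17, 17)]%N q.

(** The summand 4 expresses that the number of lines is at most 2 q^2 / 5 rounded up. *)
Definition params_ok (q : nat) : bool :=
  let: (n, k, e, r) := uniform_params q in
  uniform_ok n k e r q && (5 * (n * k + e * r) <= 2 * q ^ 2 + 4)%N.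

(** The formula involves q/3 and q/2 rounded, so q = 6 u + r is treated by residues; five times the
    number of lines is then 70 u^2 up to linear terms, against 72 u^2. *)
Lemma params_ok_large q : (40 <= q)%N -> params_ok q.
Proof.
move=> q40; rewrite /params_ok /uniform_params nth_default //.
have [u [r [qE r6]]] : exists u r, q = (u * 6 + r)%N /\ (r < 6)%N.
  by exists (q %/ 6)%N, (q %% 6)%N; rewrite -divn_eq ltn_pmod.
have [n3 k3] : ((q + 2) %/ 3 = if r == 0 then u * 2 else if r <= 3 then u * 2 + 1 else u * 2 + 2)%N /\
    (3 %| q)%N = (r == 0)%N || (r == 3)%N.
  rewrite qE; move: r6; clear; move: r; do 6?[case=> [_|]] => //=; split; try lia;
      apply/idP/idP; lia.
have u2 : uphalf q = if (r < 5)%N then (u * 3 + uphalf r)%N else (u * 3 + 3)%N.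
  by rewrite qE; move: r6; clear; move: r; do 6?[case=> [_|]] => //=; lia.
rewrite /= n3 k3 u2 /uniform_ok -!muln2 -mulnn.
(* This is (u - 6)(u - 7) >= 0, the one nonlinear fact by which the quadratic margin beats the
   linear terms. *)
have uu : (13 * u <= u * u + 42)%N.
  have u6 : (6 <= u)%N by lia.
  rewrite -(subnK u6); move: (u - 6)%N => v.
  have : (v <= v * v)%N by case: v => // v; rewrite leq_pmulr.
  lia.
rewrite qE in q40 *; move: r6 q40 uu; clear; move: r; do 6?[case=> [_|]] => //= q40 uu;
  (apply/andP; split; last by lia); by repeat (apply/andP; split); lia.
Qed.

Lemma realizable_ex q s : (0 < q)%N -> (2 * q ^ 2 <= 5 * s)%N -> s \notin [:: 4; 7; 10]%N ->
  realizable q s.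
Proof.
move=> q0 le; rewrite !inE => ns.
have uni n k e r : uniform_ok n k e r q -> (n * k + e * r <= s)%N -> realizable q s.
  exact: uniform_realizable.
have mono q' s' : realizable q' s' -> (s' <= s)%N -> realizable q' s.
  by move=> [N [kind [k [h1 h2 h3 h4]]]] ss; exists N, kind, k; split=> //; apply: leq_trans ss.
have [q40|q40] := leqP 40 q.
  have := params_ok_large q40; rewrite /params_ok.
  by case: uniform_params => [[[n k] e] r] /andP[ok tot]; apply: (uni _ _ _ _ ok); lia.
have [q6|n6] := eqVneq q 6%N; first by rewrite q6 in le *; apply: mono realizable_6 _; lia.
have [q7|n7] := eqVneq q 7%N; first by rewrite q7 in le *; apply: mono realizable_7 _; lia.
(* These three configurations have 5, 8 and 11 lines, while the inequality alone allows s = 4, 7 and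
   10; the exclusion of these values is used here. *)
have [qs|qs] := boolP (q \in [:: 3; 4; 5]%N).
  have := uniform_params q; rewrite !inE in qs.
  by case/or3P: qs => /eqP qE; rewrite qE in le uni * => _; 
    [apply: (uni 1 3 1 2)%N|apply: (uni 2 4 0 4)%N|apply: (uni 2 4 1 3)%N] => //; lia.
have : params_ok q.
  have : all (fun q => (q \in [:: 0; 3; 4; 5; 6; 7]%N) || params_ok q) (iota 0 40) by vm_compute.
  move/all_iota_lt => /(_ _ q40) /orP[|//]; rewrite !inE in qs *; lia.
by rewrite /params_ok; case: uniform_params => [[[n k] e] r] /andP[ok tot]; apply: (uni _ _ _ _ ok); lia.
Qed.

End Realization.

(** * Symbolic powers of the ideal of lines *)

Section Lines.
Variable K : closedFieldType.
Hypothesis K_char0 : [pchar K] =i pred0.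
Implicit Types (f h : {mpoly K[4]}) (l : line K) (P u v w : 'rV[K]_4) (U : {vspace 'rV[K]_4}).

Definition on_line l : 'rV[K]_4 -> Prop := fun P => P \in val l.

Lemma mem_span2 u v P : (P \in <<[:: u; v]>>%VS) <-> plane2 u v P.
Proof.
rewrite span_cons span_seq1; split.
  by move=> /memv_addP[_ /vlineP[a ->] [_ /vlineP[b ->] ->]]; exists a, b.
by move=> [a [b ->]]; rewrite memv_add ?memvZ ?memv_line.
Qed.

Lemma free2_eq0 u v a b : free [:: u; v] -> a *: u + b *: v = 0 -> a = 0 /\ b = 0.
Proof.
rewrite free_cons span_seq1 seq1_free => /andP[nu nv] E.
have a0 : a = 0.
  apply/eqP/negPn/negP => a0; move/negP: nu; apply.
  apply/vlineP; exists (- (a^-1 * b)); apply: (scalerI a0).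
  by rewrite scalerA mulrN mulrA mulfV // mul1r scaleNr; apply/eqP; rewrite -addr_eq0 E.
split=> //; move: E; rewrite a0 scale0r add0r => /eqP.
by rewrite scaler_eq0 (negPf nv) orbF => /eqP.
Qed.

Lemma vbasis2 U : \dim U = 2%N -> exists u v,
  [/\ vbasis U = [:: u; v] :> seq _, free [:: u; v] & U = <<[:: u; v]>>%VS].
Proof.
move=> dU; have := basis_free (vbasisP U); have := span_basis (vbasisP U).
move: (size_tuple (vbasis U)); rewrite {2}dU.
case: (tval (vbasis U)) => [|u [|v [|//]]] // _ s fr; by exists u, v.
Qed.

Lemma line_basis l : exists u v, [/\ vbasis (val l) = [:: u; v] :> seq _, free [:: u; v] &
  forall P, on_line l P <-> plane2 u v P].
Proof.
have [u [v [E fr s]]] := vbasis2 (eqP (valP l)); exists u, v; split=> // P.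
by rewrite /on_line s mem_span2.
Qed.

Lemma line_matrix l : exists2 g : 'M[K]_4, g \in unitmx &
  forall P, on_line l P <-> plane2 (row i0 g) (row i1 g) P.
Proof.
have [u [v [_ fr lE]]] := line_basis l.
have [|w [z [_ fr' cE]]] := @vbasis2 (val l)^C%VS.
  by rewrite dimv_compl (eqP (valP l)) dimvf /dim /= mul1n.
have r0 : row i0 (rows4 u v w z) = u by apply/rowP => k; rewrite !mxE.
have r1 : row i1 (rows4 u v w z) = v by apply/rowP => k; rewrite !mxE.
have r2 : row i2 (rows4 u v w z) = w by apply/rowP => k; rewrite !mxE.
have r3 : row i3 (rows4 u v w z) = z by apply/rowP => k; rewrite !mxE.
exists (rows4 u v w z); last by rewrite r0 r1.
rewrite -row_free_unit; apply: inj_row_free => x.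
rewrite mulmx_sum_row big_I4 /= r0 r1 r2 r3 addrA => E.
have L1 : x 0 i0 *: u + x 0 i1 *: v \in val l by apply/lE; exists (x 0 i0), (x 0 i1).
have L2 : x 0 i0 *: u + x 0 i1 *: v \in (val l)^C%VS.
  have -> : x 0 i0 *: u + x 0 i1 *: v = - (x 0 i2 *: w + x 0 i3 *: z).
    by apply/eqP; rewrite -addr_eq0 E.
  by rewrite memvN cE mem_span2; exists (x 0 i2), (x 0 i3).
have E1 : x 0 i0 *: u + x 0 i1 *: v = 0.
  by apply/eqP; rewrite -memv0 -(capv_compl (val l)) memv_cap L1 L2.
have [x0 x1] := free2_eq0 fr E1.
have [x2 x3] : x 0 i2 = 0 /\ x 0 i3 = 0.
  by apply: (free2_eq0 fr'); rewrite -E E1 add0r.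
by apply/rowP; apply: I4P; rewrite mxE.
Qed.

(** A coordinate of the projection along U in which v - [projv U v] is nonzero. *)
Lemma separating_form U v : v \notin U -> exists h : {mpoly K[4]},
  [/\ h \is 1.-homog, forall P, P \in U -> h.@[P 0] = 0 & h.@[v 0] != 0].
Proof.
move=> vU; have /rV0Pn[c vc] : v - projv U v != 0.
  by apply: contra vU; rewrite subr_eq0 => /eqP ->; apply: memv_proj.
pose h : {mpoly K[4]} := \sum_k ((delta_mx 0 k - projv U (delta_mx 0 k)) 0 c) *: 'X_k.
have hE P : h.@[P 0] = (P - projv U P) 0 c.
  have -> : P - projv U P = \sum_k P 0 k *: (delta_mx 0 k - projv U (delta_mx 0 k)).
    under eq_bigr do rewrite scalerBr.
    rewrite sumrB -row_sum_delta; congr (_ - _).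
    by rewrite {1}(row_sum_delta P) linear_sum; apply: eq_bigr => k _; rewrite linearZ.
  rewrite summxE /h raddf_sum /=; apply: eq_bigr => k _.
  by rewrite mevalZ mevalXU [RHS]mxE mulrC.
exists h; split.
- by apply: rpred_sum => k _; apply: rpredZ; rewrite dhomogX /= mdeg1.
- by move=> P PU; rewrite hE projv_id // subrr mxE.
- by rewrite hE.
Qed.

Lemma linepoly_eval f : linepoly (fun P : 'rV[K]_4 => f.@[P 0]).
Proof.
apply: (@linepoly_meval K _ 4 f (fun i (P : 'rV[K]_4) => P 0 i)) => i a b.
by exists ((a 0 i)%:P + b 0 i *: 'X) => x; rewrite !hornerE !mxE mulrC.
Qed.

Definition vanish_on U : set {mpoly K[4]} := [set h | forall P, P \in U -> h.@[P 0] = 0].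

(** A point of U where f is nonzero and one where h is nonzero are joined by a line inside U, on
    which both are nonzero polynomials in one variable. *)
Lemma vanish_on_prime U f h : vanish_on U (f * h) -> vanish_on U f \/ vanish_on U h.
Proof.
move=> V; apply/or_asboolP/negPn/negP; rewrite negb_or => /andP[].
move=> /asboolPn/existsNP[P /not_implyP[PU /eqP fP]] /asboolPn/existsNP[Q /not_implyP[QU /eqP hQ]].
have [p pE] := linepoly_eval f P (Q - P); have [r rE] := linepoly_eval h P (Q - P).
have p0 : p != 0.
  by apply: contraNneq fP => p0; have := pE 0; rewrite p0 horner0 scale0r addr0 => ->.
have r0 : r != 0.
  by apply: contraNneq hQ => r0; have := rE 1; rewrite r0 horner0 scale1r addrC subrK => ->.
have [x] := poly_nonroot K_char0 (mulf_neq0 p0 r0).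
by rewrite hornerM -pE -rE -mevalM V ?eqxx // memvD // memvZ // memvB.
Qed.

Section Family.
Variables (s : nat) (L : 'I_s -> line K).
Implicit Types i j : 'I_s.

Lemma lines_idealE f : lines_ideal L f <-> forall i, vanish_on (val (L i)) f.
Proof. by split=> H i; [move=> P; apply: H|apply: H]. Qed.

(** A product of factors, one for each index. Lines of the family may coincide, hence the comparison
    of the subspaces rather than of the indices. *)
Lemma complementary_factor i : exists x : {mpoly K[4]}, ~ vanish_on (val (L i)) x /\
  forall j, val (L j) != val (L i) -> vanish_on (val (L j)) x.
Proof.
have /choice[h hP] : forall j, exists h : {mpoly K[4]}, ~ vanish_on (val (L i)) h /\
    (val (L j) != val (L i) -> vanish_on (val (L j)) h).
  move=> j; have [E|ne] := eqVneq (val (L j)) (val (L i)).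
    exists 1; split=> // /(_ 0 (mem0v _)) /eqP; by rewrite meval1 oner_eq0.
  have : ~~ (val (L i) <= val (L j))%VS.
    apply: contra ne => le; rewrite eq_sym eqEdim le.
    by rewrite (eqP (valP (L i))) (eqP (valP (L j))).
  move=> /subvPn[v vi vj]; have [h [_ h0 hv]] := separating_form vj.
  by exists h; split=> // /(_ v vi) /eqP; rewrite (negPf hv).
exists (\prod_j h j); split.
  elim/big_ind: _ => [|x y nx ny /vanish_on_prime[]//|j _]; last exact: (hP j).1.
  by move=> /(_ 0 (mem0v _)) /eqP; rewrite meval1 oner_eq0.
by move=> j ne P PL; rewrite (bigD1 j) //= mevalM (hP j).2 // mul0r.
Qed.

(** The annihilator of the complementary factor modulo the ideal is the ideal of the i-th line,
    because the latter is prime. *)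
Lemma line_prime_associated i : associated_prime (lines_ideal L) (vanish_on (val (L i))).
Proof.
have [x [nx xj]] := complementary_factor i.
split.
- split; rewrite ?inE.
  + by move=> P _; rewrite meval0.
  + by apply/negP; rewrite inE => /(_ 0 (mem0v _)) /eqP; rewrite meval1 oner_eq0.
  + move=> a u v; rewrite !inE => Hu Hv P PL.
    by rewrite mevalD mevalM Hu // Hv // mulr0 addr0.
- by move=> u v; rewrite !inE => /vanish_on_prime[] H; apply/orP; [left|right]; rewrite inE.
- exists x; apply/seteqP; split=> f /=; rewrite lines_idealE => H.
    move=> j P PL; rewrite mevalM.
    have [E|ne] := eqVneq (val (L j)) (val (L i)); first by rewrite H ?mul0r // -E.
    by rewrite (xj j ne) ?mulr0.
  by have [|] := vanish_on_prime (H i).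
Qed.

(** From left to right: at the prime of a line f b lies in I^m for some b not vanishing on the line,
    and b cancels. Conversely, an associated prime is I : x with x not vanishing on some line; f is
    in the m-th power of the ideal of that line, and a complementary factor y gives f y^m in I^m
    with y^m outside the prime. *)
Lemma symbolic_powerE m f :
  symbolic_power (lines_ideal L) m f <-> forall i, vanish f (on_line (L i)) m.
Proof.
split=> [sf i|Vf P [[_ P1 _] _ [x PE]]].
  have [a [b [Ia nb E]]] := sf _ (line_prime_associated i).
  have /existsNP[Q /not_implyP[QL bQ]] : ~ vanish_on (val (L i)) b by move=> H; apply: nb.
  have b0 : b != 0 by apply: contra_notN bQ => /eqP ->; rewrite meval0.
  have fb : f * b = a.
    by apply/eqP; rewrite -tofrac_eq tofracM E divfK ?tofrac_eq0.
  apply: (@vanish_cancel K K_char0 f b _ m 0 Q 0) => //.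
  - by move=> P R y PL RL; rewrite /on_line memvD // memvZ // memvB.
  - rewrite addn0 fb; apply: vanish_ideal_power Ia => h /lines_idealE Ih R RL.
    exact: (Ih i).
  - by exists 0%N => //; rewrite fline_coef0; apply/eqP.
have [i xi] : exists i, ~ vanish_on (val (L i)) x.
  apply/existsNP => H; move/negP: P1; apply; rewrite inE PE /= mul1r.
  by apply/lines_idealE.
have [y [ny yj]] := complementary_factor i.
have [g gu gE] := line_matrix (L i).
have [n [c [h [Ph fE]]]] : ideal_power (vanish_on (val (L i))) m f.
  have [|n [c [h [Ph fE]]]] := @vanish_in_ideal_power K K_char0 f g m gu.
    by move=> R w /gE; apply: Vf.
  by exists n, c, h; split=> // a b R /gE; apply: Ph.
have ym : ~ vanish_on (val (L i)) (y ^+ m).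
  elim: m {Vf c h Ph fE} => [|m IH]; last by rewrite exprS => /vanish_on_prime[].
  by move=> /(_ 0 (mem0v _)) /eqP; rewrite meval1 oner_eq0.
exists (f * y ^+ m), (y ^+ m); split.
- exists n, c, (fun a b => h a b * y); split.
    move=> a b; apply/lines_idealE => j R RL; rewrite mevalM.
    have [E|ne] := eqVneq (val (L j)) (val (L i)); first by rewrite Ph ?mul0r // -E.
    by rewrite (yj j ne) ?mulr0.
  rewrite fE mulr_suml; apply: eq_bigr => a _.
  by rewrite big_split /= prodr_const card_ord mulrA.
- rewrite PE /= => /lines_idealE /(_ i) /vanish_on_prime[] //.
- rewrite tofracM mulfK // tofrac_eq0.
  by apply: contra_notN ym => /eqP -> R _; rewrite meval0.
Qed.

End Family.
End Lines.

(** * Initial degrees of the symbolic powers *)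

Section InitialDegrees.
Variable K : closedFieldType.
Hypothesis K_char0 : [pchar K] =i pred0.
Variable s : nat.
Implicit Types (L : 'I_s -> line K) (m t : nat).

Definition has_form L m t : Prop := exists f : {mpoly K[4]},
  [/\ forall i, vanish f (on_line (L i)) m, f \is t.-homog & f != 0].

Definition alpha L m : nat := initial_degree (symbolic_power (lines_ideal L) m).

Lemma has_formM L m m' t t' :
  has_form L m t -> has_form L m' t' -> has_form L (m + m') (t + t').
Proof.
move=> [f [Vf fh f0]] [g [Vg gh g0]]; exists (f * g); split.
- by move=> i; apply: vanishM.
- exact: dhomogM.
- exact: mulf_neq0.
Qed.

Lemma has_form_le L m t t' : (t <= t')%N -> has_form L m t -> has_form L m t'.
Proof.
move=> le H; rewrite -(subnKC le) -[m]addn0; apply: has_formM => //.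
exists ('X_i0 ^+ (t' - t)); split.
- by move=> i P w _ [].
- by rewrite mpolyXn dhomogX /= mdegMn mdeg1 mul1n.
- by rewrite mpolyXn -msupp_eq0 msuppX.
Qed.

(** One linear form through each line, to the power m. This bounds the initial degree and rules out
    the default value 0 in its definition. *)
Lemma has_form_ex L m : has_form L m (s * m).
Proof.
have H i : exists h : {mpoly K[4]},
    [/\ h \is 1.-homog, forall P, P \in val (L i) -> h.@[P 0] = 0 & h != 0].
  have : ~~ (fullv <= val (L i))%VS.
    by apply/negP => /dimvS; rewrite (eqP (valP (L i))) dimvf /dim /= mul1n.
  move=> /subvPn[v _ /separating_form [h [hh h0 hv]]]; exists h; split=> //.
  by apply: contraNneq hv => ->; rewrite meval0.
have [h hP] := choice H; exists (\prod_i h i ^+ m); split.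
- move=> i; rewrite (bigD1 i) //= mulrC; apply: vanishMl.
  elim: m => [|m IH] //; rewrite exprSr -(addn1 m); apply: vanishM => //.
  by apply: vanish1 => P PL; have [_ h0 _] := hP i; apply: h0.
- have -> : (s * m = \sum_(i < s) m)%N by rewrite sum_nat_const card_ord.
  elim/big_rec2: _ => [|i p t _ ph]; first exact: dhomog1.
  apply: dhomogM => //; have [hh _ _] := hP i.
  elim: m {p ph} => [|m IH]; first exact: dhomog1.
  by rewrite exprS -(add1n m); apply: dhomogM.
- by apply/prodf_neq0 => i _; rewrite expf_neq0 //; have [] := hP i.
Qed.

Lemma alphaP L m : has_form L m (alpha L m) /\ forall t, has_form L m t -> (alpha L m <= t)%N.
Proof.
have [t0 /asboolP H0 H1] := ex_minnP (ex_intro (fun t => `[< has_form L m t >]) _ (asboolT (has_form_ex L m))).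
have iff t : has_form L m t <->
    [set t | exists f, [/\ symbolic_power (lines_ideal L) m f, f \is t.-homog & f != 0]] t.
  by split=> -[f [H fh f0]]; exists f; split=> //; apply/(symbolic_powerE K_char0).
have : (alpha L m) = t0.
  apply: xget_unique.
    split; first exact/iff.
    by move=> t /iff Ht; apply: H1; apply/asboolP.
  move=> t [/iff Ht lt]; apply/eqP; rewrite eqn_leq.
  by rewrite (H1 t) ?andbT; [apply: lt; apply/iff|apply/asboolP].
by move=> ->; split=> // t Ht; apply: H1; apply/asboolP.
Qed.

Lemma alpha_le L m : (alpha L m <= s * m)%N.
Proof. by have [_] := alphaP L m; apply; apply: has_form_ex. Qed.

Lemma alphaD L m n : (alpha L (m + n) <= alpha L m + alpha L n)%N.
Proof.
have [_] := alphaP L (m + n); apply; apply: has_formM.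
- by have [] := alphaP L m.
- by have [] := alphaP L n.
Qed.

Lemma free2P (u v : 'rV[K]_4) :
  (forall a b, a *: u + b *: v = 0 -> a = 0 /\ b = 0) -> free [:: u; v].
Proof.
move=> H; rewrite free_cons span_seq1 seq1_free; apply/andP; split.
  apply/negP => /vlineP[a E]; have E1 : 1 *: u + - a *: v = 0.
    by rewrite E scale1r scaleNr subrr.
  by have /eqP := (H _ _ E1).1; rewrite oner_eq0.
apply/negP => /eqP v0; have E1 : 0 *: u + 1 *: v = 0.
  by rewrite v0 scale0r scaler0 addr0.
by have /eqP := (H _ _ E1).2; rewrite oner_eq0.
Qed.

Lemma line_span (u v : 'rV[K]_4) : free [:: u; v] ->
  exists l : line K, forall P, on_line l P <-> plane2 u v P.
Proof.
move=> fr; have d : \dim <<[:: u; v]>> == 2%N by rewrite (eqnP fr).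
by exists (exist (fun U : {vspace 'rV[K]_4} => \dim U == 2%N) _ d) => P; apply: mem_span2.
Qed.

Lemma line_ex : exists l : line K, True.
Proof.
have [|l _] := @line_span (delta_mx 0 i0) (delta_mx 0 i1); last by exists l.
apply: free2P => x y /rowP E; have := E i0; have := E i1.
by rewrite !mxE /= !(mulr0, mulr1, addr0, add0r).
Qed.

Lemma lines_of_high_alpha q m : (0 < q)%N -> realizable K q s ->
  exists L, (q * m <= alpha L m)%N.
Proof.
move=> q0 [N [kind [k [kq sq ks forced]]]].
have [|c ok] := @cfg_ok_ex K K_char0 N q kind k m; first by move=> j m' _; apply: forced.
have [dets dist nz _] := ok.
have fr i b : free [:: cfg0 c i b; cfg1 kind c i b].
  apply: free2P => x y E; have gu : c.1 i \in unitmx by rewrite unitmxE unitfE.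
  have {E} : x *: ruling0 (c.2 i b) + y *: ruling1 (kind i) (c.2 i b) = 0 :> 'rV[K]_4.
    by rewrite -[LHS](mulmxK gu) mulmxDl -!scalemxAl E mul0mx.
  move=> /rowP E; have := E i0; have := E i1.
  by rewrite !mxE /= !(mulr0, mulr1, addr0, add0r).
have lE i b := line_span (fr i b).
have [l lP] := choice (fun p : 'I_N * 'I_q => lE p.1 p.2).
pose ps : seq ('I_N * 'I_q) := enum [pred p : 'I_N * 'I_q | (p.2 < k p.1)%N].
have sps : (size ps <= s)%N.
  rewrite -cardE -sum1_card -(pair_big_dep predT (fun i (b : 'I_q) => (b < k i)%N) (fun _ _ => 1%N)) /=.
  apply: leq_trans ks; apply: leq_sum => i _.
  rewrite sum1_card cardE -[X in (_ <= X)%N](count_ord_lt (kq i)).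
  apply: uniq_leq_size => [|b]; first exact: enum_uniq.
  by rewrite mem_enum mem_filter mem_enum => h; rewrite andbT; apply: h.
(* The configuration may have fewer than s lines; the list is filled up with an arbitrary line,
   which only adds conditions on f. *)
have [l0 _] := line_ex.
exists (fun i => nth l0 [seq l p | p <- ps] i).
rewrite leqNgt; apply/negP => lt.
have [[f [Vf fh /eqP f0]] _] := alphaP (fun i : 'I_s => nth l0 [seq l p | p <- ps] i) m.
apply: f0; apply: (cfg_horace K_char0 kq sq ok fh lt) => i b lb.
have pin : (i, b) \in ps by rewrite mem_enum inE.
have ix : (index (i, b) ps < s)%N by apply: leq_trans sps; rewrite index_mem.
move=> P w PU; apply: (Vf (Ordinal ix)).
by rewrite /= (nth_map (i, b)) ?index_mem // nth_index //; apply/lP.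
Qed.

End InitialDegrees.

(** * Closedness in Pluecker coordinates *)

Section GroupedDegrees.
Variables (K : fieldType) (s : nat).
Notation A := {mpoly K[s * 6]}.
Implicit Types (d : 'I_s -> nat) (F G : A) (Q : {poly A}).

Definition grouped d F : Prop :=
  forall e, e \in msupp F -> forall i, (\sum_(j < 6) e (mxvec_index i j) = d i)%N.

Lemma grouped_multihomogeneous d F : grouped d F -> multihomogeneous F.
Proof. by move=> H i; exists (d i) => e eF; apply: H. Qed.

Lemma grouped0 d : grouped d 0.
Proof. by move=> e; rewrite msupp0. Qed.

Lemma groupedC c : grouped (fun=> 0%N) c%:MP.
Proof.
move=> e; rewrite msuppC; case: ifP => // _; rewrite inE => /eqP -> i.
by apply: big1 => j _; rewrite mnm0E.
Qed.

Lemma groupedD d F G : grouped d F -> grouped d G -> grouped d (F + G).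
Proof. by move=> HF HG e /msuppD_le; rewrite mem_cat => /orP[/HF|/HG]. Qed.

Lemma groupedN d F : grouped d F -> grouped d (- F).
Proof. by move=> HF e; rewrite (perm_mem (msuppN F)) => /HF. Qed.

Lemma groupedM d d' F G : grouped d F -> grouped d' G -> grouped (fun i => d i + d' i)%N (F * G).
Proof.
move=> HF HG e /msuppM_le /allpairsP[[a b] /= [/HF ha /HG hb ->]] i.
by rewrite -ha -hb -big_split /=; apply: eq_bigr => j _; rewrite mnmDE.
Qed.

Lemma eq_grouped d d' F : d =1 d' -> grouped d F -> grouped d' F.
Proof. by move=> E H e eF i; rewrite -E H. Qed.

Lemma grouped_sum (I : Type) (r : seq I) (P : pred I) d (F : I -> A) :
  (forall i, P i -> grouped d (F i)) -> grouped d (\sum_(i <- r | P i) F i).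
Proof.
move=> H; elim/big_ind: _ => [|F1 F2|i /H //]; [exact: grouped0|exact: groupedD].
Qed.

Lemma grouped_prod (I : finType) (d : I -> 'I_s -> nat) (F : I -> A) :
  (forall i, grouped (d i) (F i)) -> grouped (fun g => \sum_i d i g)%N (\prod_i F i).
Proof.
move=> H; suff: forall r : seq I, grouped (fun g => \sum_(i <- r) d i g)%N (\prod_(i <- r) F i) by [].
elim=> [|i r IH].
  by rewrite big_nil -mpolyC1; apply: eq_grouped (@groupedC 1) => g; rewrite big_nil.
by rewrite big_cons; apply: eq_grouped (groupedM (H i) IH) => g; rewrite big_cons.
Qed.

Lemma grouped_det n (d : 'I_n -> 'I_s -> nat) (M : 'M[A]_n) :
  (forall a b, grouped (d a) (M a b)) -> grouped (fun g => \sum_a d a g)%N (\det M).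
Proof.
move=> H; apply: grouped_sum => /= p _.
have HP := grouped_prod (fun a => H a (p a)).
by case: (odd_perm p); rewrite ?expr1 ?expr0 ?mulN1r ?mul1r //; apply: groupedN.
Qed.

Definition in_group (i : 'I_s) (d : nat) : 'I_s -> nat := fun g => if g == i then d else 0%N.

Lemma groupedX i j : grouped (in_group i 1) 'X_(mxvec_index i j).
Proof.
move=> e; rewrite msuppX inE => /eqP -> g; rewrite /in_group.
have idx (j' : 'I_6) : (mxvec_index i j == mxvec_index g j') = (g == i) && (j' == j).
  rewrite /mxvec_index (inj_eq (@cast_ord_inj _ _ _)) (inj_eq enum_rank_inj).
  by rewrite xpair_eqE eq_sym [j == _]eq_sym.
under eq_bigr do rewrite mnm1E idx.
case: ifP => _ /=; last by rewrite big1.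
by rewrite (bigD1 j) //= eqxx big1 // => j' /negPf ->.
Qed.

(** Homogeneity of degree d in the variables of group i and the polynomial variable taken
    together. *)
Definition pgrouped i (d : nat) Q : Prop := forall l,
  grouped (in_group i (d - l)) Q`_l /\ ((d < l)%N -> Q`_l = 0).

Lemma pgroupedM i (d d' : nat) Q Q' : pgrouped i d Q -> pgrouped i d' Q' -> pgrouped i (d + d') (Q * Q').
Proof.
move=> H H' l; rewrite coefM; split.
  apply: grouped_sum => /= a _.
  have [da|da] := ltnP d a; first by rewrite (H a).2 // mul0r; apply: grouped0.
  have [la|la] := ltnP d' (l - a); first by rewrite (H' _).2 // mulr0; apply: grouped0.
  apply: eq_grouped (groupedM (H a).1 (H' (l - a)%N).1) => g; rewrite /in_group.
  by case: ifP => // _; have := ltn_ord a; lia.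
move=> lt; apply: big1 => a _; have [da|da] := ltnP d a; first by rewrite (H a).2 // mul0r.
by rewrite (H' _).2 ?mulr0 //; have := ltn_ord a; lia.
Qed.

Lemma pgrouped1 i : pgrouped i 0 1.
Proof.
move=> l; rewrite coef1; case: l => [|l] /=; split=> //; last exact: grouped0.
by rewrite -mpolyC1; apply: eq_grouped (@groupedC 1) => g; rewrite /in_group; case: ifP.
Qed.

Lemma pgroupedX i (d : nat) Q n : pgrouped i d Q -> pgrouped i (n * d) (Q ^+ n).
Proof.
move=> H; elim: n => [|n IH]; first exact: pgrouped1.
by rewrite exprS mulSn; apply: pgroupedM.
Qed.

Lemma pgrouped_linear i F c : grouped (in_group i 1) F -> pgrouped i 1 (F%:P + c%:MP *: 'X).
Proof.
move=> H [|[|l]]; rewrite coefD coefC coefZ coefX /= ?mulr0 ?mulr1 ?addr0 ?add0r.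
- by split.
- by split=> //; apply: eq_grouped (@groupedC c) => g; rewrite /in_group; case: ifP.
- by split=> //; apply: grouped0.
Qed.

End GroupedDegrees.

Section Pluecker.

(** The alternating matrix of the Pluecker coordinates. Its row space is the line, which gives a
    parametrization by bilinear expressions in the Pluecker coordinates without choosing a basis. *)
Definition plmx (A : nzRingType) (x : 'I_6 -> A) : 'M[A]_4 := \matrix_(a, b)
  if (a < b)%N then x (inord (index (a : nat, b : nat) pluecker_pairs))
  else if (b < a)%N then - x (inord (index (b : nat, a : nat) pluecker_pairs)) else 0.

Variable K : closedFieldType.
Implicit Types (l : line K) (u v P : 'rV[K]_4).

Definition wedge u v : 'rV[K]_6 :=
  \row_k let: (i, j) := nth (0, 0)%N pluecker_pairs k in
         u 0 (inord i) * v 0 (inord j) - u 0 (inord j) * v 0 (inord i).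

Lemma plmx_wedge u v a b : plmx (wedge u v 0) a b = u 0 a * v 0 b - u 0 b * v 0 a.
Proof.
have H (c d : 'I_4) : (c < d)%N ->
    wedge u v 0 (inord (index (c : nat, d : nat) pluecker_pairs)) = u 0 c * v 0 d - u 0 d * v 0 c.
  move=> cd; have cdP : (c : nat, d : nat) \in pluecker_pairs.
    by move: c d cd; apply: I4P; apply: I4P.
  rewrite mxE inordK; last by rewrite -[6%N]/(size pluecker_pairs) index_mem.
  by rewrite nth_index //= !inord_val.
rewrite mxE; case: ltngtP => ab; first exact: H.
  by rewrite H // opprB.
by rewrite (val_inj ab) subrr.
Qed.

Lemma mul_plmx (phi u v : 'rV[K]_4) : phi *m plmx (wedge u v 0) =
  (\sum_a phi 0 a * u 0 a) *: v - (\sum_a phi 0 a * v 0 a) *: u.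
Proof.
apply/rowP => b; rewrite !mxE !mulr_suml -sumrB; apply: eq_bigr => a _.
by rewrite plmx_wedge; ring.
Qed.

Lemma wedge_neq0 u v : free [:: u; v] -> wedge u v != 0.
Proof.
move=> fr; apply/eqP => w0.
have E a b : u 0 a * v 0 b = u 0 b * v 0 a.
  have z0 k : wedge u v 0 k = 0 by rewrite w0 mxE.
  by apply/eqP; rewrite -subr_eq0 -plmx_wedge mxE; do 2?case: ifP => _; rewrite ?z0 ?oppr0.
have u0 : u != 0 by move: fr; rewrite free_cons => /andP[+ _]; apply: contraNneq => ->; apply: mem0v.
have /rV0Pn[a ua] := u0.
have : (- v 0 a) *: u + u 0 a *: v = 0.
  by apply/rowP => b; rewrite !mxE E; ring.
by move=> /(free2_eq0 fr)[_ ua0]; rewrite ua0 eqxx in ua.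
Qed.

Lemma wedge_combination a b c d u v :
  wedge (a *: u + b *: v) (c *: u + d *: v) = (a * d - b * c) *: wedge u v.
Proof. by apply/rowP => k; rewrite !mxE; case: nth => i j; rewrite !mxE; ring. Qed.

Lemma wedge_span u v P : free [:: u; v] ->
  plane2 u v P <-> exists phi : 'rV[K]_4, P = phi *m plmx (wedge u v 0).
Proof.
move=> fr; split; last first.
  move=> [phi ->]; rewrite mul_plmx.
  by exists (- \sum_a phi 0 a * v 0 a), (\sum_a phi 0 a * u 0 a); rewrite scaleNr addrC.
move=> [x [y ->]].
have /rV0Pn[k] := wedge_neq0 fr; rewrite mxE; case: nth => i j; set a := inord i; set b := inord j.
set D := (X in X != 0) => D0.
have dl (z : 'I_4) c (t : 'rV[K]_4) : \sum_e (c *: delta_mx 0 z : 'rV_4) 0 e * t 0 e = c * t 0 z.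
  rewrite (bigD1 z) //= big1 => [|e ne]; last by rewrite !mxE (negPf ne) andbF mulr0 mul0r.
  by rewrite !mxE !eqxx mulr1 addr0.
(* Cramer's rule for the nonzero Pluecker coordinate D: the contractions of phi with u and v have to
   be y and -x. *)
exists (D^-1 *: ((x * u 0 b + y * v 0 b) *: delta_mx 0 a + (- x * u 0 a - y * v 0 a) *: delta_mx 0 b)).
rewrite -scalemxAl mulmxDl !mul_plmx !dl.
apply: (scalerI D0); rewrite scalerA mulfV // scale1r.
by apply/rowP => e; rewrite !mxE /D; ring.
Qed.

Lemma on_line_plmx l P : on_line l P <-> exists phi : 'rV[K]_4, P = phi *m plmx (pluecker l 0).
Proof.
have [u [v [E fr lP]]] := line_basis l.
have -> : pluecker l = wedge u v by rewrite /pluecker E.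
by rewrite lP; apply: wedge_span.
Qed.

End Pluecker.

Section Closedness.
Variable K : closedFieldType.
Variables (s m t : nat).
Notation A := {mpoly K[s * 6]}.
Implicit Types (L : 'I_s -> line K) (i : 'I_s) (phi w P : 'rV[K]_4).

Let T : finType := {e : 'X_{1..4 < t.+1} | mdeg e == t}.
Let n := #|T|.
Let mon (a : 'I_n) : 'X_{1..4} := bmnm (val (enum_val a)).
Let row_index : Type := ('I_s * 'rV[K]_4 * 'rV[K]_4 * 'I_m)%type.

Definition combine (x : 'cV[K]_n) : {mpoly K[4]} := \sum_a x a 0 *: 'X_[mon a].

Lemma mon_deg a : mdeg (mon a) = t.
Proof. exact: (eqP (valP (enum_val a))). Qed.

Lemma mon_inj : injective mon.
Proof. by move=> a b /val_inj /val_inj /enum_val_inj. Qed.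

Lemma coef_combine x a : (combine x)@_(mon a) = x a 0.
Proof.
rewrite /combine raddf_sum (bigD1 a) //= mcoeffZ mcoeffX eqxx mulr1 big1 ?addr0 // => b ne.
by rewrite mcoeffZ mcoeffX (inj_eq mon_inj) (negPf ne) mulr0.
Qed.

Lemma combine_homog x : combine x \is t.-homog.
Proof. by apply: rpred_sum => a _; apply: rpredZ; rewrite dhomogX /= mon_deg. Qed.

Lemma combine_ex (f : {mpoly K[4]}) : f \is t.-homog -> exists x, f = combine x.
Proof.
move=> fh; exists (\col_a f@_(mon a)); apply/mpolyP => e.
have [et|ne] := eqVneq (mdeg e) t; last first.
  by rewrite (dhomog_nemf_coeff fh ne) (dhomog_nemf_coeff (combine_homog _) ne).
have lt : (mdeg e < t.+1)%N by rewrite et.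
have et' : mdeg (BMultinom lt) == t by rewrite /= et.
have -> : e = mon (enum_rank (Sub (BMultinom lt) et' : T)).
  by rewrite /mon enum_rankK /=.
by rewrite coef_combine mxE.
Qed.

(** The expansion of the monomial e at the point phi of the i-th line in direction w, with the
    Pluecker coordinates as indeterminates. *)
Definition sym_poly i phi w (e : 'X_{1..4}) : {poly A} :=
  \prod_k (((\sum_a (phi 0 a)%:MP * plmx (fun j => 'X_(mxvec_index i j)) a k)%:P +
    (w 0 k)%:MP *: 'X) ^+ e k).

Definition sym_matrix (r : 'I_n -> row_index) : 'M[A]_n :=
  \matrix_(a, b) let: (i, phi, w, l) := r a in (sym_poly i phi w (mon b))`_l.

Lemma sym_poly_grouped i phi w e : pgrouped i (mdeg e) (sym_poly i phi w e).
Proof.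
rewrite mdegE /sym_poly; elim/big_rec2: _ => [|k d Q _ H]; first exact: pgrouped1.
apply: pgroupedM => //; rewrite -[X in pgrouped _ X _]muln1; apply: pgroupedX.
apply: pgrouped_linear; apply: grouped_sum => a _.
apply: (@eq_grouped _ _ (fun g => 0 + in_group i 1 g)%N) => //.
apply: groupedM; first exact: groupedC.
rewrite mxE; case: ifP => _; first exact: groupedX.
by case: ifP => _; [apply/groupedN/groupedX|apply: grouped0].
Qed.

Lemma sym_det_multihomogeneous r : multihomogeneous (\det (sym_matrix r)).
Proof.
apply: grouped_multihomogeneous; apply: (@grouped_det _ _ _ (fun a =>
  in_group (r a).1.1.1 (t - (r a).2))) => a b.
rewrite mxE; case: (r a) => [[[i phi] w] l] /=.
by have [] := sym_poly_grouped i phi w (mon b) l; rewrite mon_deg.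
Qed.

Definition pluecker_point L : 'I_(s * 6) -> K := mxvec (\matrix_(i < s) pluecker (L i)) 0.

Lemma meval_sym_poly L i phi w e :
  map_poly (meval (pluecker_point L)) (sym_poly i phi w e) =
  fline 'X_[e] (phi *m plmx (pluecker (L i) 0)) w.
Proof.
rewrite /fline mmapX rmorph_prod; apply: eq_bigr => k _.
rewrite rmorphXn rmorphD /= map_polyC map_polyZ map_polyX /= mevalC.
congr ((_%:P + _) ^+ _); rewrite mxE raddf_sum; apply: eq_bigr => a _ /=.
rewrite mevalM mevalC; congr (_ * _); rewrite mxE [RHS]mxE.
have X j : ('X_(mxvec_index i j) : A).@[pluecker_point L] = pluecker (L i) 0 j.
  by rewrite mevalXU /pluecker_point mxvecE mxE.
by case: ifP => _; first exact: X; case: ifP => _; rewrite ?mevalN ?meval0 ?X.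
Qed.

Definition vanish_rows L (p : row_index) : 'rV[K]_n :=
  let: (i, phi, w, l) := p in
  \row_b (fline 'X_[mon b] (phi *m plmx (pluecker (L i) 0)) w)`_l.

Lemma vanish_rowsE L x : (forall p, vanish_rows L p *m x = 0) <->
  forall i, vanish (combine x) (on_line (L i)) m.
Proof.
have E i phi w l : vanish_rows L (i, phi, w, l) *m x =
    ((fline (combine x) (phi *m plmx (pluecker (L i) 0)) w)`_l)%:M.
  apply/rowP => z; rewrite !ord1 mxE [RHS]mxE eqxx mulr1n /combine /fline raddf_sum coef_sum.
  by apply: eq_bigr => b _; rewrite mxE /= mmapZ coefCM mulrC.
split=> H.
  move=> i P w /on_line_plmx[phi ->] l lm.
  have := H (i, phi, w, Ordinal lm); rewrite E => /rowP/(_ 0).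
  by rewrite !mxE eqxx mulr1n.
move=> [[[i phi] w] l]; rewrite E (H i) ?raddf0 //.
by apply/on_line_plmx; exists phi.
Qed.

(** Forms of degree t with the required vanishing are the kernel of a linear system indexed by all
    points and directions. A nonzero solution exists exactly when all maximal minors vanish, and
    these are multihomogeneous in the Pluecker coordinates. *)
Lemma closed_has_form : zariski_closed [set L : 'I_s -> line K | has_form L m t].
Proof.
exists [set F | exists r, F = \det (sym_matrix r)]; split.
  by move=> _ [r ->]; apply: sym_det_multihomogeneous.
have detE L r : (\det (sym_matrix r)).@[pluecker_point L] = \det (\matrix_a vanish_rows L (r a)).
  rewrite -[LHS](det_map_mx (meval (pluecker_point L))); congr (\det _).
  apply/matrixP => a b; rewrite !mxE /vanish_rows; case: (r a) => [[[i phi] w] l].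
  by rewrite mxE -meval_sym_poly coef_map.
apply/seteqP; split=> L /=.
  move=> [f [Vf fh f0]] _ [r ->]; rewrite -/(pluecker_point L) detE.
  have [x fE] := combine_ex fh.
  apply/eqP/negPn/negP => d0.
  have x0 : x = 0.
    have Mu : (\matrix_a vanish_rows L (r a)) \in unitmx by rewrite unitmxE unitfE.
    rewrite -[x](mulKmx Mu).
    suff -> : (\matrix_a vanish_rows L (r a)) *m x = 0 by rewrite mulmx0.
    apply/row_matrixP => a; rewrite row_mul rowK row0.
    by apply: (vanish_rowsE L x).2; rewrite -fE.
  move/eqP: f0; apply; rewrite fE x0 /combine.
  by apply: big1 => a _; rewrite mxE scale0r.
move=> H; have [h|nh] := pselect (has_form L m t); first exact: h.
have [|r /eqP []] := @nonzero_minor K row_index n (vanish_rows L).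
  move=> x /vanish_rowsE Vx.
  have /eqP c0 : combine x == 0.
    apply/negPn/negP => c0; apply: nh; exists (combine x); split=> //.
    exact: combine_homog.
  by apply/colP => a; rewrite -coef_combine c0 mcoeff0 mxE.
by rewrite -detE; apply: H; exists r.
Qed.

End Closedness.

(** * Very general lines *)

Section VeryGeneral.
Variable K : closedFieldType.
Hypothesis K_char0 : [pchar K] =i pred0.
Hypothesis K_uncountable : ~ countable [set: K].

Lemma countable_roots (p : {poly K}) : p != 0 -> countable [set x | p.[x] = 0].
Proof.
move=> p0; have [rs pE] := closed_field_poly_normal p.
apply: (@sub_countable _ _ _ [set` rs]); last exact/finite_set_countable/finite_seq.
apply: subset_card_le => x /= px.
have : root p x by apply/eqP.
by rewrite pE rootZ ?lead_coef_eq0 // root_prod_XsubC.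
Qed.

Lemma common_nonroot (I : countType) (p : I -> {poly K}) :
  (forall i, p i != 0) -> exists x, forall i, (p i).[x] != 0.
Proof.
move=> p0; apply: contrapT => H; apply: K_uncountable.
apply: (@sub_countable _ _ _ (\bigcup_(i in [set: I]) [set x | (p i).[x] = 0])).
  apply: subset_card_le => x _; apply: contrapT => nx; apply: H; exists x => i.
  by apply/eqP => px; apply: nx; exists i.
apply: bigcup_countable; first exact: countableP.
by move=> i _; apply: countable_roots.
Qed.

(* The coordinates are chosen one at a time, keeping for each function a point
   with the coordinates chosen so far at which it does not vanish. *)
Lemma common_nonzero (I : countType) (N : nat) (g : I -> 'rV[K]_N -> K) :
  (forall i, linepoly (g i)) -> (forall i, exists x, g i x != 0) ->
  exists x, forall i, g i x != 0.
Proof.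
move=> lin ex.
suff H n : (n <= N)%N -> exists (y : 'rV[K]_N) (z : I -> 'rV[K]_N),
    forall i, g i (z i) != 0 /\ forall a : 'I_N, (a < n)%N -> z i 0 a = y 0 a.
  have [y [z yz]] := H N (leqnn N); exists y => i.
  have -> : y = z i by apply/rowP => a; rewrite (yz i).2.
  exact: (yz i).1.
elim: n => [_|n IH nN]; first by have [z zP] := choice ex; exists 0, z => i; split.
have [y [z yz]] := IH (ltnW nN); pose b := Ordinal nN.
have [p pE] := choice (fun i => lin i (z i - z i 0 b *: delta_mx 0 b) (delta_mx 0 b)).
have [|x xP] := @common_nonroot I p.
  move=> i; apply/negP => /eqP p0; have := pE i (z i 0 b).
  by rewrite subrK p0 horner0; apply/eqP; have [] := yz i.
exists (y + (x - y 0 b) *: delta_mx 0 b), (fun i => z i - z i 0 b *: delta_mx 0 b + x *: delta_mx 0 b).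
move=> i; split; first by rewrite pE.
move=> a; rewrite ltnS leq_eqVlt => /orP[/eqP ab|an].
  have -> : a = b by apply: val_inj.
  by rewrite !mxE !eqxx !mulr1; ring.
have ne : a == b = false by rewrite -val_eqE /= ltn_eqF.
by rewrite !mxE ne andbF !mulr0 !subr0 !addr0 (yz i).2.
Qed.

Variable s : nat.
Implicit Types (L : 'I_s -> line K) (x : 'rV[K]_(s * (4 + 4))).

Definition first_vec x (i : 'I_s) : 'rV[K]_4 := lsubmx (row i (vec_mx x)).
Definition second_vec x (i : 'I_s) : 'rV[K]_4 := rsubmx (row i (vec_mx x)).
Definition wedge_mx x : 'M[K]_(s, 6) := \matrix_i wedge (first_vec x i) (second_vec x i).

Lemma linepoly_wedge_mx i j : linepoly (fun x => wedge_mx x i j).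
Proof.
have H k : linepoly (fun x => vec_mx x i k).
  by move=> a b; exists ((vec_mx a i k)%:P + vec_mx b i k *: 'X) => y; rewrite !hornerE !mxE mulrC.
apply: (@linepoly_ext _ _ (fun x => let: (a, b) := nth (0, 0)%N pluecker_pairs j in
    first_vec x i 0 (inord a) * second_vec x i 0 (inord b)
  - first_vec x i 0 (inord b) * second_vec x i 0 (inord a))) => [x|]; first by rewrite !mxE.
case: nth => a b; apply: linepolyD; last apply: linepolyN; apply: linepolyM.
all: by apply: (@linepoly_ext _ _ (fun x => vec_mx x i _)) => [x|]; [rewrite !mxE | apply: H].
Qed.

Lemma vec_points (u v : 'I_s -> 'rV[K]_4) : exists x, forall i, first_vec x i = u i /\ second_vec x i = v i.
Proof.
exists (mxvec (\matrix_i row_mx (u i) (v i))) => i.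
by rewrite /first_vec /second_vec mxvecK rowK row_mxKl row_mxKr.
Qed.

(** Needed to compare arbitrary spanning vectors with the bases chosen in [pluecker], whose
    coordinates differ by a scalar for each line. *)
Lemma multihomogeneous_scale (F : {mpoly K[s * 6]}) (c : 'I_s -> K) (M : 'M[K]_(s, 6)) :
  multihomogeneous F -> (forall i, c i != 0) ->
  F.@[mxvec M 0] != 0 -> F.@[mxvec (\matrix_i (c i *: row i M)) 0] != 0.
Proof.
move=> /choice[d dE] c0.
suff -> : F.@[mxvec (\matrix_i (c i *: row i M)) 0] = (\prod_i c i ^+ d i) * F.@[mxvec M 0].
  move=> F0; rewrite mulf_neq0 //; apply/prodf_neq0 => i _; exact: expf_neq0.
rewrite !mevalE mulr_sumr big_seq [RHS]big_seq; apply: eq_bigr => e eF.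
rewrite mulrCA; congr (_ * _).
have reindexM (G : 'I_(s * 6) -> K) : \prod_k G k = \prod_i \prod_j G (mxvec_index i j).
  rewrite pair_bigA (reindex _ (curry_mxvec_bij _ _)) /=.
  by apply: eq_bigr => -[i j].
rewrite !reindexM -big_split /=; apply: eq_bigr => i _.
rewrite -(dE i e eF) -prodrXr -big_split /=; apply: eq_bigr => j _.
by rewrite !mxvecE !mxE exprMn.
Qed.

(** One equation of each closed set that is not identically 0 is pulled back to the affine space of
    s pairs of vectors, where countably many nonzero polynomial functions have a common nonzero
    point over an uncountable field. *)
Lemma closed_union_proper (Z : nat -> set ('I_s -> line K)) :
  (forall k, zariski_closed (Z k) /\ Z k <> setT) -> exists L, forall k, ~ Z k L.
Proof.
move=> HZ.
have /choice[F FP] : forall k, exists F : {mpoly K[s * 6]}, [/\ multihomogeneous F,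
    exists x, F.@[mxvec (wedge_mx x) 0] != 0 &
    forall L, Z k L -> F.@[pluecker_point L] = 0].
  move=> k; have [[S [Smh ZE]] nT] := HZ k.
  have [L nZ] : exists L, ~ Z k L.
    by apply/existsNP => H; apply: nT; apply/seteqP; split.
  move: nZ; rewrite ZE /= => /existsNP[F /not_implyP[SF /eqP FL]]; exists F; split.
  - exact: Smh.
  - have [x xP] := vec_points (fun i => (vbasis (val (L i)))`_0) (fun i => (vbasis (val (L i)))`_1).
    exists x; suff -> : wedge_mx x = \matrix_i pluecker (L i) by [].
    by apply/row_matrixP => i; rewrite !rowK !(xP i).1 !(xP i).2.
  - by move=> L' H; apply: H.
(* The additional functions, one Pluecker coordinate for each pair, ensure that the two vectors of
   each pair span a line. *)
pose g (k : nat + 'I_s) x : K := match k with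
  inl k => (F k).@[mxvec (wedge_mx x) 0] | inr i => wedge_mx x i ord0 end.
have [||x xP] := @common_nonzero (nat + 'I_s)%type _ g.
- case=> [k|i]; last exact: linepoly_wedge_mx.
  apply: (@linepoly_meval K _ _ (F k) (fun l x => mxvec (wedge_mx x) 0 l)) => l.
  have [i j] := mxvec_indexP l.
  apply: (linepoly_ext _ (linepoly_wedge_mx i j)) => x; by rewrite mxvecE.
- case=> [k|i]; first by have [_ [x xP] _] := FP k; exists x.
  have [x xP] := vec_points (fun=> delta_mx 0 i0) (fun=> delta_mx 0 i1); exists x.
  rewrite /g mxE (xP i).1 (xP i).2 mxE /=.
  by rewrite !mxE -!val_eqE /= !inordK // mulr1 mul0r subr0 oner_neq0.
have wn0 i : wedge (first_vec x i) (second_vec x i) != 0.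
  apply: contraNneq (xP (inr i)) => w0; by rewrite /g /wedge_mx mxE w0 mxE.
have fr i : free [:: first_vec x i; second_vec x i].
  apply: free2P => a b E.
  have E1 := wedge_combination a b 0 1 (first_vec x i) (second_vec x i).
  have E2 := wedge_combination 1 0 a b (first_vec x i) (second_vec x i).
  have wz u : wedge 0 u = 0 :> 'rV[K]_6.
    by apply/rowP => k; rewrite !mxE; case: nth => p q; rewrite !mxE; ring.
  have wz' u : wedge u 0 = 0 :> 'rV[K]_6.
    by apply/rowP => k; rewrite !mxE; case: nth => p q; rewrite !mxE; ring.
  move: E1 E2; rewrite E wz wz' => /esym/eqP + /esym/eqP.
  by rewrite !scaler_eq0 (negPf (wn0 i)) !orbF mulr1 mulr0 subr0 mul1r mul0r subr0 => /eqP-> /eqP->.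
have [L LP] := choice (fun i => line_span (fr i)).
have /choice[c cP] : forall i, exists c : K, c != 0 /\ pluecker (L i) = c *: row i (wedge_mx x).
  move=> i; have [u [v [vb fr' lP]]] := line_basis (L i).
  have [a [b uE]] : plane2 (first_vec x i) (second_vec x i) u.
    by apply/LP/lP; exists 1, 0; rewrite scale1r scale0r addr0.
  have [a' [b' vE]] : plane2 (first_vec x i) (second_vec x i) v.
    by apply/LP/lP; exists 0, 1; rewrite scale1r scale0r add0r.
  have pE : pluecker (L i) = wedge u v by rewrite /pluecker vb.
  exists (a * b' - b * a'); rewrite rowK pE uE vE wedge_combination; split=> //.
  apply: contraNneq (wedge_neq0 fr') => z; by rewrite uE vE wedge_combination z scale0r.
exists L => k ZL; have [Fmh _ FZ] := FP k.
have := xP (inl k); rewrite /g /= => /(multihomogeneous_scale Fmh (fun i => (cP i).1)).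
have -> : \matrix_i (c i *: row i (wedge_mx x)) = \matrix_i pluecker (L i).
  by apply/row_matrixP => i; rewrite !rowK (cP i).2 rowK.
by rewrite -/(pluecker_point L) FZ ?eqxx.
Qed.

End VeryGeneral.

(** * Convergence of subadditive sequences *)

Section Fekete.
Variable R : realType.
Variable a : nat -> nat.
Hypothesis a_subadditive : forall m n, (a (m + n) <= a m + a n)%N.

Lemma subadditive_mulnD k p r : (a (k * p + r) <= k * a p + a r)%N.
Proof.
elim: k => [|k IH] //; rewrite !mulSn -!addnA.
by apply: leq_trans (a_subadditive _ _) _; rewrite leq_add2l.
Qed.

(** Fekete's lemma: division of m by p bounds a m / m by a p / p plus an error C / m, so the
    sequence tends to its infimum over m > 0. *)
Lemma subadditive_quotient_cvg : cvg ((fun m => (a m)%:R / m%:R : R) @ \oo).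
Proof.
pose E : set R := [set (a m)%:R / m%:R | m in [set m | (0 < m)%N]].
have E0 : lbound E 0 by move=> _ [m m0 <-]; rewrite divr_ge0.
have Ei : has_inf E by split; [exists (a 1)%:R; exists 1%N; rewrite ?divr1|exists 0].
apply/cvg_ex; exists (inf E); apply/cvgrPdist_lt => e e0.
have e2 : 0 < e / 2 by rewrite divr_gt0.
have [_ [p p0 <-] lt] := inf_adherent e2 Ei.
(* A bound for a at all remainders r < p, from a r <= r a 1 + a 0. *)
pose C : R := (p * a 1 + a 0)%:R.
near=> m.
have m0 : (0 < m)%N by near: m; apply: nbhs_infty_gt.
have mR : 0 < m%:R :> R by rewrite ltr0n.
have lb : inf E <= (a m)%:R / m%:R by apply: ge_inf; [exists 0|exists m].
have CM : C < m%:R * (e / 2).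
  rewrite -ltr_pdivrMr //; near: m; apply: nbhs_infty_gtr.
rewrite ler0_norm ?subr_le0 // opprB ltrBlDl.
have le : (a m)%:R <= m%:R * ((a p)%:R / p%:R) + C :> R.
  have h1 : (a m <= m %/ p * a p + (p * a 1 + a 0))%N.
    rewrite [X in a X](divn_eq m p); apply: leq_trans (subadditive_mulnD _ _ _) _.
    rewrite leq_add2l -[X in a X](muln1 (m %% p)%N) -[X in a X]addn0.
    apply: leq_trans (subadditive_mulnD _ _ _) _.
    by rewrite leq_add2r leq_mul2r ltnW ?orbT // ltn_pmod.
  apply: (@le_trans _ _ ((m %/ p * a p + (p * a 1 + a 0))%N)%:R); first by rewrite ler_nat.
  rewrite natrD lerD2r natrM mulrA mulrAC ler_wpM2r // ler_pdivlMr ?ltr0n //.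
  by rewrite -natrM ler_nat leq_divM.
rewrite ltr_pdivrMr //; apply: le_lt_trans le _.
apply: (@lt_le_trans _ _ (m%:R * ((a p)%:R / p%:R) + m%:R * (e / 2))).
  by rewrite ltrD2l.
rewrite -mulrDr mulrC ler_wpM2r // ltW //.
apply: (@lt_le_trans _ _ (inf E + e / 2 + e / 2)); first by rewrite ltrD2r.
by rewrite -addrA -splitr addrC.
Unshelve. all: by end_near.
Qed.

End Fekete.

(** * The Waldschmidt constant of very general lines *)

Section Generic.
Variable K : closedFieldType.
Hypothesis K_char0 : [pchar K] =i pred0.
Hypothesis K_uncountable : ~ countable [set: K].
Variable s : nat.
Implicit Types (L : 'I_s -> line K).

Lemma closed_set0 : zariski_closed (set0 : set ('I_s -> line K)).
Proof.
exists [set 1%:MP]; split; first by move=> _ -> i; exists 0%N => e /groupedC; apply.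
by apply/seteqP; split=> // L /(_ _ erefl) /eqP; rewrite mevalC oner_eq0.
Qed.

(** The maximum exists since the initial degree is at most s m. *)
Lemma generic_alpha_ex m : exists v : nat,
  [/\ exists L, alpha L m = v, forall L, (alpha L m <= v)%N &
      zariski_closed [set L : 'I_s -> line K | (alpha L m < v)%N]].
Proof.
have [l0 _] := @line_ex K.
have ex : exists n, `[< exists L : 'I_s -> line K, alpha L m = n >].
  by exists (alpha (fun _ : 'I_s => l0) m); apply/asboolP; exists (fun=> l0).
have [|v /asboolP vL vmax] := ex_maxnP ex (m := s * m).
  by move=> n /asboolP[L <-]; apply: alpha_le.
exists v; split=> //; first by move=> L; apply: vmax; apply/asboolP; exists L.
(* An initial degree at most v means that there is a form of degree exactly v, because multiplying
   by x0 preserves vanishing; for the maximum 0 the set is empty. *)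
case: v {vL vmax} => [|v].
  by rewrite (_ : [set _ | _] = set0) //; [exact: closed_set0|apply/seteqP; split].
rewrite (_ : [set _ | _] = [set L | has_form L m v]); first exact: closed_has_form.
apply/seteqP; split=> L /=; have [h1 h2] := alphaP K_char0 L m.
  by rewrite ltnS => le; apply: has_form_le h1.
by move=> /h2.
Qed.


Lemma waldschmidt_linesE (R : realType) : exists v : nat -> nat,
  [/\ forall m L, (alpha L m <= v m)%N, forall m n, (v (m + n) <= v m + v n)%N &
      waldschmidt_lines R K s = lim ((fun m => (v m)%:R / m%:R : R) @ \oo)].
Proof.
have [v vP] := choice generic_alpha_ex.
pose Z m : set ('I_s -> line K) := [set L | (alpha L m < v m)%N].
have ZP m : zariski_closed (Z m) /\ Z m <> setT.
  have [[L Lm] _ cl] := vP m; split=> // ZT.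
  have : Z m L by rewrite ZT.
  by rewrite /Z /= Lm ltnn.
have offZ L : ~ (\bigcup_k Z k) L -> alpha L = v.
  move=> nZ; apply/funext => m; apply/eqP; rewrite eqn_leq; have [_ -> _] := vP m.
  by rewrite leqNgt; apply/negP => lt; apply: nZ; exists m.
exists v; split; first by move=> m L; have [_ ->] := vP m.
  have [L nZ] := closed_union_proper K_uncountable ZP.
  have <- : alpha L = v by apply: offZ => -[k _]; apply: nZ.
  exact: alphaD.
apply: xget_unique.
  by exists Z; split=> // L /offZ <-.
move=> c [Z' [Z'P c']].
(* Interleaving the two countable families yields lines outside both unions, so any other candidate
   for the constant agrees with the limit of v. *)
pose Y k := if odd k then Z k./2 else Z' k./2.
have [|L nY] := @closed_union_proper K K_uncountable s Y.
  by move=> k; rewrite /Y; case: ifP.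
have nZ : ~ (\bigcup_k Z k) L.
  by move=> [k _ Zk]; apply: (nY k.*2.+1); rewrite /Y /= odd_double /= uphalf_double.
rewrite -(offZ L nZ); apply/esym/c' => -[k _ Zk]; apply: (nY k.*2).
by rewrite /Y odd_double doubleK.
Qed.

End Generic.

Theorem theorem4 (R : realType) (K : closedFieldType)
    (K_char0 : [pchar K] =i pred0) (K_uncountable : ~ countable [set: K])
    (s : nat) (s_ge1 : (1 <= s)%N) (s_excl : s \notin [:: 4; 7; 10]%N) :
  (Num.floor (Num.sqrt (5 / 2 * s%:R : R)))%:~R <= waldschmidt_lines R K s.
Proof.
set r := Num.sqrt _.
have [q qE] : exists q : nat, Num.floor r = q%:Z.
  by case E : (Num.floor r) => [q|q]; [exists q|have := sqrtr_ge0 (5 / 2 * s%:R : R); rewrite -floor_ge0 -/r E].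
have s0 : 0 <= 5 / 2 * s%:R :> R by rewrite mulr_ge0 // divr_ge0.
have qr : q%:R <= r by have := Num.Theory.floor_le r; rewrite qE.
have q2 : (2 * q ^ 2 <= 5 * s)%N.
  have h : q%:R ^+ 2 <= 5 / 2 * s%:R :> R by rewrite -[leRHS]sqr_sqrtr // lerXn2r ?nnegrE // sqrtr_ge0.
  rewrite -(ler_nat R) !natrM; rewrite expr2 in h; lra.
rewrite qE; have [v [vmax vD ->]] := waldschmidt_linesE K_char0 K_uncountable s R.
apply: limr_ge; first exact: subadditive_quotient_cvg.
near=> m.
have m0 : (0 < m)%N by near: m; apply: nbhs_infty_gt.
rewrite ler_pdivlMr ?ltr0n // -[_ * _]natrM ler_nat.
have [->|q0] := posnP q; first by rewrite mul0n.
(* The lines depend on m; it is enough that their initial degree bounds the maximum [v m] from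
   below. *)
have [L LP] := lines_of_high_alpha K_char0 m q0 (realizable_ex K_char0 q0 q2 s_excl).
exact: leq_trans LP (vmax m L).
Unshelve. all: by end_near.
Qed.
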